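(* Let $K$ be a separably closed field, $t$ transcendental over $K$, and $f\in K[x]$ a polynomial of degree $d\ge2$, with either $\mathrm{char}(K)=0$ or $\mathrm{char}(K)$ not dividing the local degree of any point of $\mathbb{P}^1_K$. If $\#(\Upsilon_f\cap K)\le1$, then $G_\infty(K,f,t)$, regarded as a subgroup of $\mathrm{Aut}(T)$ via the labeling $\phi$, is mixing.
   Context: Setting: $f^{-n}(t)$ the set of $s$ in a separable closure of $K(t)$ with $f^n(s)=t$; $K_\infty(f,t)=K(t)(\bigcup_nf^{-n}(t))$, $G=G_\infty(K,f,t)=\mathrm{Gal}(K_\infty(f,t)/K(t))$. Labeling: $T$ the tree of words over $X=\{1,\dots,d\}$; fix a bijection $i\mapsto t_i$, $X\to f^{-1}(t)$, and $K$-isomorphisms $\lambda_i$ from the separable closure of $K(t)$ to one of $K(t_i)$ with $\lambda_i(t)=t_i$; $\phi(t)=\emptyset$, $\phi(s)=i\,\phi(\lambda_i^{-1}(s))$ for $s\in f^{-(n+1)}(t)$ with $f^n(s)=t_i$. Tree notation: sections $g|_v$ (unique automorphism with $(vw)^g=v^gw^{g|_v}$), $\pi_m$ restriction to first $m$ levels, $\mathrm{st}_G(v)$, $\mathrm{St}_G(n)$ stabilizers, $H_v^m=\{\pi_m(h|_v):h\in\mathrm{st}_H(v)\}$, $H_v=\{h|_v: h\in\mathrm{st}_H(v)\}$. $G$ is fractal if $g|_v\in G$ for all $g,v$, $G$ is transitive on each level and $G_v=G$ for all $v$; fractal $G$ is mixing if for every $n\ge1$, $u$ at level $n$, $k\ge1$,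 $\mathrm{St}_G(n)$ is transitive on $\{uw:|w|=k\}$, and for all $n,m\ge1$ there is $N(m)\ge0$ with $\mathrm{St}_G(n)_v^m=\pi_m(G)$ for all $|v|\ge n+N(m)$. Critical data: $e_f$ local degree, $C_f=\{z\in\mathbb{P}^1_K:e_f(z)\ge2\}$, $P_f=\bigcup_{n\ge1}f^n(C_f)$; $\Upsilon_f$ is the maximal subset $\Upsilon\subseteq P_f$ with $\Upsilon=f^{-1}(\Upsilon)\setminus((C_f\cup P_f)\setminus\Upsilon)$. *)

(* Defs.v *)
From HB Require Import structures.
From mathcomp Require Import all_boot all_order all_algebra all_field.
From mathcomp Require Import all_classical.
Set Implicit Arguments.
Unset Strict Implicit.
Unset Printing Implicit Defensive.
Import GRing.Theory.
Local Open Scope classical_set_scope.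
Local Open Scope ring_scope.

(* Groups of automorphisms of the tree of words over a finite alphabet X.     *)
(* The vertices are the words, the level of a word is its size, and the       *)
(* children of v are the rcons v x.                                           *)
Section Trees.
Variable X : finType.
Implicit Types (g : seq X -> seq X) (v w : seq X).
Implicit Types G H : set (seq X -> seq X).

Definition tree_aut g : Prop :=
  [/\ bijective g, forall w, size (g w) = size w
    & forall v w, prefix v w -> prefix (g v) (g w)].

(* The section g|_v; see section_cat. *)
Definition section g v : seq X -> seq X := fun w => drop (size v) (g (v ++ w)).

Lemma section_cat g v w : tree_aut g -> g (v ++ w) = g v ++ section g v w.
Proof.
case=> _ sz_g pre_g; rewrite /section.
have /prefixP[s ->] : prefix (g v) (g (v ++ w)) by apply/pre_g/prefix_prefix.
by rewrite -(sz_g v) drop_size_cat.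
Qed.

Lemma section_uniq g v h :
  (forall w, g (v ++ w) = g v ++ h w) -> tree_aut g -> h = section g v.
Proof.
move=> gE ag; apply/funext => w; have := gE w.
by rewrite (section_cat _ _ ag) => /eqP; rewrite eqseq_cat // eqxx => /eqP.
Qed.

(* The words of size m form the last of the first m levels. *)
Definition trunc (m : nat) g := sigL [set w | (size w <= m)%N] g.
Arguments trunc m g : clear implicits.

Definition vertex_stab G v : set (seq X -> seq X) := [set g | G g /\ g v = v].

Definition level_stab G (n : nat) : set (seq X -> seq X) :=
  [set g | G g /\ forall v, size v = n -> g v = v].

Definition sections_at H v : set (seq X -> seq X) :=
  [set section h v | h in vertex_stab H v].

Definition level_transitive G : Prop :=
  forall v w, size v = size w -> exists2 g, G g & g v = w.

Definition fractal G : Prop :=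
  [/\ forall g v, G g -> G (section g v), level_transitive G
    & forall v, sections_at G v = G].

(* The bound N depends on m, but not on n. *)
Definition mixing G : Prop :=
  [/\ fractal G,
      forall (n k : nat) u, (1 <= n)%N -> (1 <= k)%N -> size u = n ->
        forall w1 w2, size w1 = k -> size w2 = k ->
          exists2 g, level_stab G n g & g (u ++ w1) = u ++ w2
    & forall m : nat, (1 <= m)%N -> exists N : nat,
        forall (n : nat) v, (1 <= n)%N -> (n + N <= size v)%N ->
          trunc m @` sections_at (level_stab G n) v = trunc m @` G].
End Trees.

Section Subfields.
Variable L : fieldType.
Implicit Types A E : set L.

Definition is_subfield (S : set L) : Prop :=
  [/\ S 1, forall x y, S x -> S y -> S (x - y)
    & forall x y, S x -> S y -> S (x / y)].

Definition gen_subfield A : set L := smallest is_subfield A.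

Lemma gen_subfield_closed A : is_subfield (gen_subfield A).
Proof.
split; first by move=> S [[S1 _ _] _].
- by move=> x y Ax Ay S SA; have [[_ SB _] _] := SA; apply: SB; [exact: Ax|exact: Ay].
- by move=> x y Ax Ay S SA; have [[_ _ SV] _] := SA; apply: SV; [exact: Ax|exact: Ay].
Qed.

Definition in_gen_subfield A : pred L := fun x => `[< gen_subfield A x >].

Lemma in_gen_subfield_divring A : divring_closed (in_gen_subfield A).
Proof.
have [A1 AB AV] := gen_subfield_closed A.
split; first by apply/asboolP.
- by move=> x y; rewrite !unfold_in => /asboolP Ax /asboolP Ay; apply/asboolP; exact: AB.
- by move=> x y; rewrite !unfold_in => /asboolP Ax /asboolP Ay; apply/asboolP; exact: AV.
Qed.

HB.instance Definition _ A :=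
  GRing.isDivringClosed.Build L (in_gen_subfield A) (in_gen_subfield_divring A).

Record gen_field A := GenField {
  gen_field_val :> L;
  gen_field_valP : gen_field_val \in in_gen_subfield A }.

HB.instance Definition _ A := [isSub for @gen_field_val A].
HB.instance Definition _ A := [Choice of gen_field A by <:].
HB.instance Definition _ A := [SubChoice_isSubIntegralDomain of gen_field A by <:].
HB.instance Definition _ A := [SubIntegralDomain_isSubField of gen_field A by <:].

Definition separably_closed : Prop :=
  forall p : {poly L}, separable_poly p -> (1 < size p)%N -> exists x, root p x.

Definition separable_algebraic_over E : Prop :=
  forall x : L, exists p : {poly L},
    [/\ forall k : nat, E p`_k, separable_poly p & root p x].

Definition is_separable_closure_of E : Prop :=
  separably_closed /\ separable_algebraic_over E.
End Subfields.

(* The ambient field L is a separable closure of K(t). *)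
Section IteratedMonodromy.
Variables (K L : fieldType) (iota : {rmorphism K -> L}) (t : L) (f : {poly K}).

Definition feval (s : L) : L := (map_poly iota f).[s].

Definition iter_fiber (n : nat) : set L := [set s | iter n feval s = t].

Definition Kt : set L := gen_subfield (range iota `|` [set t]).

Definition Kinfty_gens : set L := Kt `|` \bigcup_n iter_fiber n.

Notation Kinfty := (gen_field Kinfty_gens).

Definition in_Galois (sigma : {rmorphism Kinfty -> Kinfty}) : Prop :=
  bijective sigma /\ forall x : Kinfty, Kt (val x) -> sigma x = x.

(* A separable closure of K(t_i) containing the roots of f^n(s) = t_i for all *)
(* n can be taken to be L, so that the lambda_i are automorphisms of L over K.*)
Record labeling (d : nat) := Labeling {
  lab_root : 'I_d -> L;
  lab_rootP : set_bij [set: 'I_d] (iter_fiber 1) lab_root;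
  lab_iso : 'I_d -> {rmorphism L -> L};
  lab_inv : 'I_d -> L -> L;
  lab_isoK : forall i, cancel (lab_iso i) (lab_inv i);
  lab_invK : forall i, cancel (lab_inv i) (lab_iso i);
  lab_iso_fix : forall i c, lab_iso i (iota c) = iota c;
  lab_iso_t : forall i, lab_iso i t = lab_root i }.

Section Action.
Variables (d : nat) (lam : labeling d).

(* phi on the n-th fiber; the value is junk for s not in iter_fiber n. *)
Fixpoint label (n : nat) (s : L) : seq 'I_d :=
  if n is n'.+1 then
    if [pick i | iter n' feval s == lab_root lam i] is Some i
    then i :: label n' (lab_inv lam i s) else [::]
  else [::].

Definition Ginfty : set (seq 'I_d -> seq 'I_d) :=
  [set g | tree_aut g /\ exists2 sigma, in_Galois sigma &
     forall (n : nat) (s : Kinfty), iter_fiber n (val s) ->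
       g (label n (val s)) = label n (val (sigma s))].
End Action.
End IteratedMonodromy.

(* Critical data. For K separably closed, an algebraic closure Kb of K is     *)
(* purely inseparable over K, so the closed points of the scheme P^1_K are    *)
(* the elements of option Kb, None being the point at infinity. Over an       *)
(* imperfect K, a wild critical point need not be K-rational.                 *)
Section CriticalData.
Variables (K : fieldType) (Kb : closedFieldType) (j : {rmorphism K -> Kb}).
Variable f : {poly K}.

Local Notation fb := (map_poly j f).

Definition is_algebraic_closure : Prop := forall x : Kb, algebraicOver j x.

Definition P1map (z : option Kb) : option Kb := omap (fun x => fb.[x]) z.

Definition local_degree (z : option Kb) : nat :=
  if z is Some x then mup x (fb - (fb.[x])%:P) else (size fb).-1.

Definition crit : set (option Kb) := [set z | (2 <= local_degree z)%N].

Definition postcrit : set (option Kb) :=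
  \bigcup_(n in [set n : nat | (1 <= n)%N]) (iter n P1map @` crit).

Definition Upsilon_eq (U : set (option Kb)) : Prop :=
  U `<=` postcrit /\ U = (P1map @^-1` U) `\` ((crit `|` postcrit) `\` U).

Definition Upsilon : set (option Kb) := \bigcup_(U in Upsilon_eq) U.

Lemma Upsilon_max : Upsilon_eq Upsilon /\ forall U, Upsilon_eq U -> U `<=` Upsilon.
Proof.
split; last by move=> U HU z Uz; exists U.
split; first by move=> z [U [UP _] Uz]; apply: UP.
apply/seteqP; split=> [z|z].
  move=> [U HU Uz]; split; last by case=> _; apply; exists U.
  by have := Uz; rewrite {1}HU.2 => -[fUz _]; exists U.
case=> -[U HU fUz] nz.
have [//|nUz] := pselect (Upsilon z).
exists U => //; rewrite HU.2; split=> // -[CPz _].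
by apply: nz.
Qed.

Definition Upsilon_K : set K := [set c | Upsilon (Some (j c))].

Definition tame : Prop :=
  [pchar K] =i pred0 \/
  exists2 p : nat, p \in [pchar K] & forall z, ~~ (p %| local_degree z)%N.
End CriticalData.

(* Main.v *)
(* G is the action of the K(t)-automorphisms of L on the points of the fibers f^-n(t),   *)
(* and inertia groups are computed with places L -> P^1(Kb) over K.                      *)
(*   At t = oo, f is totally and tamely ramified: an inertia element that fixes one      *)
(* point of a level fixes the level, because the ratio of two of its points reduces to   *)
(* a root of unity. Hence St_G(n) is transitive on the descendants of a vertex u.        *)
(*   For the second condition let s_k be the vertex of level k on the path to v, and     *)
(* consider the cover of the s_k-line that corresponds to the subgroup coset_fix, the    *)
(* product of St_G(n) and the stabilizer of the first m levels below v. It is unramified *)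
(* over oo by the above. Suppose that it ramifies over z; then over a noncritical        *)
(* preimage of z the cover of the s_(k+1)-line ramifies, and going on up to level        *)
(* |v| + m all preimages of z are critical or postcritical. The same holds for f^i(z),   *)
(* i <= k - n, since the cover of the s_(k-i)-line ramifies over f^i(z). For k = |v| - 1 *)
(* only finitely many z, depending on m, are concerned, so if |v| - n is large then the  *)
(* whole forward orbit of z has this property and z lies in Upsilon. Therefore the cover *)
(* has at most one branch point, which is K-rational by tameness, and it is trivial      *)
(* since P^1 has no tame cover with a single branch point.                               *)

Require Import Defs.
From HB Require Import structures.
From mathcomp Require Import all_boot all_order all_algebra all_fingroup all_field.
From mathcomp Require Import cyclic pgroup all_classical ring.
Set Implicit Arguments.
Unset Strict Implicit.
Unset Printing Implicit Defensive.
Import GRing.Theory.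
Local Open Scope classical_set_scope.
Local Open Scope ring_scope.

(** The proof works with K-automorphisms of L instead of tree automorphisms, and with places L ->
    P^1(F) over K ([place]) instead of points on covering curves. Places exist by [place_extension].
    Two places with the same value at a point [vert u] of the tree are conjugate, on each finite
    level, under the automorphisms that fix [vert u] ([conjugate_places], [conjugate_places_vert]).
    [mixing_Ginfty] translates mixing into transitivity of automorphisms on levels, transitivity of
    level stabilizers below a vertex, and an approximation property of the stabilizer of a long word
    v.

    Transitivity comes from t = oo: comparing pole orders gives [Aut_transitive], and since tame
    inertia at oo that fixes one point of a level fixes the whole level ([inertia_infinity]), the
    automorphism can be chosen to fix that level ([level_fix_transitive]).

    The approximation property says that every automorphism fixing v lies in [coset_fix]. That group
    is normalized by the stabilizer of the ancestor of v at level n ([coset_fix_normal]), so it cuts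
    out a Galois cover of the line whose coordinate is the parent of v. Ramification moves towards v
    along noncritical preimages ([ramified_lift]) and towards the root by inclusion of groups
    ([ramified_le]); hence for |v| - n large all branch points lie in Upsilon
    ([Upsilon_backward_bound]), and there is at most one. Wild inertia is trivial
    ([wild_inertia_trivial]), so the cover is tame and [tame_line_cover_trivial] makes it trivial;
    this is [stage_trivial].

    The triviality of a tame cover of P^1 with one branch point is obtained by duality for the trace
    form. The functions on the cover have a basis adapted to w = oo ([minimal_basis]); the dual of a
    basis element with a pole at oo would be regular everywhere and vanish at oo. *)

Lemma ideal_generator (F : fieldType) (J : set {poly F}) (k : set F) :
    J 0 -> (forall p q, J p -> J q -> J (p - q)) ->
    (forall c i p, k c -> J p -> J (c *: 'X^i * p)) ->
    (forall p, J p -> k (lead_coef p)) ->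
    (forall a b, k a -> k b -> k (a / b)) ->
  exists2 q, J q & forall p, J p -> q %| p.
Proof.
move=> J0 JB JM Jlc kV.
have [allz|] := pselect (forall p, J p -> p = 0).
  by exists 0 => // p /allz ->.
move=> /existsNP[p0 /not_implyP[Jp0 /eqP p0N0]].
have exn : exists n, `[< exists2 q, J q & q != 0 /\ size q = n >].
  by exists (size p0); apply/asboolP; exists p0.
case: (ex_minnP exn) => n /asboolP[q Jq [qN0 sq]] minn; exists q => //.
move=> p; have [m] := ubnP (size p).
elim: m p => // m IH p lt_pm Jp.
have [->|pN0] := eqVneq p 0; first exact: dvdp0.
have le_qp : (size q <= size p)%N.
  by rewrite sq; apply: minn; apply/asboolP; exists p.
(* Euclidean division by an element of least degree: leading terms are cancelled with monomials over
   [k] only, while the conclusion is divisibility over F. *)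
pose c := lead_coef p / lead_coef q; pose i := (size p - size q)%N.
pose r := c *: 'X^i * q.
have Jr : J r by apply: JM => //; apply: kV; apply: Jlc.
have cN0 : c != 0 by rewrite mulf_neq0 ?invr_eq0 ?lead_coef_eq0.
have sr : size r = size p.
  rewrite /r -scalerAl size_scale // mulrC size_Mmonic ?monicXn //.
  by rewrite size_polyXn addnS /= addnC subnK.
have lr : lead_coef r = lead_coef p.
  rewrite /r -scalerAl lead_coefZ lead_coefM lead_coefXn mul1r.
  by rewrite /c divfK ?lead_coef_eq0.
have lt : (size (p - r)%R < size p)%N.
  rewrite (polySpred pN0) ltnS; apply/leq_sizeP => l.
  rewrite leq_eqVlt => /predU1P[<-|lt_l].
    by rewrite coefB -lead_coefE -{1}sr -lead_coefE lr subrr.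
  rewrite coefB !nth_default ?subrr // ?sr; by rewrite (polySpred pN0).
have /IH dv : (size (p - r)%R < m)%N by apply: leq_trans lt _; rewrite -ltnS.
rewrite -(subrK r p) dvdp_add ?dvdp_mull //.
by apply: dv; apply: JB.
Qed.

(** * Extension of ring homomorphisms *)

Section RingGraphs.
Variables L F : fieldType.
Implicit Types (G : set (L * F)) (P : {poly L * F}).

(* The graph of a ring homomorphism from a subring of L to F. *)
Definition ring_graph G : Prop :=
  [/\ G 1, forall u v, G u -> G v -> G (u - v), forall u v, G u -> G v -> G (u * v)
    & forall b, G (0, b) -> b = 0].

Definition max_graph G : Prop :=
  ring_graph G /\ forall G', ring_graph G' -> G `<=` G' -> G' `<=` G.

Lemma ring_graph0 G : ring_graph G -> G 0.
Proof. by case=> G1 GB _ _; rewrite -(subrr 1); apply: GB. Qed.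

Lemma ring_graphN G u : ring_graph G -> G u -> G (- u).
Proof. by move=> gG; rewrite -sub0r; case: (gG) => _ GB _ _ Gu; apply: GB => //; exact: ring_graph0. Qed.

Lemma ring_graphD G u v : ring_graph G -> G u -> G v -> G (u + v).
Proof.
move=> gG Gu Gv; rewrite -[v]opprK; case: (gG) => _ GB _ _.
by apply: GB => //; apply: ring_graphN.
Qed.

Lemma ring_graphX G u n : ring_graph G -> G u -> G (u ^+ n).
Proof.
case=> G1 _ GM _ Gu; elim: n => [|n IH]; first by rewrite expr0.
by rewrite exprS; apply: GM.
Qed.

Lemma ring_graph_sum G (I : Type) (r : seq I) (f : I -> L * F) :
  ring_graph G -> (forall i, G (f i)) -> G (\sum_(i <- r) f i).
Proof.
move=> gG Gf; apply: big_ind => //; first exact: ring_graph0.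
by move=> u v; apply: ring_graphD.
Qed.

Lemma ring_graph_inj G a b b' : ring_graph G -> G (a, b) -> G (a, b') -> b = b'.
Proof.
case=> _ GB _ G0 Gb Gb'; apply/eqP; rewrite -subr_eq0; apply/eqP/G0.
by rewrite -(subrr a); apply: (GB _ _ Gb Gb').
Qed.

Lemma ring_graph_Zorn G : ring_graph G -> exists2 G', G `<=` G' & max_graph G'.
Proof.
move=> gG; pose Q X := X = set0 \/ ring_graph X /\ G `<=` X.
have [|A [QA maxA]] := @Zorn_bigcup (L * F)%type Q.
  move=> C CQ totC.
  have [allz|] := pselect (forall X, C X -> X = set0).
    by left; rewrite bigcup0.
  move=> /existsNP[X0 /not_implyP[CX0 X0N]]; right.
  have gC X : C X -> X !=set0 -> ring_graph X /\ G `<=` X.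
    by move=> CX /set0P XN; have [X0'|//] := CQ _ CX; rewrite X0' eqxx in XN.
  have [gX0 GX0] : ring_graph X0 /\ G `<=` X0.
    by apply: gC => //; apply/set0P/eqP.
  have dir u v : (\bigcup_(X in C) X) u -> (\bigcup_(X in C) X) v ->
      exists X, [/\ C X, ring_graph X, X u & X v].
    move=> [X CX Xu] [Y CY Yv].
    have [gX _] := gC _ CX (ex_intro _ _ Xu).
    have [gY _] := gC _ CY (ex_intro _ _ Yv).
    by have [sXY|sYX] := totC _ _ CX CY; [exists Y|exists X]; split=> //; [apply: sXY|apply: sYX].
  split; last by move=> u Gu; exists X0 => //; apply: GX0.
  split; first by exists X0 => //; case: gX0.
  - by move=> u v /dir/[apply] [[X [CX [_ XB _ _] Xu Xv]]]; exists X => //; apply: XB.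
  - by move=> u v /dir/[apply] [[X [CX [_ _ XM _] Xu Xv]]]; exists X => //; apply: XM.
  - by move=> b Ub; have [X [_ [_ _ _ X0'] /X0']] := dir _ _ Ub Ub.
have G1 : G 1 by case: gG.
have [A0|[gA GA]] := QA.
  have ltAG : A `<` G by rewrite A0; split => [|/(_ _ G1)//]; exact: sub0set.
  by case: (maxA _ ltAG); right; split => // u.
exists A => //; split=> // G' gG' AG'; apply: contrapT => G'A.
have ltAG : A `<` G' by [].
by case: (maxA _ ltAG); right; split => //; exact: subset_trans AG'.
Qed.

(** A polynomial over the domain and its image under the homomorphism are kept together as one
    polynomial over the product ring L * F. *)
Definition over_graph G P : Prop := forall i, G P`_i.

Lemma over_graphB G P Q : ring_graph G ->
  over_graph G P -> over_graph G Q -> over_graph G (P - Q).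
Proof. by move=> [_ GB _ _] GP GQ i; rewrite coefB; apply: GB. Qed.

Lemma over_graphM G P Q : ring_graph G ->
  over_graph G P -> over_graph G Q -> over_graph G (P * Q).
Proof.
move=> gG GP GQ i; rewrite coefM; apply: ring_graph_sum => // l.
by case: gG => _ _ GM _; apply: GM.
Qed.

Lemma over_graphC G u : ring_graph G -> G u -> over_graph G u%:P.
Proof. by move=> gG Gu i; rewrite coefC; case: eqP => // _; apply: ring_graph0. Qed.

Lemma over_graphX G : ring_graph G -> over_graph G 'X.
Proof.
by move=> gG i; rewrite coefX; case: eqP => _; [case: gG|apply: ring_graph0].
Qed.

Definition adjoin_graph G (u : L * F) : set (L * F) :=
  [set v | exists2 P, over_graph G P & v = P.[u]].

Lemma adjoin_graphP G u :
    ring_graph G ->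
    (forall P, over_graph G P -> P.[u].1 = 0 -> P.[u].2 = 0) ->
  [/\ ring_graph (adjoin_graph G u), G `<=` adjoin_graph G u & adjoin_graph G u u].
Proof.
move=> gG H; split; first split.
- by exists 1; [rewrite -polyC1; apply: over_graphC => //; case: gG|rewrite hornerC].
- move=> v w [P GP ->] [Q GQ ->]; exists (P - Q); last by rewrite hornerD hornerN.
  exact: over_graphB.
- move=> v w [P GP ->] [Q GQ ->]; exists (P * Q); last by rewrite hornerM.
  exact: over_graphM.
- by move=> b [P GP Pb]; have := H P GP; rewrite -Pb => /(_ erefl).
- by move=> v Gv; exists v%:P; rewrite ?hornerC //; apply: over_graphC.
- by exists 'X; rewrite ?hornerX //; apply: over_graphX.
Qed.

Lemma max_graph_adjoin G u : max_graph G ->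
  (forall P, over_graph G P -> P.[u].1 = 0 -> P.[u].2 = 0) -> G u.
Proof.
move=> [gG mG] H; have [g s] := adjoin_graphP gG H; exact: mG.
Qed.

(** The domain of a maximal homomorphism is a local ring. A polynomial expression in the inverse,
    multiplied by a power of (a, b), is an element of G, so its second component vanishes with its
    first. *)
Lemma max_graphV G a b : max_graph G -> G (a, b) -> b != 0 -> G (a^-1, b^-1).
Proof.
move=> mG Gab b0; have [gG _] := mG.
have a0 : a != 0.
  by apply: contra b0 => /eqP a0; rewrite a0 in Gab; case: gG => _ _ _ /(_ _ Gab) ->.
apply: max_graph_adjoin => // P GP P0; set u := (a^-1, b^-1).
have uX : (a, b) * u = 1 by rewrite /u; congr pair; rewrite /= divff.
have : G ((a, b) ^+ (size P) * P.[u]).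
  rewrite horner_coef mulr_sumr; apply: ring_graph_sum => // i.
  have -> : (a, b) ^+ size P * (P`_i * u ^+ i) = P`_i * (a, b) ^+ (size P - i).
    rewrite -{1}(subnK (ltnW (ltn_ord i))) exprD mulrCA; congr (_ * _).
    by rewrite -mulrA -exprMn uX expr1n mulr1.
  by case: (gG) => _ _ GM _; apply: GM => //; apply: ring_graphX.
case: gG => _ _ _ G0; move: P0; case: (P.[u]) => x y /= ->.
have -> : (a, b) ^+ size P * (0, y) = (0, b ^+ size P * y).
  have e n : (a, b) ^+ n = (a ^+ n, b ^+ n).
    by elim: n => [|n IH]; rewrite ?expr0 // !exprS IH.
  by rewrite e; congr pair; rewrite /= mulr0.
move/G0/eqP; rewrite mulf_eq0 expf_eq0 (negPf b0) andbF /= => /eqP //.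
Qed.

(** The reductions of the equations of x over the domain of G; x can be sent to b when b is a common
    root of them. *)
Definition relations G (x : L) : set {poly F} :=
  [set p | exists2 P, over_graph G P & (map_poly fst P).[x] = 0 /\ p = map_poly snd P].

Lemma horner_fst P u : P.[u].1 = (map_poly fst P).[u.1].
Proof. by rewrite -(horner_map fst). Qed.

Lemma horner_snd P u : P.[u].2 = (map_poly snd P).[u.2].
Proof. by rewrite -(horner_map snd). Qed.

Lemma max_graph_root G x b : max_graph G ->
  (forall p, relations G x p -> root p b) -> G (x, b).
Proof.
move=> mG H; apply: max_graph_adjoin => // P GP.
rewrite horner_fst horner_snd /= => P0; apply/eqP/H; by exists P.
Qed.

(** By [max_graphV] the values of a maximal homomorphism form a field, over which the relations are
    an ideal. *)
Lemma relations_generator G x : max_graph G ->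
  exists2 q, relations G x q & forall p, relations G x p -> q %| p.
Proof.
move=> mG; have [gG _] := mG.
apply: (@ideal_generator _ _ [set b | exists a, G (a, b)]).
- exists 0; last by rewrite !rmorph0 horner0.
  by move=> i; rewrite coef0; apply: ring_graph0.
- move=> _ _ [P GP [P0 ->]] [Q GQ [Q0 ->]]; exists (P - Q); first exact: over_graphB.
  by rewrite !rmorphB /= hornerD hornerN P0 Q0 subrr.
- move=> c i _ [a Gac] [P GP [P0 ->]]; exists ((a, c)%:P * 'X^i * P).
    apply: over_graphM => //; apply: over_graphM => //; first exact: over_graphC.
    by move=> l; rewrite coefXn; case: eqP => _; [case: gG|apply: ring_graph0].
  rewrite !rmorphM /= !map_polyC !map_polyXn /= hornerM P0 mulr0; split => //.
  by rewrite -mul_polyC.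
- move=> _ [P GP [P0 ->]]; exists (P`_(size (map_poly snd P)).-1).1.
  rewrite lead_coefE coef_map /=; move: (GP (size (map_poly snd P)).-1).
  by case: (P`__).
- move=> a b [a' Ga] [b' Gb]; have [->|b0] := eqVneq b 0.
    by exists 0; rewrite invr0 mulr0; apply: ring_graph0.
  exists (a' / b'); case: gG => _ _ GM _.
  by apply: (GM (_, _) (_, _)) => //; apply: max_graphV.
Qed.

End RingGraphs.

Section RingMorphisms.
Variables (R S : nzRingType) (f : R -> S).
Hypotheses (fB : zmod_morphism f) (fM : monoid_morphism f).

HB.instance Definition _ := GRing.isZmodMorphism.Build R S f fB.
HB.instance Definition _ := GRing.isMonoidMorphism.Build R S f fM.

Definition mk_rmorphism : {rmorphism R -> S} := f.
End RingMorphisms.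

Definition rcomp (R : nzRingType) (s u : {rmorphism R -> R}) : {rmorphism R -> R} :=
  s \o u.

Definition rid (R : nzRingType) : {rmorphism R -> R} := idfun.

(** * Separably closed fields *)

Section SeparablyClosed.
Variable K : fieldType.
Hypothesis hK : separably_closed K.

Lemma sep_closed_split (p : {poly K}) : separable_poly p ->
  exists2 s, uniq s & p = lead_coef p *: \prod_(x <- s) ('X - x%:P).
Proof.
have [n] := ubnP (size p); elim: n p => // n IH p lt_pn sp.
have p0 := separable_poly_neq0 sp.
have [le1|gt1] := leqP (size p) 1.
  exists [::] => //; rewrite big_nil alg_polyC {1}(size1_polyC le1).
  by rewrite lead_coefE -subn1; have := p0; rewrite -size_poly_gt0; case: size le1 => [|[]].
have [x /factor_theorem[q Dp]] := hK sp gt1.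
have q0 : q != 0 by apply: contraNneq p0 => q0; rewrite Dp q0 mul0r.
have [||s us Dq] := IH q.
- by move: lt_pn; rewrite Dp size_Mmonic ?monicXsubC // size_XsubC addn2.
- by move: sp; rewrite Dp separable_root => /andP[].
have Dp' : p = lead_coef p *: \prod_(y <- x :: s) ('X - y%:P).
  rewrite {1}Dp Dq big_cons scalerAr mulrC; congr (_ * (_ *: _)).
  by rewrite Dp lead_coef_Mmonic ?monicXsubC.
exists (x :: s) => //; rewrite -separable_prod_XsubC.
rewrite (@eqp_separable _ _ p) //; rewrite Dp' eqp_sym eqp_scale //.
by rewrite lead_coef_eq0.
Qed.

Lemma sep_closed_root (F : fieldType) (h : {rmorphism K -> F}) p y :
  separable_poly p -> root (map_poly h p) y -> exists c, y = h c.
Proof.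
move=> sp; have [s _ ->] := sep_closed_split sp.
rewrite map_polyZ rootZ ?fmorph_eq0 ?lead_coef_eq0 ?separable_poly_neq0 //.
rewrite rmorph_prod /= (eq_bigr (fun x => 'X - (h x)%:P)) => [|x _].
  rewrite -(big_map h xpredT (fun x => 'X - x%:P)) root_prod_XsubC.
  by case/mapP=> c _ ->; exists c.
by rewrite rmorphB /= map_polyX map_polyC.
Qed.

(** A simple root of p is a root of p / gcd(p, p'), which is separable. *)
Lemma sep_closed_simple_root (F : fieldType) (h : {rmorphism K -> F}) p y :
    root (map_poly h p) y -> ~~ root (map_poly h p^`()) y ->
  exists c, y = h c.
Proof.
move=> py p'y; have p0 : p != 0.
  by apply: contraNneq p'y => ->; rewrite deriv0 rmorph0 root0.
apply: (sep_closed_root (make_separable p0)).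
have : root (map_poly h (p %/ gcdp p p^`() * gcdp p p^`())) y.
  by rewrite divpK ?dvdp_gcdl.
rewrite rmorphM rootM => /orP[//|g0]; case/negP: p'y.
by apply: root_dvdp g0; rewrite dvdp_map dvdp_gcdr.
Qed.

(** X^n - 1 has n distinct roots in K if n is nonzero in K, and one of two consecutive integers
    is. *)
Lemma sep_closed_infinite (s : seq K) : exists c, c \notin s.
Proof.
have [n lt_sn n0] : exists2 n, (size s < n)%N & n%:R != 0 :> K.
  have [e|] := eqVneq ((size s).+1%:R : K) 0; last by exists (size s).+1.
  exists (size s).+2 => //; rewrite -natr1 e add0r; exact: oner_neq0.
have [r ur Dr] := sep_closed_split (cyclotomic.separable_Xn_sub_1 n0).
apply: contrapT => /forallNP al.
have : (size r <= size s)%N.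
  by apply: uniq_leq_size => // x _; move: (al x) => /negP; rewrite negbK.
have : size ('X^n - 1 : {poly K}) = n.+1 by rewrite size_XnsubC // (leq_ltn_trans _ lt_sn).
rewrite {1}Dr size_scale ?size_prod_XsubC; last first.
  by rewrite lead_coef_eq0 -size_poly_gt0 size_XnsubC // (leq_ltn_trans _ lt_sn).
by move=> [->]; rewrite leqNgt lt_sn.
Qed.

Lemma sep_closed_avoid (F : fieldType) (h : {rmorphism K -> F}) (s : seq F) :
  exists c, h c \notin s.
Proof.
pose g (y : F) : K := xget 0 [set c | h c = y].
have [c cs] := sep_closed_infinite (map g s); exists c.
apply: contra cs => hcs; apply/mapP; exists (h c) => //.
have : h (g (h c)) = h c by apply: (@xgetPex _ 0 [set x | h x = h c]); exists c.
by move/fmorph_inj.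
Qed.

End SeparablyClosed.

(** * Automorphisms of a separable closure *)

Section Extension.
Variables (L : fieldType) (E : set L).
Hypotheses (hL : separably_closed L) (hE : separable_algebraic_over E).

(** A maximal extension is injective because its domain is algebraic over E. It is defined at every
    a because the generator of the relations of a divides a separable polynomial over E, and so has
    a root in L. *)
Lemma extend_graph (G : set (L * L)) :
    ring_graph G -> (forall e, E e -> G (e, e)) ->
  exists s : {rmorphism L -> L}, forall a b, G (a, b) -> s a = b.
Proof.
move=> /ring_graph_Zorn[A GA mA] GE; have [gA _] := mA.
have AE (p : {poly L}) : (forall i, E p`_i) -> exists2 P, over_graph A P &
    map_poly fst P = p /\ map_poly snd P = p.
  move=> Ep; exists (\poly_(i < size p) (p`_i, p`_i)) => [i|].
    by rewrite coef_poly; case: ifP => _; [exact/GA/GE|apply: ring_graph0].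
  by split; apply/polyP => i; rewrite coef_map coef_poly; case: ltnP => //= /(nth_default 0).
(* Injectivity: after removal of a power of X, an equation q of a over E has q(0) nonzero, and
   evaluation at (a, 0) would put (0, q(0)) in the graph. *)
have A0 a b : A (a, b) -> b = 0 -> a = 0.
  move=> Aab b0; apply/eqP; apply: contraT => a0.
  have [p [Ep sp pa]] := hE a.
  pose n := mup 0 p; have p0 := separable_poly_neq0 sp.
  have [q Dp] : exists q, p = q * 'X^n.
    have : ('X - 0%:P) ^+ n %| p by rewrite -mup_geq.
    by rewrite subr0 => /dvdpP[q ->]; exists q.
  have q0 : q`_0 != 0.
    have : ~~ (('X - 0%:P) ^+ n.+1 %| p) by rewrite -mup_ltn ?ltnSn.
    rewrite subr0; apply: contraNneq => /eqP q0.
    rewrite Dp exprS dvdp_mul2r ?expf_neq0 ?polyX_eq0 //.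
    by rewrite -['X]subr0 -polyC0 dvdp_XsubCl /root horner_coef0.
  have qE i : q`_i = p`_(i + n) by rewrite Dp coefMXn addnK ltnNge leq_addl.
  have /AE[Q AQ [Q1 Q2]] : forall i, E q`_i by move=> i; rewrite qE.
  have : A Q.[(a, b)].
    by rewrite horner_coef; apply: ring_graph_sum => // i; case: (gA) => _ _ AM _;
       apply: AM => //; apply: ring_graphX.
  rewrite [Q.[_]]surjective_pairing horner_fst horner_snd Q1 Q2 /=.
  have -> : q.[a] = 0.
    by move: pa; rewrite Dp rootM /root hornerXn expf_eq0 (negPf a0) andbF orbF => /eqP.
  rewrite b0 horner_coef0; case: gA => _ _ _ /[apply] q00; by rewrite q00 eqxx in q0.
have tot a : exists b, A (a, b).
  have [q [P AP [P0 Dq]] dvq] := relations_generator a mA.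
  have [p [/AE[Q AQ [Q1 Q2]] sp pa]] := hE a.
  have sq : separable_poly q.
    apply: dvdp_separable sp; apply: dvq; exists Q; rewrite ?Q1 ?Q2 //.
    by split=> //; apply/eqP.
  have [le1|/(hL sq)[b qb]] := leqP (size q) 1; last first.
    by exists b; apply: max_graph_root => // r /dvq dq; apply: root_dvdp dq _.
  (* A constant generator is 0: by injectivity the higher coefficients of P vanish already in L, so
     P is a constant that vanishes at a. *)
  case/negP: (separable_poly_neq0 sq).
  have P1 : map_poly fst P = ((map_poly fst P)`_0)%:P.
    apply/polyP => i; rewrite coefC; case: eqP => [->//|/eqP i0]; rewrite coef_map.
    apply: (A0 _ (P`_i).2); first by rewrite -surjective_pairing.
    by rewrite -(coef_map snd) -Dq nth_default // (leq_trans le1) ?lt0n.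
  move: P0; rewrite P1 hornerC coef_map /= => P00.
  have q00 : q`_0 = 0.
    rewrite Dq coef_map /=; case: gA => _ _ _; apply.
    by rewrite -P00 -surjective_pairing.
  by rewrite (size1_polyC le1) q00.
pose s a := xget 0 [set b | A (a, b)].
have As a : A (a, s a) by apply: (@xgetPex _ 0 [set b | A (a, b)]); exact: tot.
have sE a b : A (a, b) -> s a = b by move=> Aab; apply: ring_graph_inj (As a) Aab.
have sB : zmod_morphism s.
  by move=> a b; apply: sE; case: gA => _ AB _ _; apply: (AB (_, _) (_, _)).
have sM : monoid_morphism s.
  split; first by apply: sE; case: gA.
  by move=> a b; apply: sE; case: gA => _ _ AM _; apply: (AM (_, _) (_, _)).
by exists (mk_rmorphism sB sM) => a b /GA /sE.
Qed.

End Extension.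

Section Automorphisms.
Variables (L : fieldType) (E : set L).
Hypotheses (hL : separably_closed L) (hE : separable_algebraic_over E).

(** The minimal polynomial of x over E is separable of degree at least 2, so it has a second root
    x', and x -> x' extends to L. *)
Lemma fixed_subfield (x : L) : is_subfield E -> ~ E x ->
  exists2 s : {rmorphism L -> L}, (forall e, E e -> s e = e) & s x != x.
Proof.
move=> [E1 EB EV] nEx.
have E0 : E 0 by rewrite -(subrr 1); apply: EB.
have EN a : E a -> E (- a) by move=> Ea; rewrite -sub0r; apply: EB.
have EM a b : E a -> E b -> E (a * b).
  move=> Ea Eb; rewrite -[b]invrK; apply: (EV _ _ Ea).
  by rewrite -[b^-1]div1r; apply: EV.
have ED a b : E a -> E b -> E (a + b).
  by move=> Ea Eb; rewrite -[b]opprK; apply: EB => //; apply: EN.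
pose J := [set p : {poly L} | (forall i, E p`_i) /\ root p x].
have [q [Eq qx] dvq] : exists2 q, J q & forall p, J p -> q %| p.
  apply: (ideal_generator (k := E)) => //.
  - by split=> [i|]; rewrite ?coef0 ?root0.
  - move=> p r [Ep px] [Er rx]; split=> [i|]; first by rewrite coefB; apply: EB.
    by rewrite /root hornerD hornerN (eqP px) (eqP rx) subrr.
  - move=> c i p Ec [Ep px]; split=> [l|].
      rewrite -scalerAl coefZ coefXnM; apply: EM => //; by case: ifP.
    by rewrite rootM px orbT.
  - by move=> p [Ep _]; apply: Ep.
have [p [Ep sp px]] := hE x.
have sq : separable_poly q by apply: dvdp_separable sp; apply: dvq.
have q0 := separable_poly_neq0 sq.
have /factor_theorem[r Dq] := qx.
have [sr rx] : separable_poly r /\ ~~ root r x.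
  by apply/andP; rewrite -separable_root -Dq.
have r0 := separable_poly_neq0 sr.
have szq : size q = (size r).+1 by rewrite Dq size_Mmonic ?monicXsubC // size_XsubC addn2.
have [le1|/(hL sr)[x' rx']] := leqP (size r) 1.
  case: nEx; have := Eq 0; have := Eq 1.
  have := r0; rewrite Dq (size1_polyC le1) polyC_eq0; set c := r`_0 => c0.
  rewrite !coefCM coefB coefX coefC subr0 mulr1 coefB coefX coefC /= sub0r.
  by move=> Ec /EN; rewrite mulrN opprK => /EV/(_ Ec); rewrite mulrC mulKf.
have x'x : x' != x by apply: contraNneq rx => <-.
pose G := [set u : L * L | E u.1 /\ u.2 = u.1].
have gG : ring_graph G.
  split; first by [].
  - by move=> u v [Eu u2] [Ev v2]; split; [apply: EB|rewrite /= u2 v2].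
  - by move=> u v [Eu u2] [Ev v2]; split; [apply: EM|rewrite /= u2 v2].
  - by move=> b [/= _ ->].
have [gA sGA Au] : [/\ ring_graph (adjoin_graph G (x, x')),
    G `<=` adjoin_graph G (x, x') & adjoin_graph G (x, x') (x, x')].
  apply: adjoin_graphP => // P GP; rewrite horner_fst horner_snd /= => Px.
  have eP : map_poly snd P = map_poly fst P.
    by apply/polyP => i; rewrite !coef_map /=; case: (GP i).
  rewrite eP; apply/eqP/(@root_dvdp _ q); last by rewrite Dq rootM rx'.
  by apply: dvq; split; [move=> i; rewrite coef_map; case: (GP i)|apply/eqP].
have [s sP] := extend_graph hL hE gA (fun e Ee => sGA (e, e) (conj Ee erefl)).
exists s; last by rewrite (sP _ _ Au).
by move=> e Ee; apply/sP/sGA.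
Qed.

(** Surjectivity: an injective map over E permutes the finitely many roots of a polynomial over
    E. *)
Lemma automorphism_inverse (s : {rmorphism L -> L}) :
    (forall e, E e -> s e = e) ->
  exists2 u : {rmorphism L -> L}, cancel s u & cancel u s.
Proof.
move=> sE; have surj x : exists y, s y = x.
  have [p [Ep sp px]] := hE x.
  have [r ur Dp] := sep_closed_split hL sp.
  have lc0 : lead_coef p != 0 by rewrite lead_coef_eq0 separable_poly_neq0.
  have rP y : (y \in r) = root p y.
    by rewrite Dp rootZ // root_prod_XsubC.
  have sub : {subset map s r <= r}.
    move=> _ /mapP[y yr ->]; rewrite rP.
    have <- : map_poly s p = p by apply/polyP => i; rewrite coef_map; apply: sE.
    by rewrite fmorph_root -rP.
  have us : uniq (map s r) by rewrite map_inj_uniq //; apply: fmorph_inj.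
  have [_ e] := uniq_min_size us sub (eq_leq (esym (size_map s r))).
  have : x \in map s r by rewrite e rP.
  by case/mapP => y _ ->; exists y.
pose u x := xget 0 [set y | s y = x].
have us : cancel u s by move=> x; apply: (@xgetPex _ 0 [set y | s y = x]); apply: surj.
have su : cancel s u by move=> x; apply: (fmorph_inj s); rewrite us.
have uB : zmod_morphism u by move=> x y; apply: (fmorph_inj s); rewrite rmorphB !us.
have uM : monoid_morphism u.
  by split=> [|x y]; apply: (fmorph_inj s); rewrite ?rmorph1 ?rmorphM !us.
by exists (mk_rmorphism uB uM).
Qed.

End Automorphisms.

(** * Places *)

Section Places.
Variables (K L : fieldType) (F : closedFieldType).
Variables (iota : {rmorphism K -> L}) (j : {rmorphism K -> F}).

Record place := Place {
  pl :> L -> option F;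
  pl_iota : forall c, pl (iota c) = Some (j c);
  plB : forall x y a b, pl x = Some a -> pl y = Some b -> pl (x - y) = Some (a - b);
  plM : forall x y a b, pl x = Some a -> pl y = Some b -> pl (x * y) = Some (a * b);
  plV0 : forall x, pl x = None -> pl x^-1 = Some 0 }.

(* Chevalley's extension theorem. *)
Lemma place_extension (G : set (L * F)) :
    ring_graph G -> (forall c, G (iota c, j c)) ->
  exists P : place, forall a b, G (a, b) -> P a = Some b.
Proof.
move=> /ring_graph_Zorn[A GA mA] Gj; have [gA _] := mA.
(* [rel x n] is the obstruction to a finite value at x: an equation of degree at most n over the
   domain whose reduction is a nonzero constant. *)
pose rel x n := exists P : {poly L * F}, [/\ over_graph A P, (size P <= n.+1)%N,
  (map_poly fst P).[x] = 0 & exists2 c, c != 0 & map_poly snd P = c%:P].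
have szf (R S : nzRingType) (h : {rmorphism R -> S}) (p : {poly R}) :
    (size (map_poly h p) <= size p)%N by exact: size_poly.
have rel_ltn x m n : x != 0 -> rel x m -> rel x^-1 n -> (n <= m)%N ->
    exists2 m', (m' < m)%N & rel x m'.
  move=> x0 [P [AP sP Px [c c0 Pc]]] [Q [AQ sQ Qx [c' c'0 Qc]]] le_nm.
  have [m0|m_gt0] := posnP m.
    case/eqP: c0; rewrite m0 in sP.
    have Px0 : (P`_0).1 = 0.
      rewrite -(coef_map fst); move: Px.
      by rewrite {1}[map_poly _ _]size1_polyC ?hornerC // (leq_trans (szf _ _ _ _)).
    have <- : (P`_0).2 = c by rewrite -(coef_map snd) Pc coefC.
    by case: gA => _ _ _; apply; rewrite -Px0 -surjective_pairing.
  exists m.-1; first by rewrite prednK.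
  have AQ0 : A ((Q`_0).1^-1, c'^-1).
    apply: max_graphV => //; have <- : (Q`_0).2 = c' by rewrite -(coef_map snd) Qc coefC.
    by rewrite -surjective_pairing.
  have Q00 : (Q`_0).1 != 0.
    apply: contra c'0 => /eqP Q01; apply/eqP; case: gA => _ _ _; apply.
    have <- : (Q`_0).2 = c' by rewrite -(coef_map snd) Qc coefC.
    by rewrite -Q01 -surjective_pairing.
  (* [Qr] is the reciprocal polynomial of Q, so it vanishes at x. Its multiple [T] has the same
     coefficient of degree m as P, and reduces to 0 because that coefficient does, m being
     positive. *)
  pose Qr : {poly L * F} := \poly_(i < n.+1) Q`_(n - i).
  have AQr : over_graph A Qr.
    by move=> i; rewrite coef_poly; case: ifP => _; [apply: AQ|apply: ring_graph0].
  pose T := (P`_m * ((Q`_0).1^-1, c'^-1))%:P * 'X^(m - n) * Qr.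
  have AT : over_graph A T.
    apply: over_graphM => //; apply: over_graphM => //.
      by apply: over_graphC => //; case: (gA) => _ _ AM _; apply: AM.
    by move=> l; rewrite coefXn; case: eqP => _; [case: gA|apply: ring_graph0].
  have Tx : (map_poly fst T).[x] = 0.
    rewrite !rmorphM /= map_polyXn !hornerM hornerXn.
    suff -> : (map_poly fst Qr).[x] = x ^+ n * (map_poly fst Q).[x^-1].
      by rewrite Qx !mulr0.
    rewrite (@horner_coef_wide _ n.+1); last first.
      by rewrite (leq_trans (szf _ _ _ _)) // size_poly.
    rewrite (@horner_coef_wide _ n.+1 (map_poly fst Q)); last first.
      by rewrite (leq_trans (szf _ _ _ _)).
    rewrite (reindex_inj rev_ord_inj) mulr_sumr; apply: eq_bigr => i _ /=.
    rewrite !coef_map /= coef_poly subSS ltnS leq_subr subKn -1?ltnS // mulrCA.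
    congr (_ * _); rewrite exprVn; apply: (canRL (mulfK _)); first by rewrite expf_neq0.
    by rewrite -exprD subnK // leq_ord.
  have Pm2 : (P`_m).2 = 0.
    by rewrite -(coef_map snd) Pc coefC gtn_eqF.
  have T2 : map_poly snd T = 0.
    by rewrite !rmorphM /= map_polyC /= Pm2 !mul0r.
  exists (P - T); split; first exact: over_graphB.
  - rewrite prednK //; apply/leq_sizeP => i; rewrite leq_eqVlt coefB => /predU1P[<-|lt_mi].
      rewrite /T -mulrA coefCM coefXnM ltnNge leq_subr /= subKn // coef_poly ltnSn subnn.
      rewrite -mulrA -[X in X - _]mulr1 -mulrBr.
      have -> : ((Q`_0).1^-1, c'^-1) * Q`_0 = 1.
        rewrite [Q`_0]surjective_pairing; congr pair; rewrite /= ?mulVf //.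
        by rewrite -(coef_map snd) Qc coefC /= mulVf.
      by rewrite subrr mulr0.
    rewrite nth_default ?(leq_trans sP) // sub0r.
    rewrite /T -mulrA coefCM coefXnM ltnNge (leq_trans (leq_subr _ _) (ltnW lt_mi)) /=.
    rewrite coef_poly ltnS leqNgt ltn_subRL subnK // lt_mi /= mulr0 oppr0; reflexivity.
  - by rewrite rmorphB /= hornerD hornerN Px Tx subrr.
  - by exists c => //; rewrite rmorphB /= Pc T2 subr0.
(* Descent on m + n: of the equations of x and x^-1, the one of larger degree can be shortened by
   means of the other. *)
have no_rel x m n : x != 0 -> rel x m -> rel x^-1 n -> False.
  have [k] := ubnP (m + n); elim: k x m n => // k IH x m n; rewrite ltnS => le_k x0 Rm Rn.
  have [le_nm|/ltnW le_mn] := leqP n m.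
    have [m' lt_m' Rm'] := rel_ltn x m n x0 Rm Rn le_nm.
    by apply: (IH x m' n) => //; apply: leq_trans le_k; rewrite ltn_add2r.
  have x'0 : x^-1 != 0 by rewrite invr_eq0.
  have Rm' : rel x^-1^-1 m by rewrite invrK.
  have [n' lt_n' Rn'] := rel_ltn _ _ _ x'0 Rn Rm' le_mn.
  by apply: (IH x m n') => //; apply: leq_trans le_k; rewrite ltn_add2l.
have dichotomy x : (exists b, A (x, b)) \/ exists n, rel x n.
  have [q [P AP [P0 Dq]] dvq] := relations_generator x mA.
  have [/closed_rootP[b qb]|] := boolP (size q != 1)%N.
    by left; exists b; apply: max_graph_root => // r /dvq dq; apply: root_dvdp dq _.
  rewrite negbK => /size_poly1P[c c0 Dc]; right; exists (size P), P; split=> //.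
  by exists c; rewrite // -Dq.
have domV x : ~ (exists b, A (x, b)) -> A (x^-1, 0).
  move=> nx; have [//|[m Rm]] := dichotomy x.
  have x0 : x != 0.
    by apply: contra_notN nx => /eqP ->; exists 0; apply: ring_graph0.
  have [[b Ab]|[n Rn]] := dichotomy x^-1; last by case: (no_rel x m n).
  have [b0|b0] := eqVneq b 0; first by rewrite -b0.
  by case: nx; exists b^-1; rewrite -[x]invrK; apply: max_graphV.
pose P x := if `[< exists b, A (x, b) >] then Some (xget 0 [set b | A (x, b)]) else None.
have PP x b : P x = Some b <-> A (x, b).
  rewrite /P; case: asboolP => [ex|nex]; last by split=> // Ab; case: nex; exists b.
  have Ax : A (x, xget 0 [set b | A (x, b)]) by apply: (@xgetPex _ 0 [set b | A (x, b)]).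
  by split=> [[<-]//|Ab]; congr Some; apply: ring_graph_inj Ax Ab.
have Piota c : P (iota c) = Some (j c) by apply/PP/GA.
have PB x y a b : P x = Some a -> P y = Some b -> P (x - y) = Some (a - b).
  by move=> /PP Ax /PP Ay; apply/PP; case: gA => _ AB _ _; apply: (AB (_, _) (_, _)).
have PM x y a b : P x = Some a -> P y = Some b -> P (x * y) = Some (a * b).
  by move=> /PP Ax /PP Ay; apply/PP; case: gA => _ _ AM _; apply: (AM (_, _) (_, _)).
have PV x : P x = None -> P x^-1 = Some 0.
  by rewrite {1}/P; case: asboolP => // nex _; apply/PP/domV.
by exists (Place Piota PB PM PV) => a b /GA/PP.
Qed.

End Places.

Section PlaceTheory.
Variables (K L : fieldType) (F : closedFieldType).
Variables (iota : {rmorphism K -> L}) (j : {rmorphism K -> F}).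
Local Notation place := (place iota j).

Section OnePlace.
Variable P : place.

Lemma pl0 : P 0 = Some 0.
Proof. by rewrite -(rmorph0 iota) pl_iota rmorph0. Qed.

Lemma pl1 : P 1 = Some 1.
Proof. by rewrite -(rmorph1 iota) pl_iota rmorph1. Qed.

Lemma plN x a : P x = Some a -> P (- x) = Some (- a).
Proof. by move=> Px; rewrite -sub0r -[- a]sub0r; apply: plB => //; apply: pl0. Qed.

Lemma plD x y a b : P x = Some a -> P y = Some b -> P (x + y) = Some (a + b).
Proof. by move=> Px Py; rewrite -[y]opprK -[b]opprK; apply: plB => //; apply: plN. Qed.

Lemma plX x a n : P x = Some a -> P (x ^+ n) = Some (a ^+ n).
Proof.
move=> Px; elim: n => [|n IH]; first exact: pl1.
by rewrite !exprS; apply: plM.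
Qed.

Lemma pl_sum (I : Type) (r : seq I) (Q : pred I) (u : I -> L) (v : I -> F) :
  (forall i, Q i -> P (u i) = Some (v i)) ->
  P (\sum_(i <- r | Q i) u i) = Some (\sum_(i <- r | Q i) v i).
Proof.
move=> uv; elim/big_rec2: _ => [|i x y Qi Py]; first exact: pl0.
by apply: plD => //; apply: uv.
Qed.

Lemma pl_prod (I : Type) (r : seq I) (Q : pred I) (u : I -> L) (v : I -> F) :
  (forall i, Q i -> P (u i) = Some (v i)) ->
  P (\prod_(i <- r | Q i) u i) = Some (\prod_(i <- r | Q i) v i).
Proof.
move=> uv; elim/big_rec2: _ => [|i x y Qi Py]; first exact: pl1.
by apply: plM => //; apply: uv.
Qed.

Lemma plV x a : P x = Some a -> a != 0 -> P x^-1 = Some a^-1.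
Proof.
move=> Px a0; have x0 : x != 0 by apply: contra_eq_neq Px => ->; rewrite pl0 eq_sym; apply: contra a0 => /eqP[->].
case Px': (P x^-1) => [b|]; last first.
  by move/plV0: Px'; rewrite invrK Px => -[a00]; rewrite a00 eqxx in a0.
have := plM Px Px'; rewrite divff // pl1 => -[ab]; congr Some.
by apply: (mulfI a0); rewrite divff.
Qed.

Lemma plVN x : P x = Some 0 -> x != 0 -> P x^-1 = None.
Proof.
move=> Px x0; case Px': (P x^-1) => [b|//].
by have := plM Px Px'; rewrite divff // pl1 mul0r => -[/eqP]; rewrite oner_eq0.
Qed.

Lemma pl_neq0 x : P x <> Some 0 -> x != 0.
Proof. by move=> Px; apply: contra_not_neq Px => ->; apply: pl0. Qed.

Lemma pl_horner (p : {poly L}) (q : {poly F}) x a :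
  (forall i, P p`_i = Some q`_i) -> P x = Some a -> P p.[x] = Some q.[a].
Proof.
move=> pq Px; pose n := maxn (size p) (size q).
rewrite (@horner_coef_wide _ n p) ?leq_maxl // (@horner_coef_wide _ n q) ?leq_maxr //.
by apply: pl_sum => i _; apply: plM; [apply: pq|apply: plX].
Qed.

(* The uniqueness part of Hensel's lemma. *)
Lemma pl_simple_root (p : {poly L}) (q : {poly F}) x y a :
    (forall i, P p`_i = Some q`_i) -> P x = Some a -> P y = Some a ->
    root p x -> root p y -> ~~ root q^`() a -> x = y.
Proof.
move=> pq Px Py rx ry; apply: contra_neq_eq; rewrite -subr_eq0 => xy0.
pose n := maxn (size p) (size q).
pose k := \sum_(i < n) p`_i * \sum_(l < i) x ^+ (i.-1 - l) * y ^+ l.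
have k0 : (x - y) * k = 0.
  transitivity (p.[x] - p.[y]); last by rewrite (eqP rx) (eqP ry) subrr.
  rewrite !(@horner_coef_wide _ n p) ?leq_maxl // -sumrB mulr_sumr.
  by apply: eq_bigr => i _; rewrite -mulrBr subrXX mulrCA.
have : P k = Some q^`().[a].
  have -> : q^`().[a] = \sum_(i < n) q`_i * \sum_(l < i) a ^+ (i.-1 - l) * a ^+ l.
    rewrite (@horner_coef_wide _ n.-1); last first.
      apply: leq_trans (size_poly _ _) _; rewrite -!subn1 leq_sub2r //; exact: leq_maxr.
    case: (n) => [|m]; first by rewrite !big_ord0.
    rewrite big_ord_recl /= big_ord0 mulr0 add0r; apply: eq_bigr => i _.
    rewrite coef_deriv /= /bump leq0n add1n /= mulrnAl -mulrnAr; congr (_ * _).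
    rewrite (eq_bigr (fun=> a ^+ i)) ?sumr_const ?card_ord // => l _.
    by rewrite -exprD subnK // -ltnS.
  apply: pl_sum => i _; apply: plM; first exact: pq.
  by apply: pl_sum => l _; apply: plM; apply: plX.
have -> : k = 0 by apply/eqP; move/eqP: k0; rewrite mulf_eq0 (negPf xy0).
by rewrite pl0 => -[<-].
Qed.

(** If x had a pole, division of the equation by x^n would present 0 as 1 plus terms that reduce to
    0. *)
Lemma pl_integral (p : {poly L}) x : p \is monic -> (forall i, P p`_i <> None) ->
  root p x -> P x <> None.
Proof.
move=> mp fp rx Px; have Px' := plV0 Px.
have x0 : x != 0 by apply: pl_neq0; rewrite Px.
pose n := (size p).-1; have szp : size p = n.+1 by rewrite prednK // size_poly_gt0 monic_neq0.
have : x^-1 ^+ n * p.[x] = 0 by rewrite (eqP rx) mulr0.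
have -> : x^-1 ^+ n * p.[x] = 1 + \sum_(i < n) p`_i * x^-1 ^+ (n - i).
  rewrite horner_coef szp big_ord_recr /= mulrDr addrC; congr (_ + _).
    by rewrite -[p`_n]/(lead_coef p) (monicP mp) mul1r -exprMn mulVf // expr1n.
  rewrite mulr_sumr; apply: eq_bigr => i _; rewrite mulrCA; congr (_ * _).
  rewrite -{1}(subnK (ltnW (ltn_ord i))) exprD -mulrA -exprMn mulVf //.
  by rewrite expr1n mulr1.
move=> e; suff : P 0 = Some 1 by rewrite pl0 => -[/eqP]; rewrite eq_sym oner_eq0.
rewrite -e -[X in Some X]addr0; apply: plD; first exact: pl1.
rewrite -[X in Some X](@big1_eq _ _ +%R 'I_n (index_enum _) xpredT).
apply: pl_sum => i _; case Pi : (P p`_i) => [c|]; last by case: (fp i).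
rewrite -[X in Some X](mulr0 c); apply: plM => //.
by have := plX (n - i) Px'; rewrite expr0n subn_eq0 leqNgt ltn_ord.
Qed.

End OnePlace.

Definition place_comp (P : place) (s : {rmorphism L -> L})
  (sK : forall c, s (iota c) = iota c) : place.
Proof.
apply: (@Place _ _ _ iota j (P \o s)) => [c|x y a b|x y a b|x] /=.
- by rewrite sK pl_iota.
- by rewrite rmorphB; apply: plB.
- by rewrite rmorphM; apply: plM.
- by rewrite fmorphV; apply: plV0.
Defined.

Lemma subfieldP (M : set L) : is_subfield M ->
  [/\ M 0, forall x, M x -> M x^-1, forall x y, M x -> M y -> M (x + y)
    & forall x y, M x -> M y -> M (x * y)].
Proof.
move=> [M1 MB MV]; have M0 : M 0 by rewrite -(subrr (1 : L)); apply: MB.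
have Mi x : M x -> M x^-1 by move=> Mx; rewrite -div1r; apply: MV.
split=> // x y Mx My.
  by rewrite -[y]opprK -[- y]sub0r; apply: (MB) => //; apply: MB.
by rewrite -[y]invrK; apply: MV => //; apply: Mi.
Qed.

Section Separation.
Hypothesis hK : separably_closed K.
Variable M : set L.
Hypotheses (sfM : is_subfield M) (iM : forall c, M (iota c)).

(* The values of z = 1/(y - c) determine those of y, and z is finite wherever *)
(* y does not take the value c.                                               *)
Lemma separate1 (T : finType) (R : T -> place) (P Q : place) y :
    M y -> P y <> Q y ->
  exists z, [/\ M z, P z <> Q z & forall i, R i z <> None].
Proof.
move=> My PQ; pose vals := [seq odflt 0 (R i y) | i <- enum T].
have [c cv] := sep_closed_avoid hK j (odflt 0 (P y) :: odflt 0 (Q y) :: vals).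
move: cv; rewrite !inE !negb_or => /and3P[cP cQ cv].
have [M0 Mi MD MM] := subfieldP sfM; case: (sfM) => M1 MB MV.
pose z := (y - iota c)^-1.
have zE (S : place) : odflt 0 (S y) != j c ->
    S z = if S y is Some a then Some (a - j c)^-1 else Some 0.
  case Sy : (S y) => [a|] /= ac.
    by apply: plV; [apply: plB => //; apply: pl_iota|rewrite subr_eq0].
  apply: plV0; case Syc : (S (y - iota c)) => [b|//].
  by have := plD Syc (pl_iota S c); rewrite subrK Sy.
exists z; split; first by apply/Mi/MB.
  rewrite !zE 1?eq_sym //; case Py : (P y) => [a|]; case Qy: (Q y) => [b|] //.
  - move=> [/invr_inj/addIr ab]; by case: PQ; rewrite Py Qy ab.
  - case=> /eqP; rewrite invr_eq0 subr_eq0 => /eqP ac.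
    by rewrite Py /= ac eqxx in cP.
  - case=> /eqP; rewrite eq_sym invr_eq0 subr_eq0 => /eqP bc.
    by rewrite Qy /= bc eqxx in cQ.
  - by move=> _; case: PQ; rewrite Py Qy.
move=> i; rewrite zE; first by case: (R i y).
by rewrite eq_sym; apply: contra cv => /eqP ->; apply: map_f; rewrite mem_enum.
Qed.

(** Elements that separate single pairs are made finite by [separate1] and combined as y + c z; the
    constant c avoids the finitely many ratios for which two values to be separated would
    coincide. *)
Lemma separate (I T : finType) (P Q : I -> place) (R : T -> place) :
    (forall i, exists2 y, M y & P i y <> Q i y) ->
  exists y, [/\ M y, forall i, P i y <> Q i y & forall i, R i y <> None].
Proof.
move=> PQ; pose S (u : I + I + T) : place :=
  match u with inl (inl i) => P i | inl (inr i) => Q i | inr i => R i end.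
have [M0 Mi MD MM] := subfieldP sfM.
suff [y [My Py Ry]] : exists y, [/\ M y, forall i, i \in enum I -> P i y <> Q i y
    & forall u, S u y <> None].
  exists y; split=> // [i|i]; first by apply: Py; rewrite mem_enum.
  exact: (Ry (inr i)).
elim: (enum I) => [|i s [y [My Py Ry]]].
  by exists 0; split=> // u; rewrite pl0.
have [y0 My0 Py0] := PQ i.
have [z [Mz Pz Rz]] := separate1 S My0 Py0.
pose v (R : place) x := odflt 0 (R x).
have vE (u : I + I + T) x : S u x <> None -> S u x = Some (v (S u) x).
  by rewrite /v; case: (S u x).
pose d k x := v (P k) x - v (Q k) x.
have [c cs] := sep_closed_avoid hK j [seq - (d k y / d k z) | k <- i :: s].
have Sy u : S u (y + iota c * z) = Some (v (S u) y + j c * v (S u) z).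
  by apply: plD; [apply: vE|apply: plM; [apply: pl_iota|apply: vE]].
exists (y + iota c * z); split; first by apply: MD => //; apply: MM.
  move=> k ks; rewrite (Sy (inl (inl k))) (Sy (inl (inr k))) /= => -[/eqP].
  rewrite -subr_eq0 opprD addrACA -mulrBr -/(d k y) -/(d k z) => e.
  have [dz|dz] := eqVneq (d k z) 0.
    have dy : d k y = 0 by move: e; rewrite dz mulr0 addr0 => /eqP.
    move: ks; rewrite inE => /predU1P[ki|/Py].
      case: Pz; rewrite -ki (vE (inl (inl k)) z (Rz _)) (vE (inl (inr k)) z (Rz _)) /=.
      by congr Some; apply/eqP; rewrite -subr_eq0; apply/eqP.
    apply; rewrite (vE (inl (inl k)) y (Ry _)) (vE (inl (inr k)) y (Ry _)) /=.
    by congr Some; apply/eqP; rewrite -subr_eq0; apply/eqP.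
  case/negP: cs; apply/mapP; exists k => //.
  by move: e; rewrite addrC addr_eq0 => /eqP e; rewrite -mulNr -e mulfK.
by move=> u; rewrite Sy.
Qed.

End Separation.

Section RationalFunctions.
Variable w : L.
Implicit Types p q r s : {poly K}.

Definition rat_eval (p : {poly K}) : L := (map_poly iota p).[w].

Definition rational (x : L) : Prop :=
  exists p q, [/\ coprimep p q, rat_eval q != 0 & x = rat_eval p / rat_eval q].

Lemma rat_evalM p q : rat_eval (p * q) = rat_eval p * rat_eval q.
Proof. by rewrite /rat_eval rmorphM hornerM. Qed.

Lemma rat_evalB p q : rat_eval (p - q) = rat_eval p - rat_eval q.
Proof. by rewrite /rat_eval rmorphB /= hornerD hornerN. Qed.

Lemma rat_evalD p q : rat_eval (p + q) = rat_eval p + rat_eval q.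
Proof. by rewrite /rat_eval rmorphD /= hornerD. Qed.

Lemma rat_evalC c : rat_eval c%:P = iota c.
Proof. by rewrite /rat_eval map_polyC hornerC. Qed.

Lemma rat_evalX : rat_eval 'X = w.
Proof. by rewrite /rat_eval map_polyX hornerX. Qed.

Lemma rational_div p q : rat_eval q != 0 -> rational (rat_eval p / rat_eval q).
Proof.
move=> q0; have [pE qE] : p = p %/ gcdp p q * gcdp p q /\ q = q %/ gcdp p q * gcdp p q.
  by rewrite !divpK ?dvdp_gcdl ?dvdp_gcdr.
have qN0 : q != 0 by apply: contraNneq q0 => ->; rewrite /rat_eval rmorph0 horner0.
have := q0; rewrite qE rat_evalM mulf_eq0 negb_or => /andP[q1 g0].
exists (p %/ gcdp p q), (q %/ gcdp p q); split=> //.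
  by apply: coprimep_div_gcd; rewrite qN0 orbT.
by rewrite {1}pE rat_evalM -mulf_div divff // mulr1.
Qed.

Lemma rational_eval p : rational (rat_eval p).
Proof.
exists p, 1; rewrite coprimep1 -polyC1 rat_evalC rmorph1 divr1.
by split; rewrite ?oner_eq0.
Qed.

Lemma rational_subfield : is_subfield [set x | rational x].
Proof.
split=> [|_ _ [p [q [_ q0 ->]]] [r [s [_ s0 ->]]]|_ _ [p [q [_ q0 ->]]] [r [s [_ s0 ->]]]] /=.
- by rewrite -(rmorph1 iota) -rat_evalC; apply: rational_eval.
- rewrite -mulNr addf_div // mulNr -!rat_evalM -rat_evalB; apply: rational_div.
  by rewrite rat_evalM mulf_neq0.
- rewrite invf_div mulf_div -!rat_evalM; have [e|] := eqVneq (rat_eval (q * r)) 0.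
    by rewrite e invr0 mulr0 -(rmorph0 iota) -rat_evalC; apply: rational_eval.
  exact: rational_div.
Qed.

Section AtAPlace.
Variable P : place.

Lemma pl_rat_eval p a : P w = Some a -> P (rat_eval p) = Some (map_poly j p).[a].
Proof. by apply: pl_horner => i; rewrite !coef_map pl_iota. Qed.

Lemma pl_rat_evalV p : P w = None ->
  P (w^-1 ^+ (size p).-1 * rat_eval p) = Some (j (lead_coef p)).
Proof.
move=> /[dup] Pw /plV0 Pw'; have w0 : w != 0 by apply: (@pl_neq0 P); rewrite Pw.
have [->|p0] := eqVneq p 0.
  by rewrite lead_coef0 /rat_eval !rmorph0 horner0 mulr0 pl0.
set n := (size p).-1; have szp : size p = n.+1 by rewrite prednK // size_poly_gt0.
have -> : w^-1 ^+ n * rat_eval p = iota (lead_coef p) + \sum_(i < n) iota p`_i * w^-1 ^+ (n - i).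
  rewrite /rat_eval horner_coef size_map_poly szp big_ord_recr /= mulrDr addrC; congr (_ + _).
    by rewrite coef_map -[p`_n]/(lead_coef p) mulrCA -exprMn mulVf // expr1n mulr1.
  rewrite mulr_sumr; apply: eq_bigr => i _; rewrite coef_map mulrCA; congr (_ * _).
  rewrite -{1}(subnK (ltnW (ltn_ord i))) exprD -mulrA -exprMn mulVf //.
  by rewrite expr1n mulr1.
rewrite -[X in Some X]addr0; apply: plD; first exact: pl_iota.
rewrite -[X in Some X](@big1_eq _ _ +%R 'I_n (index_enum _) xpredT).
apply: pl_sum => i _; rewrite -[X in Some X](mulr0 (j p`_i)).
apply: plM; first exact: pl_iota.
by have := plX (n - i) Pw'; rewrite expr0n subn_eq0 leqNgt ltn_ord.
Qed.

Lemma pl_rational_pole p q a : coprimep p q -> rat_eval q != 0 ->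
  P w = Some a -> root (map_poly j q) a -> P (rat_eval p / rat_eval q) = None.
Proof.
move=> cpq q0 Pw qa; case Px : (P _) => [b|//].
have := plM Px (pl_rat_eval q Pw); rewrite divfK // (pl_rat_eval p Pw) (eqP qa) mulr0.
move=> [/eqP]; have /coprimep_root/(_ qa) : coprimep (map_poly j q) (map_poly j p).
  by rewrite coprimep_map coprimep_sym.
by move=> /negPf ->.
Qed.

Lemma pl_rational_fin p q a : P w = Some a -> ~~ root (map_poly j q) a ->
  P (rat_eval p / rat_eval q) = Some ((map_poly j p).[a] / (map_poly j q).[a]).
Proof. by move=> Pw qa; apply: plM; [|apply: plV => //]; apply: pl_rat_eval. Qed.

Lemma pl_rational_inf p q : P w = None -> p != 0 -> q != 0 ->
  P (rat_eval p / rat_eval q) =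
    if (size p < size q)%N then Some 0
    else if size p == size q then Some (j (lead_coef p / lead_coef q)) else None.
Proof.
move=> Pw; have Pw' := plV0 Pw; have w0 : w != 0 by apply: (@pl_neq0 P); rewrite Pw.
have rat_neq0 r : r != 0 -> rat_eval r != 0.
  move=> r0; apply: contra_eq_neq (pl_rat_evalV r Pw) => ->.
  rewrite mulr0 pl0; apply: contraNneq r0 => -[/esym/eqP].
  by rewrite fmorph_eq0 lead_coef_eq0.
have lt r s : r != 0 -> s != 0 -> (size r <= size s)%N ->
    P (rat_eval r / rat_eval s) =
      Some (j (lead_coef r / lead_coef s) * 0 ^+ (size s - size r)).
  move=> r0 s0 le_rs; have lc0 : j (lead_coef s) != 0 by rewrite fmorph_eq0 lead_coef_eq0.
  have s0' := rat_neq0 _ s0.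
  have e : (size s).-1 = ((size s - size r) + (size r).-1)%N.
    apply: succn_inj; rewrite prednK ?size_poly_gt0 // -addnS.
    by rewrite prednK ?size_poly_gt0 // subnK.
  have := plM (plM (pl_rat_evalV r Pw) (plV (pl_rat_evalV s Pw) lc0)) (plX (size s - size r) Pw').
  rewrite [j (_ / _)]rmorphM fmorphV => <-; congr (P _).
  have u0 : w^-1 ^+ (size r).-1 != 0 by rewrite expf_neq0 ?invr_eq0.
  have v0 : w^-1 ^+ (size s - size r) != 0 by rewrite expf_neq0 ?invr_eq0.
  rewrite e exprD.
  move: (w^-1 ^+ (size r).-1) (w^-1 ^+ (size s - size r)) u0 v0 => u v u0 v0.
  move: (rat_eval r) (rat_eval s) s0' => x y y0.
  by field; rewrite u0 v0 y0.
move=> p0 q0; case: ltngtP => [lt_pq|lt_qp|e_pq].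
- by rewrite lt ?(ltnW lt_pq) // expr0n subn_eq0 leqNgt lt_pq mulr0.
- have := lt q p q0 p0 (ltnW lt_qp).
  rewrite expr0n subn_eq0 leqNgt lt_qp mulr0 => Px.
  by rewrite -invf_div plVN // mulf_neq0 ?invr_eq0 ?rat_neq0.
- by rewrite (lt p q p0 q0 (eq_leq e_pq)) e_pq subnn expr0 mulr1.
Qed.

End AtAPlace.
End RationalFunctions.
End PlaceTheory.

Section Transcendental.
Variables (K L : fieldType) (F : closedFieldType).
Variables (iota : {rmorphism K -> L}) (j : {rmorphism K -> F}).
Local Notation place := (place iota j).
Variable w : L.
Hypothesis hw : ~ algebraicOver iota w.
Implicit Types p q : {poly K}.

Lemma rat_eval_eq0 p : (rat_eval iota w p == 0) = (p == 0).
Proof.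
apply/eqP/eqP => [e|->]; last by rewrite /rat_eval rmorph0 horner0.
by apply: contra_notP hw => /eqP p0; exists p => //; apply/eqP.
Qed.

Lemma place_at a : exists P : place, P w = Some a.
Proof.
pose G := [set u : L * F | exists p, u = (rat_eval iota w p, (map_poly j p).[a])].
have [||P PG] := @place_extension _ _ _ iota j G; last first.
- exists P; apply: PG; exists 'X.
  by rewrite rat_evalX map_polyX hornerX.
- by move=> c; exists c%:P; rewrite rat_evalC map_polyC hornerC.
split.
- by exists 1%:P; rewrite rat_evalC map_polyC hornerC; congr pair; rewrite /= rmorph1.
- move=> _ _ [p ->] [q ->]; exists (p - q).
  by rewrite rat_evalB rmorphB /= hornerD hornerN.
- move=> _ _ [p ->] [q ->]; exists (p * q).
  by rewrite rat_evalM rmorphM /= hornerM.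
- move=> b [p [/esym/eqP]]; rewrite rat_eval_eq0 => /eqP -> ->.
  by rewrite rmorph0 horner0.
Qed.

Lemma rational_agree (P Q : place) x : P w = Q w -> rational iota w x -> P x = Q x.
Proof.
move=> PQ [p [q [cpq q0 ->]]]; case Pw : (P w) => [a|].
  have Qw : Q w = Some a by rewrite -PQ.
  have [qa|qa] := boolP (root (map_poly j q) a).
    by rewrite (pl_rational_pole cpq q0 Pw qa) (pl_rational_pole cpq q0 Qw qa).
  by rewrite (pl_rational_fin p Pw qa) (pl_rational_fin p Qw qa).
have Qw : Q w = None by rewrite -PQ.
have [->|p0] := eqVneq p 0; first by rewrite /rat_eval rmorph0 horner0 mul0r !pl0.
by move: q0; rewrite rat_eval_eq0 => q0; rewrite !pl_rational_inf.
Qed.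

(** A nonconstant denominator has a root in F, and a place with this value at w is a pole of x. *)
Lemma rational_poly x : rational iota w x ->
  (forall P : place, P w <> None -> P x <> None) -> exists p, x = rat_eval iota w p.
Proof.
move=> [p [q [cpq q0 xE]]] finx.
have [/closed_rootP[a qa]|] := boolP (size (map_poly j q) != 1)%N.
  have [P Pw] := place_at a; case: (finx P); first by rewrite Pw.
  by rewrite xE (pl_rational_pole cpq q0 Pw qa).
rewrite negbK size_map_poly => /size_poly1P[c c0 qE].
exists (c^-1 *: p); rewrite xE qE rat_evalC mulrC.
by rewrite -mul_polyC rat_evalM rat_evalC fmorphV.
Qed.

Lemma rat_eval_const p (Q : place) : Q w = None -> Q (rat_eval iota w p) <> None ->
  (size p <= 1)%N.
Proof.
move=> Qw; have [->|p0] := eqVneq p 0; first by rewrite size_poly0.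
rewrite -[rat_eval iota w p]divr1 -(rmorph1 iota) -(rat_evalC iota w 1).
rewrite pl_rational_inf ?polyC_eq0 ?oner_eq0 // size_polyC oner_eq0.
by case: ltngtP.
Qed.

Lemma rat_eval_inf0 p (Q : place) : Q w = None -> Q (rat_eval iota w p) = Some 0 -> p = 0.
Proof.
move=> Qw Qp; have := @rat_eval_const p Q Qw.
rewrite Qp => /(_ ltac:(by [])) /size1_polyC pE; move: Qp; rewrite pE rat_evalC pl_iota.
by move=> [/eqP]; rewrite fmorph_eq0 => /eqP ->.
Qed.

End Transcendental.

Lemma algebraicOverV (K L : fieldType) (iota : {rmorphism K -> L}) x :
  algebraicOver iota x^-1 -> algebraicOver iota x.
Proof. by move=> /algebraic_inv; rewrite invrK. Qed.

Lemma place_inf (K L : fieldType) (F : closedFieldType) (iota : {rmorphism K -> L})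
    (j : {rmorphism K -> F}) w : ~ algebraicOver iota w ->
  exists P : place iota j, P w = None.
Proof.
move=> hw; have hw' : ~ algebraicOver iota w^-1 by move/algebraicOverV.
have [P Pw] := place_at j hw' 0; exists P; rewrite -[w]invrK plVN // invr_eq0.
by apply: contra_notN hw => /eqP ->; apply: algebraic0.
Qed.

(** * Finite quotients of automorphism groups *)

Section FiniteQuotients.
Variable L : fieldType.
Local Notation auto := {rmorphism L -> L}.
Implicit Types (H B : set auto) (s u : auto).

Definition auto_group H : Prop :=
  [/\ H (rid L), forall s u, H s -> H u -> H (rcomp s u),
      forall s, H s -> exists u, [/\ H u, cancel s u & cancel u s]
    & forall s u, s =1 u -> H s -> H u].

Definition fixed H : set L := [set y | forall s, H s -> s y = y].

(* cls identifies the opposite of H / B with the finite group G. *)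
Record finite_quotient H B (gT : finGroupType) (G : {group gT}) (cls : auto -> gT) := {
  fq_group : auto_group H;
  fq_sub : B `<=` H;
  fq_in : forall s, H s -> cls s \in G;
  fq_onto : forall a, a \in G -> exists2 s, H s & cls s = a;
  fq_eq : forall s u, s =1 u -> cls s = cls u;
  fq_mul : forall s u, H s -> H u -> cls (rcomp s u) = (cls u * cls s)%g;
  fq_ker : forall s, H s -> (cls s = 1%g <-> B s) }.

Lemma fixed_subfield_of H : is_subfield (fixed H).
Proof.
split=> [s _|x y Hx Hy s Hs|x y Hx Hy s Hs]; first exact: rmorph1.
- by rewrite rmorphB Hx ?Hy.
- by rewrite fmorph_div Hx ?Hy.
Qed.

Section Quotient.
Variables (H B : set auto) (gT : finGroupType) (G : {group gT}) (cls : auto -> gT).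
Hypothesis fq : finite_quotient H B G cls.
Local Notation M := (fixed B).

(** The identity is the default, so that a representative lies in H for every a. *)
Definition class_rep (a : gT) : auto :=
  if pselect (exists s, H s /\ cls s = a) is left e then projT1 (cid e) else rid L.

Lemma rep_in a : H (class_rep a).
Proof.
rewrite /class_rep; case: pselect => [e|_]; last by case: (fq_group fq).
by case: cid => s [].
Qed.

Lemma cls_rep a : a \in G -> cls (class_rep a) = a.
Proof.
move=> /(fq_onto fq)[s Hs sa]; rewrite /class_rep; case: pselect => [e|[]].
  by case: cid => u [].
by exists s.
Qed.

Lemma cls_id : cls (rid L) = 1%g.
Proof.
have [H1 _ _ _] := fq_group fq; have := fq_mul fq H1 H1.
rewrite -(fq_eq fq (s := rid L)) // => e; apply: (mulgI (cls (rid L))).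
by rewrite -e mulg1.
Qed.

Lemma cls_fixed s u y : H s -> H u -> cls s = cls u -> M y -> s y = u y.
Proof.
move=> Hs Hu su My; have [_ HM HV _] := fq_group fq.
have [u' [Hu' uu' u'u]] := HV _ Hu.
have Bsu : B (rcomp u' s).
  apply/(fq_ker fq); first exact: HM.
  rewrite (fq_mul fq) // su -(fq_mul fq) // -cls_id.
  by apply: (fq_eq fq) => x /=; apply: uu'.
by rewrite -{2}(My _ Bsu) /= u'u.
Qed.

Lemma fixed_stable s y : H s -> M y -> M (s y).
Proof.
move=> Hs My b Bb; have Hb := fq_sub fq Bb; have [_ HM _ _] := fq_group fq.
apply: (@cls_fixed (rcomp b s) s) => //; first exact: HM.
by rewrite (fq_mul fq) // (_ : cls b = 1%g) ?mulg1 //; apply/(fq_ker fq).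
Qed.

Lemma rep_fixed a y : M y -> M (class_rep a y).
Proof. by apply: fixed_stable; apply: rep_in. Qed.

Lemma rep1 y : M y -> class_rep 1%g y = y.
Proof.
move=> My; have [H1 _ _ _] := fq_group fq.
by apply: (@cls_fixed _ (rid L)) => //; [apply: rep_in|rewrite cls_rep ?group1 // cls_id].
Qed.

Lemma rep_auto s a y : H s -> a \in G -> M y -> s (class_rep a y) = class_rep (a * cls s)%g y.
Proof.
move=> Hs Ga My; have [_ HM _ _] := fq_group fq; have Ha := rep_in a.
apply: (@cls_fixed (rcomp s (class_rep a))) => //; first exact: HM.
- exact: rep_in.
- by rewrite (fq_mul fq) // !cls_rep ?groupM ?(fq_in fq).
Qed.

Lemma repM a b y : a \in G -> b \in G -> M y -> class_rep b (class_rep a y) = class_rep (a * b)%g y.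
Proof. by move=> Ga Gb My; rewrite rep_auto ?cls_rep //; apply: rep_in. Qed.

Definition orbit_seq y := undup [seq class_rep a y | a <- enum G].

Lemma orbit_seqP y z : reflect (exists2 a, a \in G & z = class_rep a y) (z \in orbit_seq y).
Proof.
rewrite mem_undup; apply: (iffP mapP) => [[a]|[a]]; rewrite ?mem_enum => Ga ->;
  by exists a; rewrite ?mem_enum.
Qed.

Lemma orbit_seq_id y : M y -> y \in orbit_seq y.
Proof. by move=> My; apply/orbit_seqP; exists 1%g; rewrite ?rep1. Qed.

Definition orbit_poly y := \prod_(z <- orbit_seq y) ('X - z%:P).

Lemma map_prod_XsubC (h : auto) (r : seq L) :
  map_poly h (\prod_(z <- r) ('X - z%:P)) = \prod_(z <- map h r) ('X - z%:P).
Proof.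
rewrite rmorph_prod /= big_map; apply: eq_bigr => z _.
by rewrite rmorphB /= map_polyX map_polyC.
Qed.

Lemma orbit_poly_fixed y i : M y -> fixed H (orbit_poly y)`_i.
Proof.
move=> My s Hs; suff e : map_poly s (orbit_poly y) = orbit_poly y by rewrite -coef_map e.
rewrite map_prod_XsubC; apply: perm_big; have us : uniq (map s (orbit_seq y)).
  by rewrite map_inj_uniq ?undup_uniq //; apply: fmorph_inj.
have sub : {subset map s (orbit_seq y) <= orbit_seq y}.
  move=> _ /mapP[_ /orbit_seqP[a Ga ->] ->]; apply/orbit_seqP.
  by exists (a * cls s)%g; rewrite ?groupM ?(fq_in fq) // rep_auto.
have [_ e] := uniq_min_size us sub (eq_leq (esym (size_map _ _))).
by apply: uniq_perm => //; apply: undup_uniq.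
Qed.

Lemma orbit_poly_root y : M y -> root (orbit_poly y) y.
Proof. by move=> My; rewrite root_prod_XsubC orbit_seq_id. Qed.

Lemma norm_fixed y : M y -> fixed H (\prod_(a in G) class_rep a y).
Proof.
move=> My s Hs; rewrite rmorph_prod /= [RHS](reindex_inj (mulIg (cls s))) /=.
by apply: eq_big => [a|a Ga]; rewrite ?groupMr ?(fq_in fq) ?rep_auto.
Qed.

Lemma trace_fixed y : M y -> fixed H (\sum_(a in G) class_rep a y).
Proof.
move=> My s Hs; rewrite rmorph_sum /= [RHS](reindex_inj (mulIg (cls s))) /=.
by apply: eq_big => [a|a Ga]; rewrite ?groupMr ?(fq_in fq) ?rep_auto.
Qed.

End Quotient.
End FiniteQuotients.

(** * Conjugacy of places *)

Section Conjugacy.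
Variables (K L : fieldType) (F : closedFieldType).
Variables (iota : {rmorphism K -> L}) (j : {rmorphism K -> F}).
Local Notation place := (place iota j).
Local Notation auto := {rmorphism L -> L}.

Lemma pl_prod_XsubC (P : place) (r : seq L) (v : L -> F) i :
    (forall z, z \in r -> P z = Some (v z)) ->
  P (\prod_(z <- r) ('X - z%:P))`_i = Some (\prod_(z <- r) ('X - (v z)%:P))`_i.
Proof.
elim: r i => [|z r IH] i Pr.
  by rewrite !big_nil !coef1; case: eqP; rewrite ?pl1 ?pl0.
have Pz : P z = Some (v z) by apply: Pr; rewrite mem_head.
have Pr' y : y \in r -> P y = Some (v y) by move=> yr; apply: Pr; rewrite inE yr orbT.
have {}IH l := IH l Pr'.
rewrite !big_cons !mulrBl !coefB !coefXM !coefCM; apply: plB.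
  by case: eqP; rewrite ?pl0.
by apply: plM.
Qed.

Variables (H B : set auto) (gT : finGroupType) (G : {group gT}) (cls : auto -> gT).
Hypothesis fq : finite_quotient H B G cls.
Hypothesis hK : separably_closed K.
Hypothesis HK : forall s, H s -> forall c, s (iota c) = iota c.

Lemma fixed_base c : fixed B (iota c).
Proof. by move=> s /(fq_sub fq) /HK. Qed.

(** Otherwise some y separates Q from all conjugates of P. The orbit polynomial of y has
    coefficients in the fixed field of H, where P and Q agree, so Q y is a root of its reduction;
    but these roots are the values of P at the conjugates of y. *)
Lemma conjugate_places (P Q : place) : (forall x, fixed H x -> P x = Q x) ->
  exists2 s, H s & forall y, fixed B y -> Q y = P (s y).
Proof.
move=> PQ; apply: contrapT => no.
pose R (a : gT) := place_comp P (HK (rep_in fq a)).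
pose S (u : gT + unit) := if u is inl a then R a else Q.
have [a|y [My Qy Sy]] := @separate _ _ _ _ j hK (fixed B) (@fixed_subfield_of _ _)
    fixed_base _ _ (fun=> Q) R S.
  apply: contra_notP no => /forall2NP ally; exists (class_rep H cls a); first exact: (rep_in fq a).
  by move=> y My; apply: contrapT => ne; case: (ally y).
pose v z := odflt 0 (P z).
have Pv z : z \in orbit_seq H G cls y -> P z = Some (v z).
  move=> /orbit_seqP[a Ga ->]; have : P (class_rep H cls a y) <> None := Sy (inl a).
  by rewrite /v; case: (P _).
case Qyv : (Q y) => [b|]; last by case: (Sy (inr tt)).
have : Q (orbit_poly H G cls y).[y] = Some (\prod_(z <- orbit_seq H G cls y) ('X - (v z)%:P)).[b].
  apply: pl_horner => // i; rewrite -PQ; last exact: (orbit_poly_fixed fq).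
  exact: pl_prod_XsubC.
rewrite (eqP (orbit_poly_root fq My)) pl0 => -[/esym/eqP].
rewrite -[_ == 0]/(root _ b) -(big_map v xpredT (fun z => 'X - z%:P)) root_prod_XsubC.
move=> /mapP[z zy bE]; case/orbit_seqP: (zy) => a Ga zE.
by apply: (Qy a); rewrite Qyv bE -Pv // zE.
Qed.

End Conjugacy.

(** * Tame covers of the line with one branch point *)

Section FinitePlaces.
Variables (K L : fieldType) (F : closedFieldType).
Variables (iota : {rmorphism K -> L}) (j : {rmorphism K -> F}).
Local Notation place := (place iota j).
Implicit Types P : place.

Lemma fin_val P x : P x <> None -> exists a, P x = Some a.
Proof. by case: (P x) => [a _|//]; exists a. Qed.

Lemma finD P x y : P x <> None -> P y <> None -> P (x + y) <> None.
Proof. by move=> /fin_val[a Px] /fin_val[b Py]; rewrite (plD Px Py). Qed.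

Lemma finM P x y : P x <> None -> P y <> None -> P (x * y) <> None.
Proof. by move=> /fin_val[a Px] /fin_val[b Py]; rewrite (plM Px Py). Qed.

Lemma finN P x : P x <> None -> P (- x) <> None.
Proof. by move=> /fin_val[a Px]; rewrite (plN Px). Qed.

Lemma finX P x n : P x <> None -> P (x ^+ n) <> None.
Proof. by move=> /fin_val[a Px]; rewrite (plX n Px). Qed.

Lemma fin_iota P c : P (iota c) <> None.
Proof. by rewrite pl_iota. Qed.

Lemma fin0 P : P 0 <> None. Proof. by rewrite pl0. Qed.

Lemma fin1 P : P 1 <> None. Proof. by rewrite pl1. Qed.

Lemma fin_sum P (I : Type) (r : seq I) (Q : pred I) (u : I -> L) :
  (forall i, Q i -> P (u i) <> None) -> P (\sum_(i <- r | Q i) u i) <> None.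
Proof. move=> Pu; elim/big_ind: _ => [|x y|i]; [exact: fin0|exact: finD|exact: Pu]. Qed.

Lemma fin_prod P (I : Type) (r : seq I) (Q : pred I) (u : I -> L) :
  (forall i, Q i -> P (u i) <> None) -> P (\prod_(i <- r | Q i) u i) <> None.
Proof. move=> Pu; elim/big_ind: _ => [|x y|i]; [exact: fin1|exact: finM|exact: Pu]. Qed.

Lemma fin_rat_eval P w p : P w <> None -> P (rat_eval iota w p) <> None.
Proof. by move=> /fin_val[a /(pl_rat_eval p) ->]. Qed.

Lemma fin_prod_XsubC P (I : Type) (r : seq I) (Q : pred I) (u : I -> L) i :
    (forall i, Q i -> P (u i) <> None) ->
  P (\prod_(i <- r | Q i) ('X - (u i)%:P))`_i <> None.
Proof.
move=> Pu; elim/big_ind: _ i => [i|p q Pp Pq i|k /Pu Pk i].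
- by rewrite coef1; case: eqP => _; [apply: fin1|apply: fin0].
- by rewrite coefM; apply: fin_sum => l _; apply: finM.
- rewrite coefB coefX coefC; apply: finD.
    by case: eqP => _; [apply: fin1|apply: fin0].
  by case: eqP => _; apply: finN => //; apply: fin0.
Qed.

(** The element g x is a root of the monic polynomial with coefficients g^(n - i) p_i, where n is
    the degree of p. *)
Lemma pl_integral_scale P (p : {poly L}) g x : p \is monic -> root p x ->
    (forall i, (i < (size p).-1)%N -> P (g ^+ ((size p).-1 - i) * p`_i) <> None) ->
  P (g * x) <> None.
Proof.
move=> mp px Pp; set n := (size p).-1 in Pp *.
have szp : size p = n.+1 by rewrite prednK // size_poly_gt0 monic_neq0.
have pn : p`_n = 1 by rewrite -[p`_n]/(lead_coef p) (monicP mp).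
pose q := \poly_(i < n.+1) (g ^+ (n - i) * p`_i).
have qn : g ^+ (n - n) * p`_n = 1 by rewrite subnn expr0 mul1r.
apply: (@pl_integral _ _ _ _ _ P q).
- by rewrite monicE /q lead_coef_poly //= qn ?oner_neq0.
- move=> i; rewrite coef_poly ltnS; case: ltngtP => [lt_in|_|->].
  + exact: Pp.
  + exact: fin0.
  + by rewrite qn; apply: fin1.
rewrite /root horner_poly.
have -> : \sum_(i < n.+1) g ^+ (n - i) * p`_i * (g * x) ^+ i = g ^+ n * p.[x].
  rewrite horner_coef szp mulr_sumr; apply: eq_bigr => i _.
  by rewrite exprMn mulrACA -exprD subnK ?leq_ord.
by rewrite (eqP px) mulr0.
Qed.

End FinitePlaces.

Section TameLine.
Variables (K L : fieldType) (F : closedFieldType).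
Variables (iota : {rmorphism K -> L}) (j : {rmorphism K -> F}).
Local Notation place := (place iota j).
Local Notation auto := {rmorphism L -> L}.
Variables (H B : set auto) (gT : finGroupType) (G : {group gT}) (cls : auto -> gT).
Hypothesis fq : finite_quotient H B G cls.
Hypothesis hK : separably_closed K.
Hypothesis HK : forall s, H s -> forall c, s (iota c) = iota c.
Variable w : L.
Hypothesis hw : ~ algebraicOver iota w.
Hypothesis Hw : fixed H w.
Hypothesis Hrat : forall x, fixed H x -> rational iota w x.
Local Notation M := (fixed B).
Local Notation act := (class_rep H cls).

Definition inertia (P : place) : {set gT} :=
  [set a in G | `[< forall y, M y -> P (act a y) = P y >]]%SET.

(** The integral closure of K[w] in M, described by places. *)
Definition fin_ring y : Prop := M y /\ forall P : place, P w <> None -> P y <> None.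

Lemma fixed_sub x : fixed H x -> M x.
Proof. by move=> Hx s /(fq_sub fq) /Hx. Qed.

Let MB := fixed_subfield_of B.
Let M1 : M 1. Proof. by case: MB. Qed.
Let MD x y : M x -> M y -> M (x + y). Proof. by have [_ _ h _] := subfieldP MB; apply: h. Qed.
Let MM x y : M x -> M y -> M (x * y). Proof. by have [_ _ _ h] := subfieldP MB; apply: h. Qed.
Let MV x : M x -> M x^-1. Proof. by have [_ h _ _] := subfieldP MB; apply: h. Qed.
Let MX x n : M x -> M (x ^+ n).
Proof. by move=> Mx; elim: n => [|n IH] //; rewrite exprS; apply: MM. Qed.
Let Miota c : M (iota c). Proof. exact: (fixed_base fq HK). Qed.
Let Mw : M w. Proof. exact: fixed_sub. Qed.
Let Hiota c : fixed H (iota c). Proof. by move=> s Hs; apply: HK. Qed.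

Lemma rep_fix a x : fixed H x -> act a x = x.
Proof. by apply; apply: (rep_in fq). Qed.

Lemma fixed_rat_eval p : fixed H (rat_eval iota w p).
Proof.
move=> s Hs; rewrite /rat_eval -horner_map /= Hw // -map_poly_comp.
by congr horner; apply: eq_map_poly => c /=; apply: HK.
Qed.

Let actP (P : place) a : place := place_comp P (HK (rep_in fq a)).
Let actPE P a x : actP P a x = P (act a x). Proof. by []. Qed.
Let actPw P a : actP P a w = P w. Proof. by rewrite actPE rep_fix. Qed.

Lemma fin_ringD x y : fin_ring x -> fin_ring y -> fin_ring (x + y).
Proof.
by move=> [Mx Px] [My Py]; split=> [|P Pw]; [apply: MD|apply: finD; [apply: Px|apply: Py]].
Qed.

Lemma fin_ringM x y : fin_ring x -> fin_ring y -> fin_ring (x * y).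
Proof.
by move=> [Mx Px] [My Py]; split=> [|P Pw]; [apply: MM|apply: finM; [apply: Px|apply: Py]].
Qed.

Lemma fin_ring_rat p : fin_ring (rat_eval iota w p).
Proof.
split=> [|P]; first exact/fixed_sub/fixed_rat_eval.
exact: fin_rat_eval.
Qed.

Lemma fin_ring1 : fin_ring 1.
Proof. by rewrite -(rmorph1 iota) -(rat_evalC iota w); apply: fin_ring_rat. Qed.

Lemma fin_ring0 : fin_ring 0.
Proof. by rewrite -(rmorph0 iota) -(rat_evalC iota w); apply: fin_ring_rat. Qed.

Lemma fin_ringX x n : fin_ring x -> fin_ring (x ^+ n).
Proof.
move=> Ox; elim: n => [|n IH]; first exact: fin_ring1.
by rewrite exprS; apply: fin_ringM.
Qed.

Lemma fin_ring_sum (I : Type) (r : seq I) (Q : pred I) (u : I -> L) :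
  (forall i, Q i -> fin_ring (u i)) -> fin_ring (\sum_(i <- r | Q i) u i).
Proof.
move=> Ou; elim/big_ind: _ => [|x y|i]; [exact: fin_ring0|exact: fin_ringD|exact: Ou].
Qed.

Lemma fin_act y (P : place) a : fin_ring y -> P w <> None -> P (act a y) <> None.
Proof. by move=> [_ Py] Pw; apply: (Py (actP P a)); rewrite actPw. Qed.

Lemma fixed_fin_poly x : fixed H x -> (forall P : place, P w <> None -> P x <> None) ->
  exists p, x = rat_eval iota w p.
Proof. by move=> /Hrat; apply: (rational_poly hw). Qed.

Lemma orbit_poly_rat y i : fin_ring y ->
  exists p, (orbit_poly H G cls y)`_i = rat_eval iota w p.
Proof.
move=> Oy; have My : M y by case: Oy.
apply: fixed_fin_poly; first exact: (orbit_poly_fixed fq).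
move=> P Pw; rewrite /orbit_poly big_seq.
by apply: fin_prod_XsubC => z /orbit_seqP[a _ ->]; apply: fin_act.
Qed.

Lemma orbit_poly_monic y : orbit_poly H G cls y \is monic.
Proof. exact: monic_prod_XsubC. Qed.

(** The conjugates of y are finite at P, so the coefficients of its orbit polynomial are rational
    functions of w without pole at b; g is the product of their denominators. *)
Lemma clear_denominators y (P : place) b : M y -> P w = Some b ->
    (forall a, a \in G -> P (act a y) <> None) ->
  exists2 g, ~~ root (map_poly j g) b & fin_ring (rat_eval iota w g * y).
Proof.
move=> My Pw Py; set p := orbit_poly H G cls y.
have co i : exists g : {poly K} * {poly K}, ~~ root (map_poly j g.2) b /\
    rat_eval iota w g.2 * p`_i = rat_eval iota w g.1.
  have [g [h [cgh h0 pE]]] := Hrat (orbit_poly_fixed fq i My).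
  exists (g, h); split=> /=; last by rewrite /p pE mulrC divfK.
  apply/negP => hb; have := pl_rational_pole cgh h0 Pw hb; rewrite -pE.
  rewrite /orbit_poly big_seq; apply: fin_prod_XsubC => z /orbit_seqP[a Ga ->].
  exact: Py.
have [c cP] := choice co.
pose n := (size p).-1; pose g := \prod_(i < n) (c i).2.
exists g.
  rewrite /g rmorph_prod /root horner_prod; apply/prodf_neq0 => i _.
  by have [] := cP i.
split=> [|P' P'w]; first by apply: MM => //; apply/fixed_sub/fixed_rat_eval.
apply: (pl_integral_scale (p := p)); [exact: orbit_poly_monic|exact: (orbit_poly_root fq)|].
move=> i; rewrite -/n => lt_in.
rewrite -(prednK (_ : 0 < n - i)%N) ?subn_gt0 // exprSr -mulrA; apply: finM.
  by apply/finX/fin_rat_eval.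
rewrite /g (bigD1 (Ordinal lt_in)) //= mulrC rat_evalM mulrA [p`_i * _]mulrC.
by rewrite (cP i).2; apply: finM; apply: fin_rat_eval.
Qed.

Lemma separate_conjugates (P : place) (I : {set gT}) :
    (forall a, a \in G -> a \in I -> exists2 y, M y & P (act a y) <> P y) ->
  exists y, [/\ M y, forall a, a \in G -> P (act a y) <> None &
    forall a, a \in G -> a \in I -> P (act a y) <> P y].
Proof.
move=> PI; pose T := {a : gT | (a \in G) && (a \in I)}.
have [|y [My Py Ry]] := @separate _ _ _ _ j hK M MB Miota T gT
    (fun a => actP P (val a)) (fun=> P) (actP P).
  by move=> [a aP]; have /andP[Ga Ia] := aP; apply: PI.
exists y; split=> // [a _|a Ga Ia]; first exact: Ry.
have aP : (a \in G) && (a \in I) by rewrite Ga Ia.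
exact: (Py (Sub a aP)).
Qed.

Lemma trace_horner (z y : L) (q : {poly L}) : M z -> M y ->
  \sum_(a in G) act a z * q.[act a y] =
  \sum_(i < size q) q`_i * \sum_(a in G) act a (z * y ^+ i).
Proof.
move=> Mz My; under [RHS]eq_bigr do rewrite mulr_sumr.
rewrite exchange_big; apply: eq_bigr => a _ /=.
rewrite horner_coef mulr_sumr; apply: eq_bigr => i _.
by rewrite rmorphM rmorphXn mulrCA.
Qed.

(* q = \prod_(a in G, not in the inertia group) (X - act a y) kills the conjugates of y *)
(* off the inertia group and takes one nonzero value on the others.                    *)
Lemma inertia_poly (P : place) : exists y (q : {poly L}), [/\ M y,
    forall a, a \in G -> P (act a y) <> None, forall i, P q`_i <> None,
    forall a, a \in G -> a \notin inertia P -> q.[act a y] = 0 &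
    exists2 r, r != 0 & forall a, a \in inertia P -> P q.[act a y] = Some r].
Proof.
have [|y [My Py Pny]] := @separate_conjugates P (~: inertia P)%SET.
  move=> a Ga; rewrite !inE Ga /= => /asboolPn/existsNP[y /not_implyP[My ne]].
  by exists y.
pose q := \prod_(a in G :\: inertia P) ('X - (act a y)%:P).
have qfin i : P q`_i <> None.
  by apply: fin_prod_XsubC => a; rewrite inE => /andP[_ Ga]; apply: Py.
exists y, q; split=> //.
  move=> a Ga aI; rewrite /q (bigD1 a) ?finset.in_setD ?aI ?Ga //=.
  by rewrite hornerM hornerXsubC subrr mul0r.
have Py1 : P y <> None by have := Py 1%g (group1 G); rewrite (rep1 fq).
pose v x := odflt 0 (P x); have vE x : P x <> None -> P x = Some (v x).
  by rewrite /v; case: (P x).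
exists (\prod_(a in G :\: inertia P) (v y - v (act a y))).
  apply/prodf_neq0 => a; rewrite inE => /andP[aI Ga]; rewrite subr_eq0.
  apply: contra_not_neq (Pny a Ga _); last by rewrite inE.
  by move=> e; rewrite (vE _ Py1) (vE _ (Py _ Ga)) e.
move=> a; rewrite inE => /andP[Ga /asboolP aI].
rewrite horner_prod; apply: pl_prod => b; rewrite inE => /andP[_ Gb].
rewrite hornerXsubC; apply: plB; last exact/vE/Py.
by rewrite (aI _ My) vE.
Qed.

Hypothesis unramified : forall P : place, P w <> None -> inertia P = [set 1%g]%SET.

(** The different is trivial where the cover is unramified. With y and q from [inertia_poly], the
    sum of the act a z * q.[act a y] has only its term z * q.[y] for a = 1; by [trace_horner] it is
    also a combination of traces of z y^i, which are finite at P once the denominators of the y^i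
    are cleared by powers of u. *)
Lemma trace_dual_fin z : M z ->
    (forall y, fin_ring y -> exists p, \sum_(a in G) act a (z * y) = rat_eval iota w p) ->
  fin_ring z.
Proof.
move=> Mz trz; split=> // P Pw; have [b Pwb] := fin_val Pw.
have [y [q [My Py Pq q0 [r r0 qr]]]] := inertia_poly P.
have [g gb Oy] := clear_denominators My Pwb Py.
set u := rat_eval iota w g; have Pu : P u = Some (map_poly j g).[b] by apply: pl_rat_eval.
pose n := size q.
have : P (u ^+ n * \sum_(i < n) q`_i * \sum_(a in G) act a (z * y ^+ i)) <> None.
  rewrite mulr_sumr; apply: fin_sum => i _; rewrite mulrCA; apply: finM => //.
  rewrite mulr_sumr.
  have [p pE] := trz _ (fin_ringM (fin_ring_rat (g ^+ (n - i))) (fin_ringX i Oy)).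
  suff -> : \sum_(a in G) u ^+ n * act a (z * y ^+ i) = rat_eval iota w p by apply: fin_rat_eval.
  rewrite -pE; apply: eq_bigr => a Ga.
  have uE m : rat_eval iota w (g ^+ m) = u ^+ m.
    by rewrite /u /rat_eval rmorphXn horner_exp.
  have Hu m : fixed H (u ^+ m) by rewrite -uE; apply: fixed_rat_eval.
  have -> : z * (rat_eval iota w (g ^+ (n - i)) * (u * y) ^+ i) = u ^+ n * (z * y ^+ i).
    rewrite uE exprMn mulrCA [z * (_ * _)]mulrCA mulrA -exprD.
    by rewrite subnK // ltnW.
  by rewrite [in RHS]rmorphM (rep_fix _ (Hu n)).
rewrite -trace_horner // (bigD1 1%g) //= (rep1 fq) // (rep1 fq) // big1 ?addr0; last first.
  by move=> a /andP[Ga a1]; rewrite q0 ?mulr0 // unramified // inE.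
have Pq1 : P q.[y] = Some r.
  by have := qr 1%g; rewrite unramified // inE eqxx (rep1 fq) //; apply.
have Pc := plM (plX n Pu) Pq1; move=> Pz.
have c0 : (map_poly j g).[b] ^+ n * r != 0 by rewrite mulf_neq0 // expf_neq0.
have -> : z = u ^+ n * (z * q.[y]) * (u ^+ n * q.[y])^-1.
  have cN0 : u ^+ n * q.[y] != 0.
    by apply: (@pl_neq0 _ _ _ _ _ P); rewrite Pc => -[/eqP]; rewrite (negPf c0).
  by rewrite mulrCA mulfK.
by apply: finM => //; rewrite (plV Pc c0).
Qed.

Hypothesis tame_inf : forall P : place, P w = None -> #|inertia P|%:R != 0 :> F.

Section AtInfinity.
Variable Q : place.
Hypothesis Qw : Q w = None.
Let Qw' : Q w^-1 = Some 0. Proof. exact: plV0. Qed.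
Let w0 : w != 0. Proof. by apply: (@pl_neq0 _ _ _ _ _ Q); rewrite Qw. Qed.

(** The places of M over w = oo are the conjugates of Q, so this is the integral closure in M of the
    local ring of the line at oo. *)
Definition inf_ring y : Prop := M y /\ forall a, a \in G -> Q (act a y) <> None.

Lemma inf_ringD x y : inf_ring x -> inf_ring y -> inf_ring (x + y).
Proof.
move=> [Mx Qx] [My Qy]; split=> [|a Ga]; first exact: MD.
by rewrite rmorphD; apply: finD; [apply: Qx|apply: Qy].
Qed.

Lemma inf_ringM x y : inf_ring x -> inf_ring y -> inf_ring (x * y).
Proof.
move=> [Mx Qx] [My Qy]; split=> [|a Ga]; first exact: MM.
by rewrite rmorphM; apply: finM; [apply: Qx|apply: Qy].
Qed.

Lemma inf_ring_fixed x : fixed H x -> Q x <> None -> inf_ring x.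
Proof. by move=> Hx Qx; split=> [|a _]; [apply: fixed_sub|rewrite rep_fix]. Qed.

Lemma inf_ring_iota c : inf_ring (iota c).
Proof. by apply: inf_ring_fixed => //; apply: fin_iota. Qed.

Lemma inf_ring1 : inf_ring 1.
Proof. by rewrite -(rmorph1 iota); apply: inf_ring_iota. Qed.

Lemma inf_ring0 : inf_ring 0.
Proof. by rewrite -(rmorph0 iota); apply: inf_ring_iota. Qed.

Lemma inf_ringV n : inf_ring (w^-1 ^+ n).
Proof.
apply: inf_ring_fixed; last by rewrite (plX n Qw').
by move=> s Hs; rewrite rmorphXn fmorphV Hw.
Qed.

Lemma inf_ringX x n : inf_ring x -> inf_ring (x ^+ n).
Proof.
move=> Ox; elim: n => [|n IH]; first exact: inf_ring1.
by rewrite exprS; apply: inf_ringM.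
Qed.

Lemma inf_ring_sum (I : Type) (r : seq I) (R : pred I) (u : I -> L) :
  (forall i, R i -> inf_ring (u i)) -> inf_ring (\sum_(i <- r | R i) u i).
Proof.
move=> Ou; elim/big_ind: _ => [|x y|i]; [exact: inf_ring0|exact: inf_ringD|exact: Ou].
Qed.

(** The norm of y is a polynomial in w that vanishes at w = oo, hence it is 0. *)
Lemma fin_ring_inf0 y : fin_ring y -> (forall a, a \in G -> Q (act a y) = Some 0) -> y = 0.
Proof.
move=> Oy Qy; have My : M y by case: Oy.
have [|p Np] := fixed_fin_poly (norm_fixed fq My).
  by move=> P Pw; apply: fin_prod => a _; apply: fin_act.
have := pl_prod (index_enum gT) (v := fun=> 0) Qy; rewrite Np => Qp.
have p0 : p = 0.
  apply: (rat_eval_inf0 Qw); rewrite Qp prodr_const expr0n.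
  by rewrite eqn0Ngt cardG_gt0.
move: Np => /eqP; rewrite p0 /rat_eval rmorph0 horner0 prodf_seq_eq0 => /hasP[a _].
by rewrite fmorph_eq0 => /andP[_ /eqP].
Qed.

(** The orbit polynomial has constant coefficients and distinct roots, and K is separably closed. *)
Lemma fin_ring_inf_const y : fin_ring y -> inf_ring y -> exists c, y = iota c.
Proof.
move=> Oy [My Qy].
have co i : exists c, (orbit_poly H G cls y)`_i = iota c.
  have [p pE] := orbit_poly_rat i Oy.
  have /(rat_eval_const Qw)/size1_polyC sp : Q (rat_eval iota w p) <> None.
    rewrite -pE /orbit_poly big_seq.
    by apply: fin_prod_XsubC => z /orbit_seqP[a Ga ->]; apply: Qy.
  by exists p`_0; rewrite pE {1}sp rat_evalC.
have [c cE] := choice co.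
set p := orbit_poly H G cls y in cE.
pose r := \poly_(i < size p) c i.
have pE : map_poly iota r = p.
  apply/polyP => i; rewrite coef_map coef_poly; case: ltnP => [_|le]; first by rewrite cE.
  by rewrite nth_default /= ?rmorph0.
apply: (sep_closed_root hK (p := r)); last by rewrite pE; apply: (orbit_poly_root fq).
by rewrite -(separable_map iota) pE separable_prod_XsubC undup_uniq.
Qed.

(** Tameness bounds the different at oo: z has poles of order less than the ramification index.
    Otherwise a sum as in [trace_dual_fin] vanishes at P because of the factor w^-1 before the
    traces, while its terms over the inertia group all reduce to the same nonzero e * r, and the
    order of that group is invertible in F. *)
Lemma trace_inf z : M z ->
    (forall y, inf_ring y -> Q (\sum_(a in G) act a (z * y)) <> None) ->
  forall a, a \in G -> Q (act a (w^-1 * z)) = Some 0.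
Proof.
move=> Mz trz a0 Ga0; pose z1 := w^-1 * z; apply: contrapT => /= nz.
have Mz1 : M z1 by apply: MM => //; apply: MV.
pose vals := [seq - odflt 0 (Q (act a z1)) | a <- enum G].
have [c cv] := sep_closed_avoid hK j (0 :: vals).
move: cv; rewrite inE negb_or => /andP[c0 cv].
have z1c a : a \in G -> Q (act a z1 + iota c) <> Some 0.
  move=> Ga; case Qz : (Q (act a z1)) => [b|].
    rewrite (plD Qz (pl_iota Q c)) => -[/eqP]; rewrite addrC addr_eq0 => /eqP cb.
    by case/negP: cv; rewrite cb; apply/mapP; exists a; rewrite ?mem_enum // Qz.
  move=> Qzc; have := plB Qzc (pl_iota Q c); by rewrite addrK Qz.
(* z1 may have poles, so it is replaced by z2 = z1 / (z1 + c), which is finite at all conjugates of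
   Q and nonzero at P; c is chosen so that no denominator reduces to 0. *)
pose u := (z1 + iota c)^-1.
have uE a : act a u = (act a z1 + iota c)^-1.
  by rewrite fmorphV rmorphD (rep_fix _ (Hiota c)).
have Qu a : a \in G -> exists2 b, Q (act a u) = Some b &
    (b = 0 \/ exists2 e, Q (act a z1) = Some e & b = (e + j c)^-1).
  move=> Ga; rewrite uE; case Qz : (Q (act a z1)) => [e|].
    exists (e + j c)^-1; last by right; exists e.
    apply: plV; first exact: plD Qz (pl_iota Q c).
    by apply/eqP => e0; apply: (z1c a Ga); rewrite (plD Qz (pl_iota Q c)) e0.
  exists 0; last by left.
  apply: plV0; case Qzc : (Q (act a z1 + iota c)) => [e|//].
  by have := plB Qzc (pl_iota Q c); rewrite addrK Qz.
have Mu : M u by apply/MV/MD.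
have Iu : inf_ring u by split=> // a /Qu[b ->].
pose z2 := 1 - iota c * u.
have z2E : z2 = w^-1 * (z * u).
  have n0 : z1 + iota c != 0.
    apply: contraTneq (group1 G) => e; apply/negP => /z1c.
    by rewrite (rep1 fq) // e pl0.
  by rewrite mulrA -/z1 /z2 -[1](divff n0) -mulrBl addrK.
have Mz2 : M z2 by rewrite z2E; apply: MM; [apply: MV|apply: MM].
pose P := actP Q a0; have Pw : P w = None by rewrite actPw.
have [e Pz2 e0] : exists2 e, P z2 = Some e & e != 0.
  have [b Qb bE] := Qu a0 Ga0.
  exists (1 - j c * b).
    by apply: plB; [apply: pl1|apply: plM; [apply: pl_iota|]].
  case: bE => [->|[e Qe bE]]; first by rewrite mulr0 subr0 oner_neq0.
  have ec : e + j c != 0.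
    by apply/eqP => e0; apply: (z1c a0 Ga0); rewrite (plD Qe (pl_iota Q c)) e0.
  rewrite bE -[1](divff ec) -mulrBl addrK mulf_neq0 ?invr_eq0 //.
  by apply/eqP => e0; apply: nz; rewrite -e0.
have [y [q [My Py Pq q0 [r r0 qr]]]] := inertia_poly P.
have Iy : inf_ring y.
  split=> // a Ga; have := Py (a * a0^-1)%g; rewrite actPE groupM ?groupV // => /(_ isT).
  by rewrite (repM fq) ?groupM ?groupV // mulgKV.
have : P (\sum_(a in G) act a z2 * q.[act a y]) = Some 0.
  rewrite trace_horner //.
  rewrite -[X in Some X](@big1_eq _ _ +%R 'I_(size q) (index_enum _) xpredT).
  apply: pl_sum => i _; have [b Pqi] := fin_val (Pq i).
  rewrite -[X in Some X](mulr0 b); apply: plM => //.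
  have [b' Qb'] := fin_val (trz _ (inf_ringM Iu (inf_ringX i Iy))).
  have -> : \sum_(a in G) act a (z2 * y ^+ i) = w^-1 * \sum_(a in G) act a (z * (u * y ^+ i)).
    rewrite mulr_sumr; apply: eq_bigr => a _.
    by rewrite z2E -[w^-1 * _ * _]mulrA [act a (w^-1 * _)]rmorphM fmorphV (rep_fix _ Hw) mulrA.
  rewrite -[X in Some X](mul0r b'); apply: plM; first by rewrite actPE fmorphV rep_fix.
  rewrite actPE rep_fix //; apply: (trace_fixed fq).
  by apply: MM => //; apply: MM => //; apply: MX.
rewrite (big_setID (inertia P)) /= [X in _ + X]big1 ?addr0; last first.
  by move=> a; rewrite finset.inE => /andP[aI Ga]; rewrite q0 ?mulr0.
have GI : (G :&: inertia P)%SET = inertia P.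
  by apply/finset.setIidPr/fintype.subsetP => a; rewrite inE => /andP[].
rewrite -[Q (class_rep _ _ _ _)]/(P _) (pl_sum _ (v := fun=> e * r)) => [|a]; last first.
  rewrite GI => aI; apply: plM; last exact: qr.
  by move: aI; rewrite inE => /andP[_ /asboolP ->].
rewrite sumr_const GI -mulr_natr => -[/eqP]; apply/negP.
by rewrite !mulf_neq0 // tame_inf.
Qed.

(** The columns of the matrix of conjugates are independent over L; for b in M this makes b a basis
    of M over the fixed field of H. *)
Definition free_family (b : 'I_#|G| -> L) : Prop :=
  forall x : 'I_#|G| -> L, (forall a, a \in G -> \sum_k act a (b k) * x k = 0) ->
  forall k, x k = 0.

Let W (b : 'I_#|G| -> L) : 'M[L]_#|G| := \matrix_(i, k) act (enum_val i) (b k).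

Lemma free_unitmx b : free_family b -> W b \in unitmx.
Proof.
move=> fb; rewrite -unitmx_tr -row_free_unit -kermx_eq0; apply/rowV0P => v.
move=> /sub_kermxP vW; apply/rowP => k; rewrite mxE; apply: (fb (fun k => v 0 k)) => a Ga.
have /rowP/(_ (enum_rank_in Ga a)) := vW; rewrite !mxE => e; rewrite -[RHS]e.
by apply: eq_bigr => l _; rewrite !mxE enum_rankK_in // mulrC.
Qed.

(** The linear system for the coordinates is solved over L. An automorphism in H permutes its
    equations, so it fixes the unique solution. *)
Lemma free_coordinates b y : free_family b -> (forall k, M (b k)) -> M y ->
  exists2 c, (forall k, fixed H (c k)) & y = \sum_k b k * c k.
Proof.
move=> fb Mb My; pose c := invmx (W b) *m \col_i act (enum_val i) y.
have cE a : a \in G -> act a y = \sum_k act a (b k) * c k 0.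
  move=> Ga; have : W b *m c = \col_i act (enum_val i) y by rewrite mulKVmx ?free_unitmx.
  move/matrixP/(_ (enum_rank_in Ga a) 0); rewrite !mxE enum_rankK_in // => <-.
  by apply: eq_bigr => l _; rewrite !mxE enum_rankK_in.
exists (fun k => c k 0); last first.
  have := cE 1%g (group1 G); rewrite (rep1 fq) // => {1}->.
  by apply: eq_bigr => k _; rewrite (rep1 fq).
move=> k s Hs; apply/eqP; rewrite -subr_eq0; apply/eqP; move: k.
apply: (fb (fun k => s (c k 0) - c k 0)) => a Ga; under eq_bigr do rewrite mulrBr.
have Gs : (cls s)^-1%g \in G by rewrite groupV (fq_in fq).
have sE x : M x -> s (act (a * (cls s)^-1)%g x) = act a x.
  by move=> Mx; rewrite (rep_auto fq) ?groupM // mulgKV.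
rewrite sumrB -cE // -(sE _ My) cE ?groupM // rmorph_sum /=.
rewrite -sumrB big1 // => k _; by rewrite rmorphM sE // subrr.
Qed.

Lemma free_dual b J : free_family b -> exists v : gT -> L,
  (forall k, \sum_(a in G) v a * act a (b k) = (k == J)%:R) /\
  forall u : gT -> L, (forall k, \sum_(a in G) u a * act a (b k) = (k == J)%:R) ->
    forall a, a \in G -> u a = v a.
Proof.
move=> fb; have uW := free_unitmx fb.
pose vr (u : gT -> L) : 'rV[L]_#|G| := \row_i u (enum_val i).
have vrE u k : (vr u *m W b) 0 k = \sum_(a in G) u a * act a (b k).
  rewrite mxE [RHS]big_enum_val /=; apply: eq_bigr => i _; by rewrite !mxE.
pose r := delta_mx 0 J *m invmx (W b) : 'rV[L]_#|G|.
pose v a := if insub a is Some u then r 0 (enum_rank_in (group1 G) (val (u : {x | x \in G}))) else 0.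
have vv : vr v = r.
  apply/rowP => i; rewrite mxE /v; case: insubP => [u _ uE|]; last by rewrite enum_valP.
  by rewrite uE enum_valK_in.
exists v; split=> [k|u uE a Ga].
  by rewrite -vrE vv mulmxKV // mxE eqxx eq_sym.
have : vr u = vr v.
  apply: (can_inj (mulmxK uW)); rewrite vv mulmxKV //; apply/rowP => k.
  by rewrite vrE uE mxE eqxx eq_sym.
move/rowP/(_ (enum_rank_in Ga a)); by rewrite !mxE enum_rankK_in.
Qed.

(* b spans the functions regular away from w = oo, and m bounds its pole orders there.   *)
(* A basis that minimizes the sum of the m k splits the direct image of the structure    *)
(* sheaf on P^1 as the sum of the O(- m k).                                              *)
Definition bounded_basis (b : 'I_#|G| -> L) (m : 'I_#|G| -> nat) : Prop :=
  [/\ free_family b, forall k, fin_ring (b k) & forall k, inf_ring (w^-1 ^+ m k * b k)].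

(** An element that separates an unramified place from its conjugates has distinct conjugates; a
    denominator is then cleared. *)
Lemma primitive_element : exists2 y, fin_ring y & {in G &, injective (fun a => act a y)}.
Proof.
have [P Pw] := place_at j hw 0; have Pwf : P w <> None by rewrite Pw.
have [|y [My Py Pny]] := @separate_conjugates P (~: inertia P)%SET.
  move=> a Ga; rewrite !inE Ga /= => /asboolPn/existsNP[y /not_implyP[My ne]].
  by exists y.
have [g g0 Oy] := clear_denominators My Pw Py.
exists (rat_eval iota w g * y) => // a b Ga Gb; rewrite !rmorphM !(rep_fix _ (fixed_rat_eval g)).
have gN0 : rat_eval iota w g != 0.
  apply: (@pl_neq0 _ _ _ _ _ P); rewrite (pl_rat_eval g Pw) => -[/eqP].
  by apply/negP.
move=> /(mulfI gN0) e; apply: contrapT => /eqP ab.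
have Gab : (a * b^-1)%g \in G by rewrite groupM ?groupV.
apply: (Pny _ Gab); last first.
  congr (P _); apply: (fmorph_inj (act b)).
  by rewrite (repM fq) // mulgKV.
by rewrite unramified // !inE -eq_mulgV1.
Qed.

Lemma degree_bound y : fin_ring y -> exists m, inf_ring (w^-1 ^+ m * y).
Proof.
move=> Oy; have My : M y by case: Oy.
have [p pE] := choice (fun i => orbit_poly_rat i Oy).
set q := orbit_poly H G cls y in pE; pose n := (size q).-1.
exists (\max_(i < n) size (p i)); split=> [|a Ga].
  by apply: MM => //; apply: (inf_ringV _).1.
rewrite rmorphM rmorphXn fmorphV (rep_fix _ Hw).
apply: (pl_integral_scale (p := q)); first exact: orbit_poly_monic.
  by rewrite root_prod_XsubC; apply/orbit_seqP; exists a.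
move=> i; rewrite -/n => lt_in; rewrite pE -exprM.
set l := (_ * _)%N; have le_l : ((size (p i)).-1 <= l)%N.
  rewrite /l (leq_trans (leq_pred _)) // -[X in (X <= _)%N]muln1 leq_mul ?subn_gt0 //.
  exact: (leq_bigmax (Ordinal lt_in)).
rewrite -(subnK le_l) exprD -mulrA; apply: finM; first by rewrite (plX _ Qw').
by rewrite pl_rat_evalV.
Qed.

(** The powers of a primitive element: a dependence would be a polynomial of degree less than |G|
    with |G| distinct roots. *)
Lemma bounded_basis_exists : exists b m, bounded_basis b m.
Proof.
have [y Oy injy] := primitive_element; have [m Iy] := degree_bound Oy.
exists (fun k => y ^+ k), (fun k : 'I__ => (m * k)%N); split.
- move=> x x0 k; pose p := \poly_(i < #|G|) oapp x 0 (insub i).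
  have pk (i : 'I_#|G|) : p`_i = x i.
    rewrite coef_poly ltn_ord insubT ?ltn_ord // => lt_i /=; congr x; exact: val_inj.
  suff : p == 0 by move=> /eqP p0; rewrite -pk p0 coef0.
  apply: contraT => p0; have : (size [seq act a y | a <- enum G] < size p)%N; last first.
    by rewrite size_map -cardE ltnNge size_poly.
  apply: max_poly_roots => //.
    apply/allP => z /mapP[a]; rewrite mem_enum => Ga ->.
    rewrite /root (@horner_coef_wide _ #|G|) ?size_poly //; apply/eqP.
    rewrite -[RHS](x0 a Ga); apply: eq_bigr => i _.
    by rewrite pk mulrC rmorphXn.
  rewrite map_inj_in_uniq ?enum_uniq // => a b; rewrite !mem_enum; exact: injy.
- by move=> k; apply: fin_ringX.
- by move=> k; rewrite exprM -exprMn; apply: inf_ringX.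
Qed.

Definition minimal_basis b m : Prop := bounded_basis b m /\
  forall b' m', bounded_basis b' m' -> (\sum_k m k <= \sum_k m' k)%N.

Lemma minimal_basis_exists : exists b m, minimal_basis b m.
Proof.
have exn : exists n, `[< exists b m, bounded_basis b m /\ (\sum_k m k)%N = n >].
  have [b [m bm]] := bounded_basis_exists; exists (\sum_k m k)%N; apply/asboolP.
  by exists b, m.
case: (ex_minnP exn) => n /asboolP[b [m [bm mn]]] minn; exists b, m; split=> // b' m' bm'.
by rewrite mn; apply: minn; apply/asboolP; exists b', m'.
Qed.

(** Otherwise y can replace b J with the bound m J lowered by one. If m J = 0, then y vanishes at
    oo, so y = 0, against freeness. *)
Lemma minimal_basis_reduced b m (c : 'I_#|G| -> L) J :
    minimal_basis b m -> (forall k, fixed H (c k)) -> c J != 0 ->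
    let y := \sum_k b k * c k in
  fin_ring y -> ~ inf_ring (w * (w^-1 ^+ m J * y)).
Proof.
move=> [[fb Ob Ib] minb] Hc cJ y Oy Iy; have My : M y by case: Oy.
have actE a : act a y = \sum_k act a (b k) * c k.
  by rewrite /y rmorph_sum; apply: eq_bigr => k _; rewrite rmorphM (rep_fix _ (Hc k)).
have [m0|m_gt0] := posnP (m J).
  move: Iy; rewrite m0 mul1r => -[_ Iy].
  have y0 : y = 0.
    apply: (fin_ring_inf0 Oy) => a Ga; have [e Qe] := fin_val (Iy a Ga).
    have := plM Qw' Qe; rewrite mul0r => <-; congr (Q _).
    by rewrite rmorphM (rep_fix _ Hw) mulKf.
  case/eqP: cJ; apply: (fb c) => a Ga; by rewrite -actE y0 rmorph0.
pose b' k := if k == J then y else b k.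
pose m' k := if k == J then (m J).-1 else m k.
have : (\sum_k m k <= \sum_k m' k)%N.
  apply: (minb b'); split.
  - move=> x x0.
    pose x' k := (if k == J then 0 else x k) + x J * c k.
    have x'0 : forall k, x' k = 0.
      apply: fb => a Ga; rewrite -[RHS](x0 a Ga) [RHS](bigD1 J) //= /b' eqxx actE mulr_suml.
      rewrite (eq_bigr (fun k => act a (b k) * (if k == J then 0 else x k) +
          act a (b k) * c k * x J)) => [|k _]; last first.
        by rewrite /x' mulrDr [x J * _]mulrC mulrA.
      rewrite big_split addrC /=; congr (_ + _).
      rewrite (bigD1 J) //= eqxx mulr0 add0r.
      by apply: eq_bigr => k /negPf ->.
    have xJ : x J = 0.
      move/eqP: (x'0 J); rewrite /x' eqxx add0r mulf_eq0 (negPf cJ) orbF; by move/eqP.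
    move=> k; have [->//|kJ] := eqVneq k J.
    by have := x'0 k; rewrite /x' (negPf kJ) xJ mul0r addr0.
  - by move=> k; rewrite /b'; case: eqP.
  - move=> k; rewrite /b' /m'; case: eqP => // _.
    suff -> : w^-1 ^+ (m J).-1 * y = w * (w^-1 ^+ m J * y) by [].
    by rewrite mulrA -{2}(prednK m_gt0) exprS mulVKf.
rewrite (bigD1 J) //= [X in (_ <= X)%N](bigD1 J) //= /m' eqxx.
rewrite [X in (_ <= _ + X)%N](eq_bigr m) => [|k /negPf -> //].
by rewrite leq_add2r leqNgt prednK // leqnn.
Qed.

Lemma inf_ring_scaled_sum b m (x : 'I_#|G| -> L) n : bounded_basis b m ->
    (forall k, fixed H (x k)) -> (forall k, Q (x k) <> None) ->
    (forall k, x k != 0 -> (m k <= n)%N) ->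
  inf_ring (\sum_k w^-1 ^+ n * (x k * b k)).
Proof.
move=> [_ _ Ib] Hx Qx xm; apply: inf_ring_sum => k _.
have [->|/xm le_mn] := eqVneq (x k) 0; first by rewrite mul0r mulr0; apply: inf_ring0.
have -> : w^-1 ^+ n * (x k * b k) = x k * w^-1 ^+ (n - m k) * (w^-1 ^+ m k * b k).
  by rewrite -{1}(subnK le_mn) exprD mulrACA [X in X * _]mulrC.
apply: inf_ringM.
  by apply: inf_ringM; [apply: inf_ring_fixed|apply: inf_ringV].
exact: Ib.
Qed.

Lemma rational_split x : fixed H x -> exists p y,
  [/\ x = rat_eval iota w p + y, fixed H y & Q (w * y) <> None].
Proof.
move=> Hx; have [p [q [_ q0 xE]]] := Hrat Hx.
have qN0 : q != 0 by rewrite -(rat_eval_eq0 hw).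
exists (p %/ q), (rat_eval iota w (p %% q) / rat_eval iota w q); split.
- rewrite xE {1}(divp_eq p q) rat_evalD rat_evalM mulrDl mulfK //.
- have [_ _ h] := fixed_subfield_of H; apply: h; exact: fixed_rat_eval.
have [r0|r0] := eqVneq (p %% q) 0.
  by rewrite r0 /rat_eval rmorph0 horner0 mul0r mulr0 pl0.
rewrite mulrA -{1}(rat_evalX iota w) -rat_evalM pl_rational_inf ?mulf_neq0 ?polyX_eq0 //.
rewrite mulrC size_mulX //; case: ltngtP => //.
by rewrite ltnNge ltn_modp qN0.
Qed.

(** A minimal basis is a K[w]-basis of [fin_ring]. The polynomial parts of the coordinates are
    subtracted; among the indices whose remainder is nonzero, one with m J largest would contradict
    [minimal_basis_reduced]. *)
Lemma minimal_basis_fin b m c : minimal_basis b m -> (forall k, fixed H (c k)) ->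
    fin_ring (\sum_k b k * c k) ->
  forall k, exists p, c k = rat_eval iota w p.
Proof.
move=> mbm Hc Oy; have [bbm _] := mbm; have [fb Ob Ib] := bbm.
have [p pE] := choice (fun k => rational_split (Hc k)).
have [x xE] := choice pE.
have Oz : fin_ring (\sum_k b k * x k).
  have -> : \sum_k b k * x k = \sum_k b k * c k + \sum_k - rat_eval iota w (p k) * b k.
    rewrite -big_split; apply: eq_bigr => k _ /=; have [-> _ _] := xE k.
    by rewrite mulNr [_ * b k]mulrC -mulrBr addrAC subrr add0r.
  apply: fin_ringD => //; apply: fin_ring_sum => k _; apply: fin_ringM => //.
  by rewrite -mulN1r; apply: fin_ringM; [have [? Po] := fin_ring1; rewrite -[1](rmorph1 iota)
     -rmorphN -(rat_evalC iota w)|]; apply: fin_ring_rat.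
suff x0 k : x k = 0 by move=> k; exists (p k); have [-> _ _] := xE k; rewrite x0 addr0.
apply: contrapT => /eqP xk0.
case: (@arg_maxnP _ k (fun i => x i != 0) m xk0) => J xJ maxJ.
apply: (minimal_basis_reduced mbm (c := x) (J := J)) => //; first by move=> i; case: (xE i).
have -> : w * (w^-1 ^+ m J * \sum_k0 b k0 * x k0) = \sum_k0 w^-1 ^+ m J * ((w * x k0) * b k0).
  by rewrite !mulr_sumr; apply: eq_bigr => i _; rewrite mulrCA; congr (_ * _); rewrite [b i * _]mulrC mulrA.
apply: (inf_ring_scaled_sum (x := fun i => w * x i) bbm) => i.
- by move=> s Hs; have [_ Hxi _] := xE i; rewrite rmorphM Hw ?Hxi.
- by case: (xE i).
- by rewrite mulf_eq0 negb_or => /andP[_]; apply: maxJ.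
Qed.

Lemma rational_inf_split x : fixed H x -> Q x <> None ->
  exists g, Q (w * (x - iota g)) <> None.
Proof.
move=> Hx Qx; have [p [y [xE Hy Qy]]] := rational_split Hx.
have Qy0 : Q y = Some 0.
  have [e Qe] := fin_val Qy; have := plM Qw' Qe; by rewrite mulKf // mul0r.
have : Q (rat_eval iota w p) <> None.
  rewrite (_ : rat_eval iota w p = x - y); first by apply: finD => //; apply: finN; rewrite Qy0.
  by rewrite xE addrK.
move=> /(rat_eval_const Qw)/size1_polyC pE; exists p`_0.
by rewrite xE {1}pE rat_evalC addrAC subrr add0r.
Qed.

(** The w^-1 ^+ m k * b k form a basis of [inf_ring] over the local ring at oo. If the w ^+ m k * c
    k had largest pole order e > 0, with leading constants g k, then the sum of the g k * w ^+ (m J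
    - m k) * b k, for m J largest among the k with g k nonzero, would contradict
    [minimal_basis_reduced]. *)
Lemma minimal_basis_inf b m c : minimal_basis b m -> (forall k, fixed H (c k)) ->
    inf_ring (\sum_k b k * c k) ->
  forall k, Q (w ^+ m k * c k) <> None.
Proof.
move=> mbm Hc Iy; have [bbm _] := mbm; have [fb Ob Ib] := bbm.
have Hwn n : fixed H (w ^+ n) by move=> s Hs; rewrite rmorphXn Hw.
have HVn n : fixed H (w^-1 ^+ n) by move=> s Hs; rewrite rmorphXn fmorphV Hw.
have HM x y : fixed H x -> fixed H y -> fixed H (x * y).
  by move=> Hx Hy s Hs; rewrite rmorphM Hx ?Hy.
pose x k := w ^+ m k * c k.
have Hx k : fixed H (x k) by apply: HM.
have exe : exists e, `[< forall k, Q (w^-1 ^+ e * x k) <> None >].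
  have ex k : exists e, Q (w^-1 ^+ e * x k) <> None.
    have [p [y [xE Hy Qy]]] := rational_split (Hx k).
    exists (size p).-1; rewrite xE mulrDr; apply: finD; first by rewrite pl_rat_evalV.
    apply: finM; first by rewrite (plX _ Qw').
    have [a Qa] := fin_val Qy; have := plM Qw' Qa; by rewrite mulKf // => ->.
  have [e eP] := choice ex; exists (\max_k e k); apply/asboolP => k.
  have le : (e k <= \max_k e k)%N by apply: leq_bigmax.
  rewrite -(subnK le) exprD -mulrA; apply: finM => //; by rewrite (plX _ Qw').
case: (ex_minnP exe) => e /asboolP eP mine.
have [e0|e_gt0] := posnP e.
  by move=> k; have := eP k; rewrite e0 mul1r.
have [k0 Qk0] : exists k, Q (w^-1 ^+ e.-1 * x k) = None.
  apply: contrapT => no; have : (e <= e.-1)%N.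
    by apply: mine; apply/asboolP => k Qk; apply: no; exists k.
  by rewrite leqNgt prednK // leqnn.
pose u k := w^-1 ^+ e * x k.
have wu k : w * u k = w^-1 ^+ e.-1 * x k.
  by rewrite /u -{1}(prednK e_gt0) exprS mulrA mulVKf // mulrA mulfV // mul1r.
have Hu k : fixed H (u k) by apply: HM.
have [g gE] := choice (fun k => rational_inf_split (Hu k) (eP k)).
have gk0 : g k0 != 0.
  apply/eqP => g0; have := gE k0; by rewrite g0 rmorph0 subr0 wu Qk0.
case: (@arg_maxnP _ k0 (fun i => g i != 0) m gk0) => J gJ maxJ.
exfalso; apply: (minimal_basis_reduced mbm (c := fun k => iota (g k) * w ^+ (m J - m k)) (J := J)).
- by move=> k; apply: HM.
- by rewrite subnn mulr1 fmorph_eq0.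
- apply: fin_ring_sum => k _; apply: fin_ringM => //; apply: fin_ringM.
    by rewrite -(rat_evalC iota w); apply: fin_ring_rat.
  by apply: fin_ringX; rewrite -(rat_evalX iota w); apply: fin_ring_rat.
have -> : w * (w^-1 ^+ m J * (\sum_k b k * (iota (g k) * w ^+ (m J - m k)))) =
    w^-1 ^+ e.-1 * (\sum_k b k * c k) +
    \sum_k (- (w * (u k - iota (g k)))) * (w^-1 ^+ m k * b k).
  rewrite !mulr_sumr -big_split; apply: eq_bigr => k _ /=.
  rewrite mulrBr wu opprB mulrBl.
  have -> : w^-1 ^+ e.-1 * x k * (w^-1 ^+ m k * b k) = w^-1 ^+ e.-1 * (b k * c k).
    have wm : w ^+ m k * w^-1 ^+ m k = 1 by rewrite -exprMn divff // expr1n.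
    have e4 (x1 x2 x3 x4 x5 : L) : x1 * (x2 * x3) * (x4 * x5) = x2 * x4 * (x1 * (x5 * x3)) by ring.
    by rewrite /x e4 wm mul1r.
  rewrite addrC subrK.
  have [->|/maxJ le_k] := eqVneq (g k) 0; first by rewrite rmorph0 !(mul0r, mulr0).
  have -> : w^-1 ^+ m J = w^-1 ^+ (m J - m k) * w^-1 ^+ m k by rewrite -exprD subnK.
  have wm : w^-1 ^+ (m J - m k) * w ^+ (m J - m k) = 1 by rewrite -exprMn mulVf // expr1n.
  have e4 (x1 x2 x3 x4 x5 x6 : L) : x1 * (x4 * x2 * (x3 * (x5 * x6))) = x4 * x6 * (x1 * x5 * (x2 * x3)) by ring.
  by rewrite e4 wm mul1r.
apply: inf_ringD; first by apply: inf_ringM => //; apply: inf_ringV.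
apply: inf_ring_sum => k _; apply: inf_ringM => //; apply: inf_ring_fixed; last exact/finN.
move=> s Hs; rewrite rmorphN rmorphM rmorphB HK // Hw // Hu //.
Qed.

(* If the cover is not trivial, then m J > 0 for some J. The element z that is dual to   *)
(* b J for the trace form is regular away from oo, where the cover is unramified, and by *)
(* tameness it vanishes at oo, so that z = 0.                                            *)
Lemma tame_line_cover_trivial_at a : a \in G -> a = 1%g.
Proof.
move=> Ga; apply: contrapT => /eqP a1.
have [b [m mbm]] := minimal_basis_exists; have [bbm _] := mbm; have [fb Ob Ib] := bbm.
have Mb k : M (b k) by case: (Ob k).
(* If all m k vanish, the b k are constants, and the rows of the matrix of conjugates for a and 1
   are equal. *)
have [J mJ] : exists J, (0 < m J)%N.
  apply: contrapT => no.
  have cb k : exists c, b k = iota c.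
    apply: fin_ring_inf_const => //; have := Ib k; rewrite (_ : m k = 0%N) ?mul1r //.
    by apply/eqP; rewrite eqn0Ngt; apply/negP => mk; apply: no; exists k.
  have := free_unitmx fb; rewrite unitmxE unitfE => /negP; apply.
  have G1 := group1 G.
  have ne : enum_rank_in G1 a != enum_rank_in G1 1%g.
    by apply: contra a1 => /eqP /(enum_rank_in_inj Ga G1) ->.
  apply/eqP/(determinant_alternate ne) => k; rewrite !mxE.
  by have [c ->] := cb k; rewrite !rep_fix.
have [v [vE vuniq]] := free_dual J fb.
pose z := v 1%g.
(* Uniqueness of the dual family makes it equivariant; hence v c is the conjugate act c z, and z
   lies in M. *)
have sv s c : H s -> c \in G -> s (v (c * (cls s)^-1)%g) = v c.
  move=> Hs Gc; have Gs : cls s \in G by apply: (fq_in fq).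
  apply: (vuniq (fun c => s (v (c * (cls s)^-1)%g))) => // k.
  rewrite -[RHS](rmorph_nat s) -vE rmorph_sum [RHS](reindex_inj (mulIg (cls s)^-1%g)) /=.
  apply: eq_big => [d|d Gd]; first by rewrite groupMr ?groupV.
  by rewrite rmorphM (rep_auto fq) ?groupM ?groupV // mulgKV.
have az c : c \in G -> act c z = v c.
  by move=> Gc; have := sv (act c) c (rep_in fq c) Gc; rewrite (cls_rep fq) // mulgV.
have Mz : M z.
  move=> s Bs; have Hs := fq_sub fq Bs; have := sv s 1%g Hs (group1 G).
  by rewrite (_ : cls s = 1%g) ?mulVg ?invg1 ?mulg1 //; apply/(fq_ker fq).
have trz (c : 'I_#|G| -> L) : (forall k, fixed H (c k)) ->
    \sum_(d in G) act d (z * \sum_k b k * c k) = c J.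
  move=> Hc; transitivity (\sum_k (\sum_(d in G) v d * act d (b k)) * c k).
    under [RHS]eq_bigr do rewrite mulr_suml.
    rewrite exchange_big; apply: eq_bigr => d Gd /=.
    rewrite rmorphM az // rmorph_sum mulr_sumr; apply: eq_bigr => k _.
    by rewrite rmorphM (rep_fix _ (Hc k)) mulrA.
  rewrite (bigD1 J) //= vE eqxx mul1r big1 ?addr0 // => k /negPf kJ.
  by rewrite vE kJ mul0r.
have Oz : fin_ring z.
  apply: trace_dual_fin => // y Oy; have My : M y by case: Oy.
  have [c Hc yE] := free_coordinates fb Mb My.
  by rewrite yE trz //; apply: (minimal_basis_fin mbm Hc); rewrite -yE.
have Qz d : d \in G -> Q (act d (w^-1 * (w ^+ m J * z))) = Some 0.
  apply: trace_inf => [|y Iy]; first by apply: MM => //; apply: MX.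
  have My : M y by case: Iy.
  have [c Hc yE] := free_coordinates fb Mb My.
  have -> : \sum_(d in G) act d (w ^+ m J * z * y) = w ^+ m J * c J.
    rewrite -(trz c Hc) -yE mulr_sumr; apply: eq_bigr => e _.
    by rewrite -mulrA rmorphM rmorphXn (rep_fix _ Hw).
  by apply: (minimal_basis_inf mbm Hc); rewrite -yE.
have z0 : z = 0.
  apply: (fin_ring_inf0 Oz) => d Gd; have := plM (plX (m J).-1 Qw') (Qz d Gd).
  rewrite mulr0 => <-; congr (Q _); rewrite -{2}(prednK mJ) exprS.
  rewrite !rmorphM fmorphV rmorphXn (rep_fix _ Hw).
  by rewrite -mulrA mulKf // mulrA -exprMn mulVf // expr1n mul1r.
have := vE J; rewrite eqxx big1 => [/eqP|d Gd]; first by rewrite eq_sym oner_eq0.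
by rewrite -az // z0 rmorph0 mul0r.
Qed.

End AtInfinity.

Theorem tame_line_cover_trivial a : a \in G -> a = 1%g.
Proof.
have [Q Qw] := place_inf j hw; move=> Ga.
exact: (tame_line_cover_trivial_at Qw Ga).
Qed.

End TameLine.

(** * The tree of preimages *)

Section Fibers.
Variables (K L : fieldType) (iota : {rmorphism K -> L}) (t : L) (f : {poly K}).
Variables (d : nat) (lam : labeling iota t f d).
Local Notation auto := {rmorphism L -> L}.
Local Notation fe := (feval iota f).
Implicit Types (u v w : seq 'I_d) (s : auto).

Definition autK s : Prop := forall c, s (iota c) = iota c.

Lemma iter_feval_aut s k x : autK s -> s (iter k fe x) = iter k fe (s x).
Proof.
move=> sK; elim: k x => //= k IH x; rewrite -IH /feval -horner_map -map_poly_comp.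
by congr horner; apply: eq_map_poly => c /=.
Qed.

(* The composite of the lambda_i along a word, and the point of the tree of preimages *)
(* that it labels.                                                                     *)
Fixpoint lamw v : auto := if v is i :: v' then rcomp (lab_iso lam i) (lamw v') else rid L.

Definition vert v : L := lamw v t.

Lemma lamw_cat u v x : lamw (u ++ v) x = lamw u (lamw v x).
Proof. by elim: u => //= i u IH; rewrite IH. Qed.

Lemma lamwK v : autK (lamw v).
Proof. by elim: v => //= i v IH c; rewrite /= IH lab_iso_fix. Qed.

Lemma vert_cat u v : vert (u ++ v) = lamw u (vert v).
Proof. exact: lamw_cat. Qed.

Lemma lamw_bij v : exists2 s : auto, cancel (lamw v) s & cancel s (lamw v).
Proof.
pose h := foldr (fun i g => g \o lab_inv lam i) id v.
have [hK Kh] : cancel (lamw v) h /\ cancel h (lamw v).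
  rewrite /h; elim: v {h} => //= i v [IH1 IH2].
  split=> x /=; first by rewrite lab_isoK IH1.
  by rewrite IH2 lab_invK.
have hB : zmod_morphism h.
  by move=> x y; apply: (fmorph_inj (lamw v)); rewrite rmorphB !Kh.
have hM : monoid_morphism h.
  by split=> [|x y]; apply: (fmorph_inj (lamw v)); rewrite ?rmorph1 ?rmorphM !Kh.
by exists (mk_rmorphism hB hM).
Qed.

Lemma feval_root i : fe (lab_root lam i) = t.
Proof. by have [fib _ _] := lab_rootP lam; have := fib i I. Qed.

Lemma iter_feval_vert u w : iter (size w) fe (vert (u ++ w)) = vert u.
Proof.
rewrite vert_cat -iter_feval_aut; last exact: lamwK.
congr (lamw u _); elim: w => //= i w IH.
rewrite -iterS iterSr /= -[vert (i :: w)]/(lab_iso lam i (vert w)).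
have liK : autK (lab_iso lam i) by move=> c; apply: lab_iso_fix.
by rewrite -iterSr iterS -(iter_feval_aut _ _ liK) IH lab_iso_t feval_root.
Qed.

Lemma fiber_vert0 n x : iter n fe x = t -> exists2 v, size v = n & vert v = x.
Proof.
elim: n x => [|n IH] x; first by move=> /= ->; exists [::].
rewrite iterS => fx; have [_ _ surj] := lab_rootP lam.
have [i _ ix] := surj _ (fx : iter_fiber iota t f 1 _).
have liK : autK (lab_iso lam i) by move=> c; apply: lab_iso_fix.
have [|v sv vE] := IH (lab_inv lam i x).
  by apply: (fmorph_inj (lab_iso lam i)); rewrite iter_feval_aut // lab_invK lab_iso_t.
by exists (i :: v); rewrite /= ?sv // /vert /= -/(vert v) vE lab_invK.
Qed.

Lemma vert_inj u v : size u = size v -> vert u = vert v -> u = v.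
Proof.
elim: u v => [|i u IH] [|k v] //= [suv] e.
have ik : i = k.
  have [_ inj _] := lab_rootP lam; apply: inj; rewrite ?inE //.
  have := iter_feval_vert [:: i] u; have := iter_feval_vert [:: k] v.
  by rewrite /= -suv e => -> ; rewrite /vert /= !lab_iso_t.
move: e; rewrite ik /vert /= => /(can_inj (lab_isoK lam k)) /(IH _ suv) ->.
by [].
Qed.

Lemma fiber_vert u n x : iter n fe x = vert u -> exists2 w, size w = n & vert (u ++ w) = x.
Proof.
have [h hK Kh] := lamw_bij u.
move=> e; have [|w sw wE] := @fiber_vert0 n (h x).
  by apply: (can_inj hK); rewrite iter_feval_aut ?Kh //; apply: lamwK.
by exists w; rewrite // vert_cat wE Kh.
Qed.

Lemma label_vert v : label lam (size v) (vert v) = v.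
Proof.
elim: v => //= i v IH.
have e : iter (size v) fe (vert (i :: v)) = lab_root lam i.
  by rewrite (iter_feval_vert [:: i]) /vert /= lab_iso_t.
case: pickP => [k /eqP|/(_ i)]; last by rewrite e eqxx.
rewrite e => ik; have [_ inj _] := lab_rootP lam.
have -> : k = i by apply: inj; rewrite ?inE.
by rewrite /vert /= lab_isoK IH.
Qed.

(** Elements are endomorphisms; for x = vert v they are invertible by [automorphism_inverse]. *)
Definition Aut_over (x : L) : set auto := [set s | autK s /\ s x = x].

Lemma Aut_over_iter x n : Aut_over x `<=` Aut_over (iter n fe x).
Proof. by move=> s [sK sx]; split=> //; rewrite iter_feval_aut // sx. Qed.

Lemma vert_prefix u w : vert u = iter (size w) fe (vert (u ++ w)).
Proof. by rewrite iter_feval_vert. Qed.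

Lemma Aut_over_prefix u w : Aut_over (vert (u ++ w)) `<=` Aut_over (vert u).
Proof. by rewrite (vert_prefix u w); apply: Aut_over_iter. Qed.

Lemma Aut_over_t u : Aut_over (vert u) `<=` Aut_over t.
Proof. exact: (Aut_over_prefix (u := [::])). Qed.

Lemma aut_vert s v : Aut_over t s -> exists2 v', size v' = size v & vert v' = s (vert v).
Proof.
move=> [sK st]; apply: fiber_vert0.
by rewrite -iter_feval_aut // (iter_feval_vert [::]) /vert.
Qed.

Definition word_act s v := label lam (size v) (s (vert v)).

Lemma word_actP s v : Aut_over t s ->
  size (word_act s v) = size v /\ vert (word_act s v) = s (vert v).
Proof.
by move=> /(aut_vert v)[v' sv' vE]; rewrite /word_act -vE -sv' label_vert.
Qed.

Lemma word_act_cat s u w : Aut_over t s ->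
  exists2 w', size w' = size w & word_act s (u ++ w) = word_act s u ++ w'.
Proof.
move=> ts; have [sK _] := ts.
have [sz1 v1] := word_actP (u ++ w) ts; have [sz2 v2] := word_actP u ts.
have [|w' sw' w'E] := @fiber_vert (word_act s u) (size w) (vert (word_act s (u ++ w))).
  by rewrite v1 v2 -iter_feval_aut // iter_feval_vert.
exists w' => //; apply: vert_inj => //.
by rewrite sz1 !size_cat sw' sz2.
Qed.

Section Galois.
Hypothesis hL : is_separable_closure_of (Kt iota t).

Lemma Kt_subfield x : is_subfield (Kt iota x).
Proof. exact: gen_subfield_closed. Qed.

Lemma Kt_iota x c : Kt iota x (iota c).
Proof. by move=> S [_ SA]; apply: SA; left; exists c. Qed.

Lemma Kt_gen x : Kt iota x x.
Proof. by move=> S [_ SA]; apply: SA; right. Qed.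

Lemma Kt_min x (S : set L) : is_subfield S -> (forall c, S (iota c)) -> S x -> Kt iota x `<=` S.
Proof.
move=> sS Sc Sx y; apply; split=> // z [[c _ <-]|->] //.
Qed.

Lemma Aut_over_Kt x s y : Aut_over x s -> Kt iota x y -> s y = y.
Proof.
move=> [sK sx]; apply: (Kt_min (S := [set y | s y = y])) => //.
split=> [|y1 y2 /= e1 e2|y1 y2 /= e1 e2]; rewrite /= ?rmorph1 //.
  by rewrite rmorphB e1 e2.
by rewrite fmorph_div e1 e2.
Qed.

Lemma Kt_feval x n : Kt iota x (iter n fe x).
Proof.
elim: n => [|n IH]; first exact: Kt_gen.
have [_ _ D M] := subfieldP (Kt_subfield x); have [E1 _ _] := Kt_subfield x.
rewrite iterS /feval horner_coef; elim/big_rec: _ => [|i y _ Ey].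
  by rewrite -(rmorph0 iota); apply: Kt_iota.
apply: D => //; apply: (M); first by rewrite coef_map; apply: Kt_iota.
by elim: (nat_of_ord i) => [|k IHk] //; rewrite exprS; apply: (M).
Qed.

Lemma Kt_t v : Kt iota t `<=` Kt iota (vert v).
Proof.
apply: Kt_min; [exact: Kt_subfield|exact: Kt_iota|].
by have := @Kt_feval (vert v) (size v); rewrite (iter_feval_vert [::]).
Qed.

Lemma closure_over_vert v : is_separable_closure_of (Kt iota (vert v)).
Proof.
have [scL saL] := hL; split=> // x; have [p [Ep sp px]] := saL x.
by exists p; split=> // k; apply: Kt_t.
Qed.

Lemma Aut_over_group v : auto_group (Aut_over (vert v)).
Proof.
have [scL saL] := closure_over_vert v.
split=> [|s u [sK sv] [uK uv]|s Hs|s u su [sK sv]].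
- by split.
- by split=> [c|] /=; rewrite ?uv ?sv // uK sK.
- have [u su us] := automorphism_inverse scL saL (fun e Ee => Aut_over_Kt Hs Ee).
  exists u; split=> //; have [sK sv] := Hs.
  by split=> [c|]; apply: (can_inj su); rewrite us ?sK ?sv.
- by split=> [c|]; rewrite -su // sK.
Qed.

Lemma fixed_Aut_over_Kt v x : fixed (Aut_over (vert v)) x -> Kt iota (vert v) x.
Proof.
have [scL saL] := closure_over_vert v; move=> fx.
apply: contrapT => nE; have [s sE /eqP] := fixed_subfield scL saL (Kt_subfield _) nE.
apply; apply: fx; split=> [c|]; first by apply: sE; apply: Kt_iota.
by apply: sE; apply: Kt_gen.
Qed.

Lemma fixed_Aut_over v x : fixed (Aut_over (vert v)) x -> rational iota (vert v) x.
Proof.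
move=> /fixed_Aut_over_Kt; apply: Kt_min; first exact: rational_subfield.
  by move=> c; rewrite /= -(rat_evalC iota (vert v)); apply: rational_eval.
by rewrite /= -{2}(rat_evalX iota (vert v)); apply: rational_eval.
Qed.

Local Notation Kinf := (gen_field (Kinfty_gens iota t f)).

Lemma gen_fieldP (A : set L) (x : gen_field A) : gen_subfield A (val x).
Proof. by have := gen_field_valP x; rewrite unfold_in => /asboolP. Qed.

Lemma gen_field_lift (A : set L) x : gen_subfield A x -> exists y : gen_field A, val y = x.
Proof.
move=> Ax; have Ax' : x \in in_gen_subfield A by rewrite unfold_in; apply/asboolP.
by exists (GenField Ax').
Qed.

Lemma vert_Kinf v : exists x : Kinf, val x = vert v.
Proof.
apply: gen_field_lift => S [_ SA]; apply: SA; right; exists (size v) => //.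
exact: (iter_feval_vert [::]).
Qed.

Lemma Kinf_stable s : Aut_over t s ->
  forall x, gen_subfield (Kinfty_gens iota t f) x -> gen_subfield (Kinfty_gens iota t f) (s x).
Proof.
move=> ts; have [sK st] := ts.
have [A1 AB AV] := gen_subfield_closed (Kinfty_gens iota t f).
apply: smallest_sub.
  split=> [|x y /= Ax Ay|x y /= Ax Ay] /=; first by rewrite rmorph1.
    by rewrite rmorphB; apply: AB.
  by rewrite fmorph_div; apply: AV.
move=> x [Ktx|[n _ fx]] /=.
  by rewrite (Aut_over_Kt ts) // => S [_ SA]; apply: SA; left.
move=> S [_ SA]; apply: SA; right; exists n => //=.
by rewrite /iter_fiber /= -iter_feval_aut // fx.
Qed.

Lemma Kinf_restrict s : Aut_over t s ->
  exists r : {rmorphism Kinf -> Kinf}, forall x, val (r x) = s (val x).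
Proof.
move=> ts; have ex (x : Kinf) : exists y : Kinf, val y = s (val x).
  by apply: gen_field_lift; apply: Kinf_stable => //; apply: gen_fieldP.
have [r rE] := choice ex.
have rB : zmod_morphism r by move=> x y; apply: val_inj; rewrite rmorphB /= !rE rmorphB.
have rM : monoid_morphism r.
  split=> [|x y]; apply: val_inj; rewrite ?rmorphM /= !rE ?rmorph1 //.
  by rewrite rmorphM.
by exists (mk_rmorphism rB rM).
Qed.

(** The graph of the Galois automorphism of the field generated by all fibers extends to L by
    [extend_graph]. *)
Lemma Ginfty_aut g : Ginfty lam g ->
  exists2 s, Aut_over t s & forall v, size (g v) = size v /\ vert (g v) = s (vert v).
Proof.
move=> [[bg szg preg] [r [br rfix] rE]].
have [scL saL] := hL.
pose A := [set u : L * L | exists x : Kinf, u = (val x, val (r x))].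
have [||s sE] := @extend_graph L (Kt iota t) scL saL A.
- split.
  + by exists 1; congr pair; rewrite /= rmorph1.
  + by move=> _ _ [x ->] [y ->]; exists (x - y); congr pair; rewrite /= ?rmorphB.
  + by move=> _ _ [x ->] [y ->]; exists (x * y); congr pair; rewrite /= ?rmorphM.
  + move=> b [x [x0 ->]]; have -> : x = 0 by apply: val_inj; rewrite rmorph0.
    by rewrite !rmorph0.
- move=> e Ee; have [x xe] : exists x : Kinf, val x = e.
    by apply: gen_field_lift => S [_ SA]; apply: SA; left.
  by exists x; rewrite rfix ?xe.
have sx (x : Kinf) : s (val x) = val (r x) by apply: sE; exists x.
have sKt e : Kt iota t e -> s e = e.
  move=> Ee; have [x xe] : exists x : Kinf, val x = e.
    by apply: gen_field_lift => S [_ SA]; apply: SA; left.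
  by rewrite -xe sx rfix // xe.
have ts : Aut_over t s by split=> [c|]; apply: sKt; [apply: Kt_iota|apply: Kt_gen].
exists s => // v; have [x xv] := vert_Kinf v.
have := rE (size v) x; rewrite xv => /(_ (iter_feval_vert [::] v)).
rewrite label_vert -sx xv; have [v' sv' vE] := aut_vert v ts.
by rewrite -vE -sv' label_vert => ->.
Qed.

Lemma aut_Ginfty s : Aut_over t s -> Ginfty lam (word_act s).
Proof.
move=> ts; have [sK st] := ts.
have gE v := word_actP v ts.
have [_ _ inv _] := Aut_over_group [::].
have [u [tu su us]] := inv _ ts.
have uE v := word_actP v tu.
split.
  split.
  - exists (word_act u) => v; apply: vert_inj.
    + by rewrite (uE _).1 (gE _).1.
    + by rewrite (uE _).2 (gE _).2 su.
    + by rewrite (gE _).1 (uE _).1.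
    + by rewrite (gE _).2 (uE _).2 us.
  - by move=> w; case: (gE w).
  - move=> v w /prefixP[x ->]; have [x' _ ->] := word_act_cat v x ts.
    exact: prefix_prefix.
have [r rE] := Kinf_restrict ts; have [r' r'E] := Kinf_restrict tu.
exists r.
  split; first by exists r' => x; apply: val_inj; rewrite ?(rE, r'E) ?su ?us.
  by move=> x Kx; apply: val_inj; rewrite rE (Aut_over_Kt ts).
move=> n x fx; have [v <- vE] := fiber_vert0 fx.
by rewrite rE -vE label_vert.
Qed.

End Galois.
End Fibers.

(** * Mixing in terms of automorphisms of L *)

Section Reduction.
Variables (K L : fieldType) (iota : {rmorphism K -> L}) (t : L) (f : {poly K}).
Variables (d : nat) (lam : labeling iota t f d).
Hypothesis hL : is_separable_closure_of (Kt iota t).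
Local Notation auto := {rmorphism L -> L}.
Local Notation vert := (vert lam).
Local Notation word_act := (word_act lam).
Local Notation lamw := (lamw lam).
Local Notation Aut := (Aut_over iota).
Local Notation G := (Ginfty lam).
Implicit Types (u v w : seq 'I_d) (s : auto).

Lemma word_act_eq s v v' : Aut t s -> size v' = size v -> vert v' = s (vert v) ->
  word_act s v = v'.
Proof.
move=> ts sv' v'E; have [sz vE] := word_actP lam v ts.
by apply: (@vert_inj _ _ _ _ _ _ lam); rewrite ?sz ?sv' // vE.
Qed.

Lemma GinftyP g : G g -> exists2 s, Aut t s & g = word_act s.
Proof.
move=> /(Ginfty_aut hL)[s ts gE]; exists s => //; apply/funext => v.
by have [sz vE] := gE v; rewrite (word_act_eq ts sz vE).
Qed.

(** If s sends v to v', the section at v is given by the composite of lamw v, s and the inverse of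
    lamw v'. *)
Lemma section_word_act s v : Aut t s -> exists2 r, Aut t r &
  section (word_act s) v = word_act r /\
  forall w, lamw (word_act s v) (r (vert w)) = s (vert (v ++ w)).
Proof.
move=> ts; have [sK st] := ts; have [szv vE] := word_actP lam v ts.
have [h hK Kh] := lamw_bij lam (word_act s v).
pose r := rcomp h (rcomp s (lamw v)).
have rE w : lamw (word_act s v) (r (vert w)) = s (vert (v ++ w)).
  by rewrite /r /= Kh vert_cat.
have tr : Aut t r.
  split=> [c|]; apply: (can_inj hK).
    by rewrite /r /= Kh !lamwK sK.
  by have := rE [::]; rewrite cats0 -vE.
exists r => //; split=> //; apply/funext => w; apply/esym.
rewrite /section; have [w' sw' e] := word_act_cat lam v w ts.
rewrite e -szv drop_size_cat //; apply: word_act_eq => //.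
apply: (can_inj hK); rewrite rE -vert_cat -e.
by have [_ ->] := word_actP lam (v ++ w) ts.
Qed.

Hypothesis transitive : forall v w, size v = size w ->
  exists2 s, Aut t s & s (vert v) = vert w.

(** Each r fixing t is realized as a section at v by its conjugate under lamw v, which fixes vert
    v. *)
Lemma fractal_Ginfty : fractal G.
Proof.
have secG g v : G g -> G (section g v).
  move=> /GinftyP[s ts ->]; have [r tr [-> _]] := section_word_act v ts.
  exact: aut_Ginfty.
split=> //.
  move=> v w vw; have [s ts sv] := transitive vw; exists (word_act s).
    exact: aut_Ginfty.
  exact: word_act_eq.
move=> v; apply/seteqP; split=> [_ [g [Gg _] <-]|g /GinftyP[r tr ->]]; first exact: secG.
have [h hK Kh] := lamw_bij lam v.
pose s := rcomp (lamw v) (rcomp r h); have [rK rt] := tr.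
have hKK : autK iota h by move=> c; apply: (can_inj hK); rewrite Kh lamwK.
have vs : Aut (vert v) s.
  split=> [c|]; first by rewrite /s /= hKK rK lamwK.
  by rewrite /s /= -[vert v]/(lamw v t) hK rt.
have ts : Aut t s by apply: (Aut_over_t (lam := lam) vs).
have sv : word_act s v = v by apply: word_act_eq => //; case: vs.
exists (word_act s); first by split=> //; apply: aut_Ginfty.
have [r' tr' [-> r'E]] := section_word_act v ts.
apply/funext => w; have [sz vE] := word_actP lam w tr.
apply: word_act_eq => //; apply: (can_inj hK).
by move: (r'E w); rewrite sv => ->; rewrite vert_cat /s /= hK vE.
Qed.

Hypothesis level_stab_transitive : forall n k u w1 w2, (1 <= n)%N -> (1 <= k)%N ->
    size u = n -> size w1 = k -> size w2 = k ->
  exists s, [/\ Aut t s, forall v, size v = n -> s (vert v) = vert v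
    & s (vert (u ++ w1)) = vert (u ++ w2)].
Hypothesis level_stab_sections : forall m, (1 <= m)%N -> exists N, forall n v,
    (1 <= n)%N -> (n + N <= size v)%N -> forall s, Aut (vert v) s ->
  exists s', [/\ Aut (vert v) s', forall v', size v' = n -> s' (vert v') = vert v'
    & forall w, (size w <= m)%N -> s' (vert (v ++ w)) = s (vert (v ++ w))].

(** By fractality every element of G is a section at v of some element fixing v. That element is
    changed into one that fixes level n, with the same action on m levels below v. *)
Lemma mixing_Ginfty : mixing G.
Proof.
have [secG _ fG] := fractal_Ginfty.
split; first exact: fractal_Ginfty.
  move=> n k u n1 k1 su w1 w2 sw1 sw2.
  have [s [ts sfix sw]] := level_stab_transitive n1 k1 su sw1 sw2.
  exists (word_act s); last by apply: word_act_eq; rewrite ?size_cat ?sw1 ?sw2.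
  split; first exact: aut_Ginfty.
  by move=> v sv; apply: word_act_eq => //; rewrite sfix.
move=> m m1; have [N NP] := level_stab_sections m1; exists N => n v n1 le_v.
apply/seteqP; split=> [_ [_ [g [[Gg _] _] <-] <-]|_ [g Gg <-]].
  by exists (section g v) => //; apply: secG.
have [h [Gh hv] hg] : sections_at G v g by rewrite fG.
have [s ts hE] := GinftyP Gh.
have vs : Aut (vert v) s.
  by split; [case: ts|have [_] := word_actP lam v ts; rewrite -hE hv].
have [s' [vs' s'fix s'E]] := NP n v n1 le_v s vs.
have ts' : Aut t s' by apply: (Aut_over_t (lam := lam) vs').
have s'v : word_act s' v = v by apply: word_act_eq => //; case: vs'.
exists (section (word_act s') v).
  exists (word_act s') => //; split=> //; split; first exact: aut_Ginfty.
  by move=> v' sv'; apply: word_act_eq => //; rewrite s'fix.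
apply/eq_sigLP => w; rewrite inE /= => le_w; rewrite -hg hE /section.
congr (drop _ _); have [sz vE] := word_actP lam (v ++ w) ts.
by apply: word_act_eq => //; rewrite s'E.
Qed.

End Reduction.

(** * Finite groups acting on a level *)

Section LevelQuotients.
Variables (K L : fieldType) (iota : {rmorphism K -> L}) (t : L) (f : {poly K}).
Variables (d : nat) (lam : labeling iota t f d).
Hypothesis hL : is_separable_closure_of (Kt iota t).
Local Notation auto := {rmorphism L -> L}.
Local Notation vert := (vert lam).
Local Notation word_act := (word_act lam).
Local Notation Aut := (Aut_over iota).
Implicit Types (u v w : seq 'I_d) (s : auto) (H B : set auto).

Definition level_fix (n : nat) : set auto :=
  [set s | Aut t s /\ forall v, size v = n -> s (vert v) = vert v].

Lemma level_fix_le n v s : (0 < d)%N -> level_fix n s -> (size v <= n)%N -> s (vert v) = vert v.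
Proof.
move=> d0 [ts sn] le_v; pose w := nseq (n - size v) (Ordinal d0).
have [sK _] := ts.
by rewrite (vert_prefix lam v w) iter_feval_aut // sn // size_cat size_nseq subnKC.
Qed.

Lemma level_fix_group n : auto_group (level_fix n).
Proof.
have [A1 AM AV AE] := Aut_over_group lam hL [::].
split=> [|s u [ts sn] [tu un]|s [ts sn]|s u su [ts sn]].
- by split.
- by split=> [|v sv]; [apply: AM|rewrite /= un ?sn].
- have [u [tu su us]] := AV s ts; exists u; split=> //; split=> // v sv.
  by rewrite -{1}(sn v sv) su.
- by split=> [|v sv]; [apply: AE ts|rewrite -su sn].
Qed.

Lemma level_fix_normal n s (u b : auto) : Aut t s -> Aut t u -> cancel u s ->
  level_fix n b -> level_fix n (rcomp s (rcomp b u)).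
Proof.
move=> ts tu us [tb bn]; have [A1 AM AV AE] := Aut_over_group lam hL [::].
split=> [|v sv]; first by apply: (AM) => //; apply: (AM).
have [v' sv' v'E] := aut_vert lam v tu.
by rewrite /= -v'E bn ?sv' // v'E us.
Qed.

(** H and B act on level n through permutation groups [Hb] and [Bb]. As B contains the kernel of
    this action, H / B is [Hb] / [Bb]. *)
Lemma finite_quotient_exists n H B : H `<=` Aut t -> auto_group H ->
    B `<=` H -> auto_group B -> level_fix n `<=` B ->
    (forall s (u b : auto), H s -> H u -> cancel s u -> cancel u s -> B b -> B (rcomp s (rcomp b u))) ->
  exists gT (G : {group gT}) cls, finite_quotient H B G cls.
Proof.
move=> HA gH BH gB nB nrm; have [H1 HM HV HE] := gH; have [B1 BM BV BE] := gB.
have [A1 AM AV AE] := Aut_over_group lam hL [::].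
pose T := (n.-tuple 'I_d : finType).
pose fn s (v : T) : T := insubd v (word_act s v).
pose pm s : {perm T} := if pselect (injective (fn s)) is left h then perm h else 1%g.
have fnE s (v : T) : Aut t s -> val (fn s v) = word_act s v.
  move=> ts; rewrite insubdK //; have [sz _] := word_actP lam v ts.
  by rewrite -topredE /= sz size_tuple.
have pmE s (v : T) : Aut t s -> vert (pm s v) = s (vert v).
  move=> ts; have [sz vE] := word_actP lam v ts; rewrite -vE -fnE // /pm.
  case: pselect => [h|[]]; first by rewrite permE.
  move=> v1 v2 e; apply/val_inj/(@vert_inj _ _ _ _ _ _ lam); first by rewrite !size_tuple.
  have [_ v1E] := word_actP lam v1 ts; have [_ v2E] := word_actP lam v2 ts.
  by apply: (fmorph_inj s); rewrite -v1E -v2E -!fnE // e.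
have vinj (v1 v2 : T) : vert v1 = vert v2 -> v1 = v2.
  by move=> e; apply/val_inj/(@vert_inj _ _ _ _ _ _ lam); rewrite ?size_tuple.
have pm_ext s (u : auto) : s =1 u -> pm s = pm u.
  move=> su; have e : fn s = fn u.
    by apply/funext => v; rewrite /fn /word_act su.
  by rewrite /pm e.
have pmM s (u : auto) : Aut t s -> Aut t u -> pm (rcomp s u) = (pm u * pm s)%g.
  move=> ts tu; apply/permP => v; apply: vinj.
  by rewrite permM !pmE //; apply: AM.
have pm1 s : Aut t s -> (forall v : T, s (vert v) = vert v) -> pm s = 1%g.
  by move=> ts sv; apply/permP => v; apply: vinj; rewrite pmE // sv perm1.
pose bar (C : set auto) : {set {perm T}} := [set p | `[< exists2 s, C s & pm s = p >]]%SET.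
have barP (C : set auto) p : reflect (exists2 s, C s & pm s = p) (p \in bar C).
  by rewrite inE; apply: asboolP.
have bar_group C : auto_group C -> C `<=` Aut t -> group_set (bar C).
  move=> [C1 CM _ _] CA; apply/group_setP; split.
    apply/barP; exists (rid L) => //; exact: pm1.
  move=> _ _ /barP[s Cs <-] /barP[u Cu <-]; apply/barP; exists (rcomp u s); first exact: CM.
  by rewrite pmM //; apply: CA.
have BA : B `<=` Aut t by apply: subset_trans HA.
pose Hb := Group (bar_group H gH HA); pose Bb := Group (bar_group B gB BA).
have nHB : Hb \subset 'N(Bb)%g.
  apply/fintype.subsetP => _ /barP[s Hs <-]; rewrite inE; apply/fintype.subsetP => x.
  rewrite mem_conjg => /barP[b Bb0 bE].
  have [u [Hu su us]] := HV s Hs.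
  have pu : pm u = (pm s)^-1%g.
    apply/eqP; rewrite eq_sym eq_invg_mul -pmM; [|exact: (HA)|exact: (HA)].
    by apply/eqP/pm1 => [|v]; [apply: (AM); apply: (HA)|apply: su].
  apply/barP; exists (rcomp s (rcomp b u)); first exact: nrm.
  have [ts tb tu] : [/\ Aut t s, Aut t b & Aut t u] by split; [exact: (HA)|exact: (BA)|exact: (HA)].
  rewrite !pmM //; last exact: (AM).
  by rewrite bE pu conjgE invgK !mulgA mulVg mul1g mulgKV.
exists (coset_of Bb), (Hb / Bb)%G, (fun s => coset Bb (pm s)).
have inHb s : H s -> pm s \in Hb by move=> Hs; apply/barP; exists s.
have inN s : H s -> pm s \in 'N(Bb)%g by move=> /inHb; apply: (fintype.subsetP nHB).
split=> //.
- by move=> s Hs; apply: mem_quotient; apply: inHb.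
- by move=> _ /morphimP[_ _ /barP[s Hs <-] ->]; exists s.
- by move=> s u su; rewrite (pm_ext _ _ su).
- by move=> s u Hs Hu; rewrite pmM ?morphM ?inN //; apply: (HA).
- move=> s Hs; split=> [c1|Bs]; last by apply: coset_id; apply/barP; exists s.
  have /barP[b Bb0 pE] : pm s \in Bb by apply: coset_idr => //; apply: inN.
  have [u [Bu bu ub]] := BV b Bb0.
  have [tb ts tu] : [/\ Aut t b, Aut t s & Aut t u] by split; [exact: (BA)|exact: (HA)|exact: (BA)].
  have Bus : B (rcomp u s).
    apply: nB; split=> [|v sv]; first exact: (AM).
    have [/= v' vE] : exists v' : T, val v' = v by exists (Tuple (introT eqP sv)).
    by rewrite /= -vE -pmE // -pE pmE // bu.
  apply: (BE (rcomp b (rcomp u s))) => [x|]; first by rewrite /= ub.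
  exact: (BM).
Qed.

End LevelQuotients.

(** * Ramification at infinity *)

Section Infinity.
Variables (K L : fieldType) (F : closedFieldType).
Variables (iota : {rmorphism K -> L}) (j : {rmorphism K -> F}) (t : L) (f : {poly K}).
Variables (d : nat) (lam : labeling iota t f d).
Hypothesis hK : separably_closed K.
Hypothesis ht : ~ algebraicOver iota t.
Hypothesis hL : is_separable_closure_of (Kt iota t).
Hypothesis hd : (2 <= d)%N.
Hypothesis hf : size f = d.+1.
Hypothesis htame : tame j f.
Local Notation place := (place iota j).
Local Notation auto := {rmorphism L -> L}.
Local Notation fe := (feval iota f).
Local Notation vert := (vert lam).
Local Notation Aut := (Aut_over iota).
Local Notation level_fix := (level_fix lam).
Implicit Types (u v w : seq 'I_d) (s : auto) (P Q : place).

Let d_gt0 : (0 < d)%N. Proof. exact: ltnW. Qed.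

Lemma tame_local_degree z : (0 < local_degree j f z)%N -> (local_degree j f z)%:R != 0 :> F.
Proof.
move=> e_gt0; rewrite -(rmorph_nat j) fmorph_eq0.
case: htame => [/pcharf0P ->|[p pch /(_ z)]]; first by rewrite -lt0n.
by rewrite (dvdn_pcharf pch).
Qed.

Lemma tame_degree : d%:R != 0 :> F.
Proof.
by have := @tame_local_degree None; rewrite /= size_map_poly hf; apply.
Qed.

Fixpoint iter_poly k : {poly K} := if k is k'.+1 then f \Po iter_poly k' else 'X.

Lemma iter_polyE k x : rat_eval iota x (iter_poly k) = iter k fe x.
Proof.
elim: k => [|k IH]; first exact: rat_evalX.
by rewrite /= -IH /rat_eval map_comp_poly horner_comp.
Qed.

Lemma size_iter_poly k : size (iter_poly k) = (d ^ k).+1.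
Proof.
elim: k => [|k IH]; first by rewrite size_polyX.
have := size_comp_poly f (iter_poly k); rewrite IH hf /= -expnS => e.
rewrite -e prednK // size_poly_gt0 -size_poly_eq0.
apply: contra_eqN e => /eqP ->; by rewrite eq_sym -lt0n expn_gt0 d_gt0.
Qed.

Lemma pl_feval P x : P (fe x) = P1map j f (P x).
Proof.
case Px : (P x) => [a|] /=; first exact: pl_rat_eval.
case Pfx : (P (fe x)) => [a|//].
have : P (rat_eval iota x f) <> None by rewrite -[rat_eval _ _ _]/(fe x) Pfx.
by move/(rat_eval_const Px); rewrite hf; case: d hd.
Qed.

Lemma pl_iter P k x : P (iter k fe x) = iter k (P1map j f) (P x).
Proof. by elim: k => //= k IH; rewrite pl_feval IH. Qed.

Lemma iter_P1map_None k z : (iter k (P1map j f) z == None) = (z == None).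
Proof. by elim: k => //= k <-; case: (iter _ _ _). Qed.

Lemma pl_iter_None P k x : P (iter k fe x) = None <-> P x = None.
Proof.
by rewrite pl_iter; split=> [/eqP|->]; [rewrite iter_P1map_None => /eqP|apply/eqP; rewrite iter_P1map_None].
Qed.

Lemma pl_vert_None P u : P (vert u) = None <-> P t = None.
Proof. by rewrite -(pl_iter_None P (size u)) (iter_feval_vert lam [::]). Qed.

Lemma vert_transcendental u : ~ algebraicOver iota (vert u).
Proof.
move=> /integral_algebraic au; apply: ht.
have -> : t = rat_eval iota (vert u) (iter_poly (size u)).
  by rewrite iter_polyE (iter_feval_vert lam [::]).
apply/integral_algebraic; apply: integral_horner => // x.
by move=> /(nthP 0)[i _ <-]; rewrite coef_map; apply: integral_id.
Qed.

Lemma level_fix_sub u n : (size u <= n)%N -> level_fix n `<=` Aut (vert u).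
Proof.
move=> le_u s ns; split; first by case: ns => -[].
exact: level_fix_le ns le_u.
Qed.

Lemma Aut_quotient u n : (size u <= n)%N ->
  exists gT (G : {group gT}) cls, finite_quotient (Aut (vert u)) (level_fix n) G cls.
Proof.
move=> le_u; apply: (finite_quotient_exists (lam := lam) hL (n := n)) => //.
- exact: Aut_over_t.
- exact: Aut_over_group.
- exact: level_fix_sub.
- exact: level_fix_group.
- move=> s u' b Hs Hu _ us; apply: level_fix_normal => //.
    exact: Aut_over_t Hs.
  exact: Aut_over_t Hu.
Qed.

Lemma conjugate_places_vert P Q u n : (size u <= n)%N -> P (vert u) = Q (vert u) ->
  exists2 s, Aut (vert u) s & forall y, fixed (level_fix n) y -> Q y = P (s y).
Proof.
move=> le_u PQ; have [gT [G [cls fq]]] := Aut_quotient le_u.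
apply: (conjugate_places fq hK) => [s [] //|x /(fixed_Aut_over hL)].
by apply: rational_agree => //; apply: vert_transcendental.
Qed.

Lemma vert_fixed u n : (size u <= n)%N -> fixed (level_fix n) (vert u).
Proof. by move=> le_u s ns; apply: level_fix_le ns le_u. Qed.

(** Total ramification at oo. For z in the orbit r of x, z^D has the pole order of vert u, where D =
    d^k; the product N of the -z is a polynomial g in vert u. Comparing the orders of N^D gives deg
    g * D = |r|, so r has at least D elements and is the whole fiber. *)
Lemma Aut_transitive u w1 w2 : size w1 = size w2 ->
  exists2 s, Aut (vert u) s & s (vert (u ++ w1)) = vert (u ++ w2).
Proof.
move=> sw; set n := size (u ++ w1).
have le_u : (size u <= n)%N by rewrite /n size_cat leq_addr.
have [gT [G [cls fq]]] := Aut_quotient le_u.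
set x := vert (u ++ w1); have Mx : fixed (level_fix n) x by apply: vert_fixed.
pose r := orbit_seq (Aut (vert u)) G cls x; pose k := size w1; pose D := (d ^ k)%N.
have rk z : z \in r -> iter k fe z = vert u.
  move=> /orbit_seqP[a Ga ->]; have [aK au] := rep_in fq a.
  by rewrite -iter_feval_aut // iter_feval_vert.
pose p := orbit_poly (Aut (vert u)) G cls x.
pose N := p`_0; have NE : N = \prod_(z <- r) - z.
  by rewrite /N -(horner_coef0 p) horner_prod; apply: eq_bigr => z _; rewrite hornerXsubC sub0r.
have [g gE] : exists g, N = rat_eval iota (vert u) g.
  apply: (rational_poly (j := j)); first exact: vert_transcendental.
    by apply: (fixed_Aut_over hL); apply: (orbit_poly_fixed fq).
  move=> P Pu; rewrite NE big_seq; apply: fin_prod => z /rk zE.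
  by apply: finN; rewrite -(pl_iter_None P k) zE.
have [P Pu] := place_inf j (@vert_transcendental u).
have Pz z : z \in r -> P z = None by move=> /rk zE; apply/(pl_iter_None P k); rewrite zE.
pose lc := lead_coef (iter_poly k).
have lc0 : j lc != 0 by rewrite fmorph_eq0 lead_coef_eq0 -size_poly_gt0 size_iter_poly.
have Pr z : z \in r -> P ((- z)^-1 ^+ D * vert u) = Some ((-1) ^+ D * j lc).
  move=> zr; have := pl_rat_evalV (iter_poly k) (Pz z zr).
  rewrite iter_polyE rk // size_iter_poly => /(plM (plX D (plN (pl1 P)))).
  by rewrite mulrA -exprMn mulN1r invrN.
have rN : P (N^-1 ^+ D * vert u ^+ size r) = Some (((-1) ^+ D * j lc) ^+ size r).
  have := pl_prod r (Q := mem r) (v := fun=> (-1) ^+ D * j lc) Pr.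
  rewrite -!big_seq big_split /= prodrXl !big_const_seq !count_predT !iter_mulr_1.
  by rewrite NE prodfV.
have c0 : ((-1) ^+ D * j lc) ^+ size r != 0.
  by rewrite expf_neq0 // mulf_neq0 // expf_neq0 // oppr_eq0 oner_eq0.
have N0 : N != 0.
  rewrite NE prodf_seq_neq0; apply/allP => z zr /=; rewrite oppr_eq0.
  by apply: (@pl_neq0 _ _ _ _ _ P); rewrite Pz.
have gN0 : g != 0 by apply: contraNneq N0 => g0; rewrite gE g0 /rat_eval rmorph0 horner0.
have u0 : vert u != 0 by apply: (@pl_neq0 _ _ _ _ _ P); rewrite Pu.
have Pu' := plV0 Pu; pose e := ((size g).-1 * D)%N.
have vN0 : j (lead_coef g) ^+ D * ((-1) ^+ D * j lc) ^+ size r != 0.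
  by rewrite mulf_neq0 // expf_neq0 // fmorph_eq0 lead_coef_eq0.
have Pg : P ((vert u)^-1 ^+ e * vert u ^+ size r) =
    Some (j (lead_coef g) ^+ D * ((-1) ^+ D * j lc) ^+ size r).
  rewrite -(plM (plX D (pl_rat_evalV g Pu)) rN) -gE; congr (P _).
  by rewrite exprMn -exprM -mulrA [N ^+ D * _]mulrA -exprMn divff // expr1n mul1r.
have eD : e = size r.
  have uX n1 n2 : (n1 <= n2)%N -> (vert u)^-1 ^+ n2 * vert u ^+ n1 = (vert u)^-1 ^+ (n2 - n1).
    by move=> le; rewrite -{1}(subnK le) exprD -mulrA -exprMn mulVf // expr1n mulr1.
  have Pu0 n1 n2 : (n1 < n2)%N -> P ((vert u)^-1 ^+ (n2 - n1)) = Some 0.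
    by move=> lt; rewrite (plX _ Pu') expr0n subn_eq0 leqNgt lt.
  case: (ltngtP e (size r)) => // lt; exfalso; last first.
    by move: Pg; rewrite (uX _ _ (ltnW lt)) Pu0 // => -[/esym/eqP]; apply/negP.
  have := plVN (Pu0 _ _ lt); rewrite expf_neq0 ?invr_eq0 // -(uX _ _ (ltnW lt)).
  by rewrite invfM -!exprVn invrK mulrC Pg => /(_ isT).
have r_gt0 : (0 < size r)%N.
  by have := orbit_seq_id fq Mx; rewrite -/r; case: (r).
have le_D : (D <= size r)%N.
  by rewrite -eD /e leq_pmull //; move: r_gt0; rewrite -eD muln_gt0 => /andP[].
pose fib := [seq vert (u ++ tval y) | y <- enum {: k.-tuple 'I_d}].
have sub : {subset r <= fib}.
  move=> z /rk /fiber_vert[w sw' <-]; apply/mapP.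
  by exists (Tuple (introT eqP sw')); rewrite ?mem_enum.
have le_fib : (size fib <= size r)%N.
  by rewrite size_map -cardE card_tuple card_ord.
have [_ efib] := uniq_min_size (undup_uniq _) sub le_fib.
have : vert (u ++ w2) \in r.
  rewrite efib; apply/mapP; have sw2 : size w2 == k by rewrite -sw.
  by exists (Tuple sw2); rewrite ?mem_enum.
move=> /orbit_seqP[a Ga ->]; exists (class_rep (Aut (vert u)) cls a) => //.
exact: rep_in fq a.
Qed.

(* At an infinite place the ratio y/s of two points of one level is a unit z with     *)
(* f^n(s z) = t, and z is determined by its residue because d is invertible in F.     *)
Lemma inertia_infinity P s u v n : P t = None -> Aut (vert u) s -> size v = size u ->
    (size u <= n)%N ->
    (forall y, fixed (level_fix n) y -> P (s y) = P y) -> s (vert v) = vert v.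
Proof.
move=> Pt us sv le_un sP; have [sK su] := us.
pose k := size u; pose D := (d ^ k)%N; pose q := iter_poly k.
have lc0 : j (lead_coef q) != 0 by rewrite fmorph_eq0 lead_coef_eq0 -size_poly_gt0 size_iter_poly.
have Pu : P (vert u) = None by apply/pl_vert_None.
have Pv : P (vert v) = None by apply/pl_vert_None.
have u0 : vert u != 0 by apply: (@pl_neq0 _ _ _ _ _ P); rewrite Pu.
have v0 : vert v != 0 by apply: (@pl_neq0 _ _ _ _ _ P); rewrite Pv.
have t0 : t != 0 by apply: (@pl_neq0 _ _ _ _ _ P); rewrite Pt.
have itu : iter k fe (vert u) = t by rewrite /k (iter_feval_vert lam [::]).
have itv : iter k fe (vert v) = t by rewrite /k -sv (iter_feval_vert lam [::]).
have Pq x : P x = None -> iter k fe x = t -> P (x^-1 ^+ D * t) = Some (j (lead_coef q)).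
  by move=> Px xt; have := pl_rat_evalV q Px; rewrite iter_polyE xt size_iter_poly.
pose z := vert v / vert u.
have PzD : P (z ^+ D) = Some 1.
  have := plM (plV (Pq _ Pv itv) lc0) (Pq _ Pu itu); rewrite mulVf // => <-; congr (P _).
  have key (x y : L) : x / t * (y * t) = x * y by field.
  by rewrite /z exprMn invfM !exprVn invrK key.
have D_gt0 : (0 < D)%N by rewrite expn_gt0 d_gt0.
have [b Pz] : exists b, P z = Some b.
  apply: fin_val => Pz; have := plM PzD (plX D (plV0 Pz)).
  rewrite -exprMn divff ?expr1n ?pl1 ?mul1r; last first.
    by rewrite /z mulf_neq0 ?invr_eq0.
  by rewrite expr0n eqn0Ngt D_gt0 => -[/eqP]; rewrite oner_eq0.
have b0 : b != 0.
  have := plX D Pz; rewrite PzD => -[bD].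
  by apply: contra_eq_neq bD => ->; rewrite expr0n eqn0Ngt D_gt0 /= oner_eq0.
have Psz : P (s z) = Some b.
  rewrite sP //; have [_ MV _ MM] := subfieldP (fixed_subfield_of (level_fix n)).
  by apply: MM; [|apply: MV]; apply: vert_fixed; rewrite ?sv.
pose E i := iota q`_i * (vert u ^+ i / t).
pose h := \poly_(i < D.+1) E i - 1.
have hE x : h.[x] = iter k fe (vert u * x) / t - 1.
  rewrite /h hornerD hornerN hornerC horner_poly; congr (_ - _).
  rewrite -iter_polyE /rat_eval (@horner_coef_wide _ D.+1); last first.
    by rewrite size_map_poly size_iter_poly.
  rewrite mulr_suml; apply: eq_bigr => i _.
  by rewrite /E coef_map exprMn !mulrA [LHS]mulrAC.
have uz : vert u * z = vert v by rewrite /z mulrC divfK.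
have hz : root h z.
  by rewrite /root hE uz itv divff // subrr.
have hsz : root h (s z).
  rewrite /root hE; have -> : vert u * s z = s (vert v).
    by rewrite /z fmorph_div su mulrC divfK.
  by rewrite -iter_feval_aut // itv (Aut_over_t us).2 divff // subrr.
suff zz : s z = z.
  have vE : vert v = z * vert u by rewrite /z divfK.
  by rewrite vE rmorphM zz su.
have PuD := plV (Pq _ Pu itu) lc0.
have PE i : (i <= D)%N -> P (E i) = Some (i == D)%:R.
  move=> le_i.
  have -> : E i = iota q`_i * (((vert u)^-1 ^+ D * t)^-1 * (vert u)^-1 ^+ (D - i)).
    rewrite /E; congr (_ * _); rewrite invfM !exprVn invrK -{1}(subnK le_i) exprD.
    have key (x y : L) : y != 0 -> x / t = y * x / t / y by move=> y0; field; rewrite ?y0 ?t0.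
    by apply: key; rewrite expf_neq0.
  rewrite (plM (pl_iota P _) (plM PuD (plX _ (plV0 Pu)))) expr0n subn_eq0.
  case: (ltngtP i D) le_i => // [_ _|iD _]; first by rewrite !mulr0.
  have -> : q`_i = lead_coef q by rewrite iD /lead_coef size_iter_poly.
  by rewrite mulr1 divff.
apply: (pl_simple_root (p := h) (q := 'X^D - 1) _ Psz Pz hsz hz).
  move=> i; rewrite !coefB coef_poly coefXn !coef1; apply: plB.
    case: ltnP => [|lt]; first by rewrite ltnS => /PE.
    by rewrite pl0 gtn_eqF.
  by case: eqP => _; [apply: pl1|apply: pl0].
rewrite derivB derivXn derivC subr0 /root hornerMn hornerXn -mulr_natr.
by rewrite mulf_neq0 ?expf_neq0 // /D natrX expf_neq0 // tame_degree.
Qed.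

(** Let s come from [Aut_transitive] and P lie over oo. P and P composed with the inverse of s both
    have a pole at x', so they are conjugate by some e fixing x'. Then e s preserves P and fixes
    vert u, so it fixes level n by [inertia_infinity]. *)
Lemma level_fix_transitive u w1 w2 n : size u = n -> size w1 = size w2 ->
  exists2 s, level_fix n s & s (vert (u ++ w1)) = vert (u ++ w2).
Proof.
move=> su sw; have [s us sx] := Aut_transitive u sw.
have [P Pt] := place_inf j ht.
have [r [ur sr rs]] : exists r, [/\ Aut (vert u) r, cancel s r & cancel r s].
  by have [_ _ inv _] := Aut_over_group lam hL u; apply: inv.
have [sK _] := us; have [rK _] := ur.
set x := vert (u ++ w1) in sx *; set x' := vert (u ++ w2) in sx *.
pose l := size (u ++ w2).
have Px : P x = None by apply/pl_vert_None.
have Px' : P x' = None by apply/pl_vert_None.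
have [|e x'e eP] := @conjugate_places_vert P (place_comp P rK) (u ++ w2) l (leqnn _).
  have rx' : r x' = x by rewrite -sx sr.
  by rewrite -[RHS]/(P (r x')) rx' Px.
have ue : Aut (vert u) e by apply: (Aut_over_prefix (lam := lam) x'e).
have [A1 AM AV AE] := Aut_over_group lam hL u.
have le_ul : (size u <= l)%N by rewrite /l size_cat leq_addr.
have ues : Aut (vert u) (rcomp e s) by apply: AM.
exists (rcomp e s); last by rewrite /= sx; case: x'e.
split=> [|v sv]; first exact: Aut_over_t ues.
apply: (inertia_infinity Pt ues (n := l)) => //; first by rewrite sv.
move=> y Fy; have [gT [G [cls fq]]] := Aut_quotient le_ul.
rewrite /= -eP; last exact: (fixed_stable fq).
by rewrite -[LHS]/(P (r (s y))) sr.
Qed.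

End Infinity.

(** * Critical points and tame inertia *)

Lemma mup_factor (F : fieldType) (p : {poly F}) x : p != 0 ->
  exists2 q, p = ('X - x%:P) ^+ mup x p * q & ~~ root q x.
Proof.
move=> p0; have : ('X - x%:P) ^+ mup x p %| p by rewrite -mup_geq.
move=> /dvdpP[q pE]; exists q; first by rewrite mulrC.
have : ~~ (('X - x%:P) ^+ (mup x p).+1 %| p) by rewrite -mup_ltn.
apply: contra => /factor_theorem[r qE].
by rewrite {2}pE qE exprS -mulrA dvdp_mull.
Qed.

Lemma nderivn_deriv (R : nzRingType) (p : {poly R}) n :
  (p^`N(n))^`() = p^`N(n.+1) *+ n.+1.
Proof.
apply/polyP => i; rewrite coef_deriv coefMn !coef_nderivn -!mulrnA addnS addSn.
congr (_ *+ _); rewrite mulnC [RHS]mulnC -addSn mul_bin_left.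
by congr (_ * _)%N; rewrite addSn -addnS addKn.
Qed.

Lemma coef_comp_shift (R : comNzRingType) (p : {poly R}) x i :
  (p \Po ('X + x%:P))`_i = p^`N(i).[x].
Proof.
rewrite /comp_poly addrC nderiv_taylor; last by rewrite /GRing.comm mulrC.
rewrite (eq_bigr (fun l : 'I_(size (map_poly polyC p)) => p^`N(l).[x] *: 'X^l)).
  rewrite -(poly_def _ (fun l => p^`N(l).[x])) coef_poly; case: ltnP => // le.
  by rewrite nderivn_poly0 ?horner0 // -(size_map_inj_poly (polyC_inj (R := R)) (erefl _)).
by move=> l _; rewrite nderivn_map horner_map mul_polyC.
Qed.

Section TameCriticalPoints.
Variables (K : fieldType) (F : closedFieldType) (j : {rmorphism K -> F}) (f : {poly K}).
Hypothesis hK : separably_closed K.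
Hypothesis hf : (2 < size f)%N.
Hypothesis htame : tame j f.
Local Notation fb := (map_poly j f).

Lemma sub_const_neq0 (R : nzRingType) (p : {poly R}) c : (1 < size p)%N -> p - c%:P != 0.
Proof.
move=> p1; apply/eqP => /subr0_eq pE; move: p1.
by rewrite pE ltnNge size_polyC leq_b1.
Qed.

Let fb1 : (1 < size fb)%N. Proof. by rewrite size_map_poly ltnW. Qed.

Lemma local_degree_gt0 z : (0 < local_degree j f z)%N.
Proof.
case: z => [x|] /=; last by rewrite size_map_poly -ltnS prednK ?(ltnW (ltnW hf)) // ltnW.
rewrite mup_geq ?sub_const_neq0 // expr1 dvdp_XsubCl /root.
by rewrite hornerD hornerN hornerC subrr.
Qed.

Lemma crit_deriv x : crit j f (Some x) <-> root fb^`() x.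
Proof.
have q0 : fb - (fb.[x])%:P != 0 by apply: sub_const_neq0.
have dE : (fb - (fb.[x])%:P)^`() = fb^`() by rewrite derivB derivC subr0.
rewrite /crit /= mup_geq //; split=> [/dvdpP[q qE]|rx].
  rewrite -dE qE derivM exprS expr1 derivM derivXsubC mulr1 mul1r.
  by rewrite /root !(hornerXsubC, hornerM, hornerD) subrr !(mulr0, mul0r, addr0).
have /factor_theorem[q qE] : root (fb - (fb.[x])%:P) x.
  by rewrite /root hornerD hornerN hornerC subrr.
have /factor_theorem[r rE] : root q x.
  move: rx; rewrite -dE qE derivM derivXsubC mulr1 /root.
  by rewrite !(hornerXsubC, hornerM, hornerD) subrr mulr0 add0r.
by rewrite qE rE -mulrA dvdp_mull.
Qed.

(* If x has multiplicity e in f - f(x), then x is a simple root of the Hasse derivative *)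
(* of order e - 1 of f, hence separable over K.                                          *)
Lemma crit_rational x : crit j f (Some x) -> exists c, x = j c.
Proof.
move=> cx; set e := local_degree j f (Some x) in cx.
have e2 : (2 <= e)%N by [].
pose g := fb - (fb.[x])%:P; have g0 : g != 0 by apply: sub_const_neq0.
have [h gE hx] := mup_factor x g0.
have gN i : (0 < i)%N -> fb^`N(i).[x] = ('X ^+ e * (h \Po ('X + x%:P)))`_i.
  move=> i0; have -> : 'X ^+ e * (h \Po ('X + x%:P)) = g \Po ('X + x%:P).
    rewrite [in RHS]gE rmorphM rmorphXn /= rmorphB /= comp_polyX comp_polyC addrK.
    by [].
  by rewrite coef_comp_shift nderivnB nderivnC eqn0Ngt i0 subr0.
apply: (sep_closed_simple_root hK (p := f^`N(e.-1))).
  rewrite -nderivn_map /root gN ?coefXnM; last by rewrite -subn1 subn_gt0.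
  by rewrite prednK ?leqnn // ltnW.
have -> : map_poly j (f^`N(e.-1))^`() = fb^`N(e) *+ e.
  by rewrite -deriv_map -nderivn_map nderivn_deriv prednK // ltnW.
rewrite /root hornerMn gN ?coefXnM ?ltnn ?subnn; last by rewrite ltnW.
rewrite -horner_coef0 horner_comp !hornerE -mulr_natr mulf_neq0 //.
rewrite -(rmorph_nat j) fmorph_eq0.
case: htame => [/pcharf0P ->|[p pch /(_ (Some x))]]; first by rewrite -lt0n ltnW.
by rewrite (dvdn_pcharf pch).
Qed.

End TameCriticalPoints.

Section Reductions.
Variables (K L : fieldType) (F : closedFieldType).
Variables (iota : {rmorphism K -> L}) (j : {rmorphism K -> F}).
Variable P : place iota j.

Definition reduces (p : {poly L}) (q : {poly F}) : Prop := forall i, P p`_i = Some q`_i.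

Lemma reducesC x a : P x = Some a -> reduces x%:P a%:P.
Proof. by move=> Px i; rewrite !coefC; case: eqP => // _; apply: pl0. Qed.

Lemma reducesX : reduces 'X 'X.
Proof. by move=> i; rewrite !coefX; case: eqP => _; [apply: pl1|apply: pl0]. Qed.

Lemma reducesD p q p' q' : reduces p q -> reduces p' q' -> reduces (p + p') (q + q').
Proof. by move=> pq pq' i; rewrite !coefD; apply: plD. Qed.

Lemma reducesB p q p' q' : reduces p q -> reduces p' q' -> reduces (p - p') (q - q').
Proof. by move=> pq pq' i; rewrite !coefB; apply: plB. Qed.

Lemma reducesM p q p' q' : reduces p q -> reduces p' q' -> reduces (p * p') (q * q').
Proof. by move=> pq pq' i; rewrite !coefM; apply: pl_sum => l _; apply: plM. Qed.

Lemma reducesXn n : reduces 'X^n 'X^n.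
Proof.
elim: n => [|n IH]; first exact: (reducesC (pl1 P)).
by rewrite !exprS; apply: reducesM => //; apply: reducesX.
Qed.

Lemma reduces_map (p : {poly K}) : reduces (map_poly iota p) (map_poly j p).
Proof. by move=> i; rewrite !coef_map pl_iota. Qed.

Lemma reduces_comp (p : {poly K}) q q' : reduces q q' ->
  reduces (map_poly iota p \Po q) (map_poly j p \Po q').
Proof.
move=> qq'; elim/poly_ind: p => [|p c IH]; first by rewrite !rmorph0 => i; rewrite !coef0 pl0.
rewrite !rmorphD !rmorphM /= !map_polyX !map_polyC !comp_polyX !comp_polyC.
by apply: reducesD; [apply: reducesM|apply/reducesC/pl_iota].
Qed.

End Reductions.

Section Ramification.
Variables (K L : fieldType) (F : closedFieldType).
Variables (iota : {rmorphism K -> L}) (j : {rmorphism K -> F}) (t : L) (f : {poly K}).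
Variables (d : nat) (lam : labeling iota t f d).
Hypothesis hK : separably_closed K.
Hypothesis ht : ~ algebraicOver iota t.
Hypothesis hL : is_separable_closure_of (Kt iota t).
Hypothesis hd : (2 <= d)%N.
Hypothesis hf : size f = d.+1.
Hypothesis htame : tame j f.
Local Notation place := (place iota j).
Local Notation auto := {rmorphism L -> L}.
Local Notation fe := (feval iota f).
Local Notation fb := (map_poly j f).
Local Notation fP := (P1map j f).
Local Notation vert := (vert lam).
Local Notation Aut := (Aut_over iota).
Local Notation level_fix := (level_fix lam).
Implicit Types (u v w : seq 'I_d) (s : auto) (P Q : place).

Let d_gt0 : (0 < d)%N. Proof. exact: ltnW. Qed.
Let f_gt2 : (2 < size f)%N. Proof. by rewrite hf. Qed.

Definition inertia_at (n : nat) P : set auto :=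
  [set s | Aut t s /\ forall y, fixed (level_fix n) y -> P (s y) = P y].

(** x and s x are roots of f - f(x) with the same reduction a, a simple root of the reduced
    polynomial; [pl_simple_root] identifies them. *)
Lemma noncrit_fixed P s x a : autK iota s -> s (fe x) = fe x ->
  P x = Some a -> P (s x) = P x -> ~ crit j f (Some a) -> s x = x.
Proof.
move=> sK sfx Px Psx nc; have Psx' : P (s x) = Some a by rewrite Psx.
apply: (pl_simple_root (p := map_poly iota f - (fe x)%:P)
   (q := map_poly j f - (fb.[a])%:P) _ Psx' Px).
- apply: reducesB; first exact: reduces_map.
  by apply: reducesC; apply: pl_rat_eval.
- rewrite /root hornerD hornerN hornerC -[(map_poly iota f).[_]]/(fe (s x)).
  by have := iter_feval_aut f 1 x sK => /= <-; rewrite sfx subrr.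
- by rewrite /root hornerD hornerN hornerC -[(map_poly iota f).[_]]/(fe x) subrr.
- by rewrite derivB derivC subr0; apply/negP => ra; apply: nc; apply/(crit_deriv j f_gt2).
Qed.

Fixpoint riter (n : nat) s : auto := if n is n'.+1 then rcomp s (riter n' s) else rid L.

Lemma riterE n s x : riter n s x = iter n s x.
Proof. by elim: n => //= n ->. Qed.

Lemma fixed_level_stable n s y : Aut t s -> fixed (level_fix n) y -> fixed (level_fix n) (s y).
Proof.
move=> ts Fy; have [gT [G [cls fq]]] := Aut_quotient lam hL hd (u := [::]) (leq0n n).
exact: (fixed_stable fq).
Qed.

(* Tame inertia acts on a uniformizer y = x - c through the character P (s y / y), and  *)
(* a root of unity of p-power order is trivial in characteristic p.                     *)
Lemma wild_inertia_trivial n P s (p k : nat) : p \in [pchar F] -> P t <> None ->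
    inertia_at n P s -> (forall y, fixed (level_fix n) y -> iter (p ^ k) s y = y) ->
  level_fix n s.
Proof.
move=> pch Pt [ts sP] sk; have [sK st] := ts; split=> // v sv.
have : (size v <= n)%N by rewrite sv.
elim/last_ind: v {sv} => [|v i IH] //.
rewrite size_rcons => le_v; have le_v' := ltnW le_v.
set x := vert (rcons v i).
have fx : fe x = vert v by rewrite /x -cats1; apply: (iter_feval_vert lam v [:: i]).
have sfx : s (fe x) = fe x by rewrite fx IH.
have Fx : fixed (level_fix n) x.
  by apply: vert_fixed => //; rewrite size_rcons.
have [a Px] : exists a, P x = Some a by apply: fin_val => /(pl_vert_None lam hd hf).
have Psx : P (s x) = P x by apply: sP.
have [ca|nca] := pselect (crit j f (Some a)); last exact: (noncrit_fixed sK sfx Px Psx nca).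
have [c ac] := crit_rational hK f_gt2 htame ca.
pose g := f - (f.[c])%:P.
have g0 : g != 0 by apply: sub_const_neq0; rewrite hf.
have [h gE hc] := mup_factor c g0; set e := mup c g in gE.
have e0 : e%:R != 0 :> F.
  suff -> : e = local_degree j f (Some a).
    by apply: tame_local_degree => //; apply: local_degree_gt0.
  have gb : map_poly j g = fb - (fb.[a])%:P by rewrite rmorphB /= map_polyC ac horner_map.
  rewrite /= -gb gE rmorphM rmorphXn /= map_polyXsubC -ac mupMl ?mup_XsubCX ?eqxx //.
  by rewrite ac fmorph_root.
have srat (s' : auto) z p0 : autK iota s' -> s' (rat_eval iota z p0) = rat_eval iota (s' z) p0.
  move=> s'K; rewrite /rat_eval -horner_map -map_poly_comp.
  by congr horner; apply: eq_map_poly => c' /=.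
pose y := x - iota c; pose H := rat_eval iota x h.
have y0 : y != 0.
  rewrite subr_eq0; apply/eqP => xc; apply: (vert_transcendental (lam := lam) ht (u := rcons v i)).
  by rewrite -/x xc; apply: algebraic_id.
have Ey : fe x - iota f.[c] = y ^+ e * H.
  have -> : fe x - iota f.[c] = rat_eval iota x g by rewrite rat_evalB rat_evalC.
  rewrite gE rat_evalM; congr (_ * _); rewrite /rat_eval rmorphXn horner_exp.
  by rewrite /= map_polyXsubC hornerXsubC.
have sy : s y = s x - iota c by rewrite rmorphB sK.
have sH : s H = rat_eval iota (s x) h by apply: srat.
have Esy : fe x - iota f.[c] = (s y) ^+ e * s H.
  by rewrite -rmorphXn -rmorphM -Ey rmorphB sfx sK.
set b0 := (map_poly j h).[a].
have b00 : b0 != 0 by rewrite /b0 ac horner_map fmorph_eq0.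
have PH : P H = Some b0 by apply: pl_rat_eval.
have [_ FV FD FM] := subfieldP (fixed_subfield_of (level_fix n)).
have Fc : fixed (level_fix n) (iota c) by move=> s' [[s'K _] _]; apply: s'K.
have Fy : fixed (level_fix n) y by move=> s' s'n; rewrite rmorphB Fx // Fc.
have FH : fixed (level_fix n) H.
  by move=> s' s'n; rewrite /H srat ?Fx //; case: s'n => -[].
have PsH : P (s H) = Some b0 by rewrite sP.
have sH0 : s H != 0 by apply: (@pl_neq0 _ _ _ _ _ P); rewrite PsH => -[/eqP]; apply/negP.
have sy0 : s y != 0 by rewrite fmorph_eq0.
(* Since y^e H = f(x) - f(c) is fixed by s and H reduces to the nonzero b0, z^e reduces to 1. *)
pose z := s y / y.
have ze : z ^+ e = H / s H.
  rewrite /z exprMn exprVn; apply: (mulIf sH0); rewrite divfK // mulrAC -Esy Ey.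
  by rewrite mulrAC mulfV ?mul1r // expf_neq0.
have e_gt0 : (0 < e)%N by rewrite lt0n; apply: contraNneq e0 => ->.
have Pze : P (z ^+ e) = Some 1 by rewrite ze (plM PH (plV PsH b00)) divff.
have [b Pz] : exists b, P z = Some b.
  apply: fin_val => Pz; have := plM Pze (plX e (plV0 Pz)).
  rewrite -exprMn divff ?expr1n ?pl1 ?mul1r; last by rewrite /z mulf_neq0 ?invr_eq0.
  by rewrite expr0n eqn0Ngt e_gt0 => -[/eqP]; rewrite oner_eq0.
(* The character: inertia does not change the residue b of z, so the residues multiply along the
   powers of s. *)
have Pit l : P (iter l s y / y) = Some (b ^+ l).
  elim: l => [|l IHl] /=; first by rewrite divff ?pl1.
  have Fl : fixed (level_fix n) (iter l s y / y).
    apply: FM; last exact: FV.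
    by elim: (l) => //= l' IHl'; apply: fixed_level_stable.
  have -> : s (iter l s y) / y = s (iter l s y / y) * z.
    by rewrite /z fmorph_div mulrA divfK.
  by rewrite exprSr; apply: plM => //; rewrite sP.
have b1 : b = 1.
  have := Pit (p ^ k)%N; rewrite sk // divff // pl1 => -[bq].
  have p_pr : prime p by case/andP: pch.
  have pk : [pchar F].-nat (p ^ k)%N by rewrite pnatX pnatE ?pch.
  have := exprDn_pchar (b - 1) 1 pk; rewrite subrK -bq expr1n => e1.
  have : (b - 1) ^+ (p ^ k) == 0 by apply/eqP/(addIr 1); rewrite -e1 add0r.
  by rewrite expf_eq0 subr_eq0 => /andP[_ /eqP].
have Py : P y = Some 0.
  by rewrite /y (plB Px (pl_iota P c)) ac subrr.
suff z1 : z = 1.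
  have : s y = y by rewrite -(divfK y0 (s y)) -/z z1 mul1r.
  by rewrite sy => /addIr.
(* z and 1 are both roots of Z^e h(y Z + c) - H, whose reduction b0 (Z^e - 1) has 1 as a simple root
   because e is nonzero in F; hence z = 1. *)
pose q := y%:P * 'X + (iota c)%:P.
pose Phi := 'X^e * (map_poly iota h \Po q) - H%:P.
have PhiE (z0 : L) : Phi.[z0] = z0 ^+ e * rat_eval iota (y * z0 + iota c) h - H.
  by rewrite /Phi hornerD hornerN hornerC hornerM hornerXn horner_comp /q !hornerE.
apply: (pl_simple_root (p := Phi) (q := 'X^e * (map_poly j h \Po (0%:P * 'X + (j c)%:P)) - b0%:P)
   (a := 1) (P := P)).
- apply: reducesB; last exact: reducesC.
  apply: reducesM; first exact: reducesXn.
  apply: reduces_comp; apply: reducesD; last exact/reducesC/pl_iota.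
  by apply: reducesM; [apply: reducesC|apply: reducesX].
- by rewrite Pz b1.
- exact: pl1.
- rewrite /root PhiE [y * z]mulrC divfK // sy subrK -sH ze divfK // subrr //.
- by rewrite /root PhiE expr1n mulr1 mul1r subrK subrr.
- rewrite mul0r add0r comp_polyCr -ac -/b0 derivB derivC subr0 derivM derivC mulr0 addr0 derivXn.
  by rewrite /root hornerM hornerC hornerMn hornerXn expr1n mulf_neq0.
Qed.

End Ramification.

(** * Ramification along a path *)

Section Stages.
Variables (K L : fieldType) (F : closedFieldType).
Variables (iota : {rmorphism K -> L}) (j : {rmorphism K -> F}) (t : L) (f : {poly K}).
Variables (d : nat) (lam : labeling iota t f d).
Hypothesis hK : separably_closed K.
Hypothesis ht : ~ algebraicOver iota t.
Hypothesis hL : is_separable_closure_of (Kt iota t).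
Hypothesis hd : (2 <= d)%N.
Hypothesis hf : size f = d.+1.
Hypothesis htame : tame j f.
Local Notation place := (place iota j).
Local Notation auto := {rmorphism L -> L}.
Local Notation fe := (feval iota f).
Local Notation fb := (map_poly j f).
Local Notation fP := (P1map j f).
Local Notation vert := (vert lam).
Local Notation Aut := (Aut_over iota).
Local Notation level_fix := (level_fix lam).
Local Notation inertia_at := (inertia_at lam).
Implicit Types (u w : seq 'I_d) (s r nu : auto) (P Q : place).

Let d_gt0 : (0 < d)%N. Proof. exact: ltnW. Qed.
Let f_gt2 : (2 < size f)%N. Proof. by rewrite hf. Qed.

Variables (n m : nat) (v : seq 'I_d).
Hypothesis le_nv : (n <= size v)%N.

(* The product of the stabilizer of level n and the pointwise stabilizer of the words *)
(* v w with |w| <= m.                                                                   *)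
Definition coset_fix : set auto := [set s | Aut t s /\
  exists2 nu, level_fix n nu & forall w, (size w <= m)%N -> s (vert (v ++ w)) = nu (vert (v ++ w))].

Let At := Aut_over_group lam hL [::].
Let nG := level_fix_group lam hL n.

Lemma level_fix_mono l : (n <= l)%N -> level_fix l `<=` level_fix n.
Proof.
move=> le_nl s ls; split=> [|u su]; first by case: ls.
by apply: (level_fix_le d_gt0 ls); rewrite su.
Qed.

Lemma level_fix_coset l : (n <= l)%N -> level_fix l `<=` coset_fix.
Proof. by move=> le_nl s ls; split; [case: ls|exists s => //; apply: level_fix_mono ls]. Qed.

Lemma coset_fix_group : auto_group coset_fix.
Proof.
have [A1 AM AV AE] := At; have [N1 NM NV NE] := nG.
split=> [|s1 s2 [ts1 [nu1 n1 e1]] [ts2 [nu2 n2 e2]]|s [ts [nu nn e]]|s r sr [ts [nu nn e]]].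
- by apply: (level_fix_coset (leqnn n)).
- have [s1' [ts1' s1K s1'K]] := AV _ ts1; split; first exact: AM.
  exists (rcomp (rcomp s1 (rcomp nu2 s1')) nu1).
    by apply: NM => //; apply: level_fix_normal.
  by move=> w le_w; rewrite /= -e1 // s1K e2.
- have [s' [ts' sK s'K]] := AV _ ts; have [nu' [n' nuK nu'K]] := NV _ nn.
  exists s'; split=> //; split=> //; exists (rcomp s' (rcomp nu' s)).
    exact: level_fix_normal.
  by move=> w le_w; rewrite /= e // nuK.
- split; first exact: AE ts.
  by exists nu => // w le_w; rewrite -sr e.
Qed.

(** r' moves v to another descendant of its ancestor at level n, and [level_fix_transitive] gives
    nu0 in the stabilizer of level n that moves it back. There s can be replaced by its companion
    nu. *)
Lemma coset_fix_normal s r r' : Aut (vert (take n v)) r -> Aut (vert (take n v)) r' ->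
  cancel r' r -> coset_fix s -> coset_fix (rcomp r (rcomp s r')).
Proof.
move=> ur ur' r'K [ts [nu nn e]].
have [tr tr'] : Aut t r /\ Aut t r' by split; [exact: Aut_over_t ur|exact: Aut_over_t ur'].
have [A1 AM AV AE] := At; have [N1 NM NV NE] := nG.
split; first by apply: (AM) => //; apply: AM.
set u := take n v in ur ur'; have su : size u = n by rewrite size_take_min (minn_idPl le_nv).
have vE : v = u ++ drop n v by rewrite cat_take_drop.
have [r'K' _] := tr'.
have [|w1 sw1 w1E] := @fiber_vert _ _ _ _ _ _ lam u (size (drop n v)) (r' (vert v)).
  have itv : iter (size (drop n v)) fe (vert v) = vert u.
    by have := iter_feval_vert lam u (drop n v); rewrite -vE.
  by rewrite -iter_feval_aut // itv; case: ur'.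
have [nu0 n0 nu0E] := level_fix_transitive lam hK ht hL hd hf htame su sw1.
rewrite w1E -vE in nu0E; have [nu0' [n0' nu0K nu0'K]] := NV _ n0.
have [s' [ts' sK s'K]] := AV _ ts.
exists (rcomp r (rcomp (rcomp (rcomp s (rcomp nu0' s')) (rcomp nu nu0)) r')).
  apply: level_fix_normal => //; apply: (NM); last exact: NM.
  exact: level_fix_normal.
move=> w le_w; have [[nu0a _] _] := n0.
have [|w' sw' w'E] := @fiber_vert _ _ _ _ _ _ lam v (size w) (nu0 (r' (vert (v ++ w)))).
  rewrite -(iter_feval_aut f _ _ nu0a) -(iter_feval_aut f _ _ r'K') iter_feval_vert.
  by rewrite nu0E.
by rewrite /= -w'E -e ?sw' // sK w'E nu0K.
Qed.

Let M := (size v + m)%N.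

(** The cover of the line of [vert (take k v)] cut out by [coset_fix] ramifies at P. *)
Definition ramified (k : nat) P : Prop :=
  exists s, [/\ inertia_at M P s, Aut (vert (take k v)) s & ~ coset_fix s].

Section OneStage.
Variable k : nat.
Hypotheses (le_nk : (n <= k)%N) (le_kv : (k <= size v)%N).
Let u := take k v.
Let su : size u = k. Proof. by rewrite size_take_min (minn_idPl le_kv). Qed.
Let le_uM : (size u <= M)%N. Proof. by rewrite su (leq_trans le_kv) // leq_addr. Qed.

Lemma ramified_finite P : ramified k P -> P t <> None.
Proof.
move=> [s [[ts sP] us ns]] Pt; apply: ns; apply: (level_fix_coset le_nk).
split=> // v' sv'; apply: (inertia_infinity hd hf htame Pt us (n := M)) => //.
by rewrite su.
Qed.

Lemma ramified_le k' P : (n <= k')%N -> (k' <= k)%N -> ramified k P -> ramified k' P.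
Proof.
move=> le_nk' le_k'k [s [sP us ns]]; exists s; split=> //.
have uE : u = take k' v ++ drop k' u.
  by rewrite -[LHS](cat_take_drop k') /u take_takel.
by move: us; rewrite -/u uE => /Aut_over_prefix.
Qed.

Lemma ramified_sub_prefix : Aut (vert u) `<=` Aut (vert (take n v)).
Proof.
have uE : u = take n v ++ drop n u.
  by rewrite -[LHS](cat_take_drop n) /u take_takel.
by rewrite uE; apply: Aut_over_prefix.
Qed.

End OneStage.

Lemma take_rcons_next k i0 : (k < size v)%N -> take k.+1 v = rcons (take k v) (nth i0 v k).
Proof. by move=> lt; rewrite (take_nth i0). Qed.

Lemma feval_take k : (k < size v)%N -> fe (vert (take k.+1 v)) = vert (take k v).
Proof.
move=> lt; rewrite (take_rcons_next (Ordinal d_gt0) lt) -cats1.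
exact: (iter_feval_vert lam _ [:: _]).
Qed.

(** A place Q with value b at the next point of the path is conjugate to P. The conjugate of s is
    inertia at Q, fixes that next point because b is noncritical, and stays outside [coset_fix] by
    normality. *)
Lemma ramified_lift k P b : (n <= k)%N -> (k < size v)%N -> ramified k P ->
    P (vert (take k v)) = Some fb.[b] -> ~ crit j f (Some b) ->
  exists2 Q, ramified k.+1 Q & Q (vert (take k.+1 v)) = Some b.
Proof.
move=> le_nk lt_kv [s [[ts sP] us ns]] Pu nb; have le_kv := ltnW lt_kv.
have su : size (take k v) = k by rewrite size_take_min (minn_idPl le_kv).
have su1 : size (take k.+1 v) = k.+1 by rewrite size_take_min (minn_idPl lt_kv).
have le_uM : (size (take k v) <= M)%N by rewrite su (leq_trans le_kv) // leq_addr.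
have [Q Qu1] := place_at j (vert_transcendental (lam := lam) ht (u := take k.+1 v)) b.
have PQ : P (vert (take k v)) = Q (vert (take k v)).
  by rewrite Pu -(feval_take lt_kv) (pl_feval hd hf) Qu1.
have [r ur rP] := conjugate_places_vert hK ht hL hd le_uM PQ.
have [A1 AM AV AE] := Aut_over_group lam hL (take k v).
have [r' [ur' rK r'K]] := AV _ ur.
have tr : Aut t r by apply: Aut_over_t ur.
have tr' : Aut t r' by apply: Aut_over_t ur'.
pose s' := rcomp r' (rcomp s r).
have us' : Aut (vert (take k v)) s' by apply: (AM) => //; apply: AM.
have ts' : Aut t s' by apply: Aut_over_t us'.
have Fst := fixed_level_stable hL hd.
have s'P y : fixed (level_fix M) y -> Q (s' y) = Q y.
  move=> Fy; rewrite rP; last exact: Fst.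
  by rewrite /s' /= r'K sP ?rP //; apply: Fst.
exists Q => //; exists s'; split=> //.
  have [s'K us'0] := us'; split=> //.
  apply: (noncrit_fixed hd hf s'K _ Qu1 _ nb).
    by rewrite feval_take.
  by rewrite s'P //; apply: vert_fixed => //; rewrite su1 (leq_trans lt_kv) // leq_addr.
move=> Bs'; apply: ns.
have [_ _ _ BE] := coset_fix_group.
apply: (BE (rcomp r (rcomp s' r'))) => [y|]; first by rewrite /s' /= !r'K.
by apply: coset_fix_normal => //; apply: (ramified_sub_prefix le_nk).
Qed.

(** An inertia element that fixes v but lies outside [coset_fix] fixes some v w and moves a child of
    it, so the value of P at that child is critical. *)
Lemma ramified_top P : ramified (size v) P -> exists i b,
  [/\ (1 <= i <= m)%N, crit j f (Some b) & P (vert v) = iter i fP (Some b)].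
Proof.
move=> ram; have Pt := ramified_finite le_nv (leqnn _) ram.
have [s [[ts sP] vs ns]] := ram; rewrite take_size in vs; have [sK _] := ts.
have [w [i [le_w fw mw]]] : exists w i, [/\ (size w < m)%N,
    s (vert (v ++ w)) = vert (v ++ w) & s (vert (v ++ rcons w i)) <> vert (v ++ rcons w i)].
  apply: contrapT => no; apply: ns; split=> //; exists (rid L).
    by case: nG.
  elim/last_ind => [|w i IH]; first by rewrite cats0; case: vs.
  rewrite size_rcons => lt_w /=; apply: contrapT => mw; apply: no; exists w, i.
  by split=> //; apply: IH; apply: ltnW.
set x := vert (v ++ rcons w i) in mw.
have fx : fe x = vert (v ++ w).
  by rewrite /x -cats1 catA; apply: (iter_feval_vert lam _ [:: i]).
have [a Px] : exists a, P x = Some a by apply: fin_val => /(pl_vert_None lam hd hf).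
exists (size w).+1, a; split; first by [].
  apply: contrapT => na; apply: mw; apply: (noncrit_fixed hd hf sK _ Px _ na).
    by rewrite fx fw.
  by apply: sP; apply: vert_fixed => //; rewrite size_cat size_rcons leq_add2l.
rewrite -Px -(pl_iter hd hf) iterSr fx iter_feval_vert //.
Qed.

(** Ramification is lifted along preimages until a preimage is critical or level |v| is reached,
    where [ramified_top] applies. *)
Lemma ramified_postcrit k P : (n <= k)%N -> (k <= size v)%N -> ramified k P ->
  exists i b, [/\ (1 <= i <= m + (size v - k))%N, crit j f (Some b)
    & P (vert (take k v)) = iter i fP (Some b)].
Proof.
move=> le_nk le_kv; move e : (size v - k)%N => l; elim: l k P le_nk le_kv e => [|l IH] k P le_nk le_kv e ram.
  have kE : k = size v by apply/eqP; rewrite eqn_leq le_kv -subn_eq0 e.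
  by rewrite addn0 kE take_size; apply: ramified_top; rewrite -kE.
have lt_kv : (k < size v)%N by rewrite -subn_gt0 e.
have [a Pu] : exists a, P (vert (take k v)) = Some a.
  by apply: fin_val => /(pl_vert_None lam hd hf); apply: ramified_finite ram.
have : (size (fb - a%:P)%R != 1)%N.
  rewrite size_polyDl size_map_poly hf; first by case: (d) hd.
  by rewrite size_polyN size_polyC (leq_ltn_trans (leq_b1 _)) // ltnS.
move=> /closed_rootP[b]; rewrite /root hornerD hornerN hornerC subr_eq0 => /eqP ba.
have [cb|nb] := pselect (crit j f (Some b)).
  by exists 1%N, b; split=> //; [rewrite addnS|rewrite Pu /= ba].
have [|Q ramQ Qb] := @ramified_lift k P b le_nk lt_kv ram _ nb; first by rewrite Pu ba.
have [||i [b' [/andP[i1 im] cb' iE]]] := IH k.+1 Q _ lt_kv _ ramQ.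
- exact: leqW.
- by rewrite subnS e.
exists i.+1, b'; split=> //; first by rewrite ltnS leq0n addnS ltnS.
by rewrite iterS -iE Qb Pu /= ba.
Qed.

Lemma ramified_backward k P : (n <= k)%N -> (k < size v)%N -> ramified k P ->
  forall y, fP y = P (vert (take k v)) -> (crit j f `|` postcrit j f) y.
Proof.
move=> le_nk lt_kv ram [b|]; last first.
  move=> /esym/(pl_vert_None lam hd hf) Pt; by case: (ramified_finite le_nk (ltnW lt_kv) ram).
move=> /esym Pu; have [cb|nb] := pselect (crit j f (Some b)); first by left.
right; have [Q ramQ Qb] := ramified_lift le_nk lt_kv ram Pu nb.
have [i [b' [/andP[i1 _] cb' iE]]] := ramified_postcrit (leqW le_nk) lt_kv ramQ.
by exists i => //; exists (Some b') => //; rewrite -iE.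
Qed.

Lemma riter_auto_group (H : set auto) s e : auto_group H -> H s -> H (riter e s).
Proof. by move=> [H1 HM _ _] Hs; elim: e => //= e IH; apply: HM. Qed.

Lemma cls_riter (H B : set auto) (gT : finGroupType) (G : {group gT}) cls s e :
  finite_quotient H B G cls -> H s -> cls (riter e s) = (cls s ^+ e)%g.
Proof.
move=> fq Hs; have gH := fq_group fq; elim: e => [|e IH] /=; first by rewrite (cls_id fq).
by rewrite (fq_mul fq) //; [rewrite IH expgSr|apply: riter_auto_group].
Qed.

(* At most one finite branch point for the cover cut out by coset_fix over the point   *)
(* of level k: tame_line_cover_trivial applies with parameter 1/(x - c).                *)
Lemma stage_trivial k c : (n <= k)%N -> (k <= size v)%N ->
    (forall P, ramified k P -> P (vert (take k v)) = Some (j c)) ->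
  Aut (vert (take k v)) `<=` coset_fix.
Proof.
move=> le_nk le_kv ramc; set u := take k v in ramc *.
have su : size u = k by rewrite size_take_min (minn_idPl le_kv).
have le_uM : (size u <= M)%N by rewrite su (leq_trans le_kv) // leq_addr.
have le_nM : (n <= M)%N by rewrite (leq_trans le_nv) // leq_addr.
have gC := coset_fix_group; have gH := Aut_over_group lam hL u.
have [C1 CM CV CE] := gC; have [H1 HM HV HE] := gH.
pose H := Aut (vert u); pose B : set auto := [set s | coset_fix s /\ H s].
have HA : H `<=` Aut t by apply: Aut_over_t.
have BH : B `<=` H by move=> s [].
have BA : B `<=` Aut t by move=> s /BH/HA.
have gB : auto_group B.
  split=> [|s r [Cs Hs] [Cr Hr]|s [Cs Hs]|s r sr [Cs Hs]].
  - by split.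
  - by split; [apply: CM|apply: HM].
  - have [s1 [C1' sK s1K]] := CV _ Cs; have [s2 [H2' s2K' s2K]] := HV _ Hs.
    exists s1; split=> //; split=> //; apply: (HE s2) => // y.
    by rewrite -{1}(s1K y) s2K'.
  - by split; [apply: CE Cs|apply: HE Hs].
have NB : level_fix M `<=` B.
  by move=> s Ms; split; [apply: (level_fix_coset le_nM)|apply: (level_fix_sub hd le_uM)].
have nrmB s r b : H s -> H r -> cancel s r -> cancel r s -> B b -> B (rcomp s (rcomp b r)).
  move=> Hs Hr _ rs [Cb Hb]; split; last by apply: (HM) => //; apply: HM.
  by apply: coset_fix_normal => //; apply: (ramified_sub_prefix le_nk).
have [gT [G [cls fq]]] := finite_quotient_exists hL HA gH BH gB NB nrmB.
have nrmN C : C `<=` Aut t -> forall s r b, C s -> C r -> cancel s r -> cancel r s ->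
    level_fix M b -> level_fix M (rcomp s (rcomp b r)).
  by move=> CA s r b Cs Cr _ rs Mb; apply: level_fix_normal => //; apply: (CA).
have gM := level_fix_group lam hL M.
have [gT1 [G1 [cls1 fq1]]] := finite_quotient_exists hL BA gB NB gM (fun s => id) (nrmN B BA).
have MH : level_fix M `<=` H by apply: subset_trans BH.
have [gT0 [G0 [cls0 fq0]]] := finite_quotient_exists hL HA gH MH gM (fun s => id) (nrmN H HA).
have HK s : H s -> forall c, s (iota c) = iota c by case.
have BK s : B s -> forall c, s (iota c) = iota c by move=> /BH/HK.
pose w := (vert u - iota c)^-1.
have utr := vert_transcendental (lam := lam) ht (u := u).
have uc0 : vert u - iota c != 0.
  by rewrite subr_eq0; apply: contra_notN utr => /eqP ->; apply: algebraic_id.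
have hw : ~ algebraicOver iota w.
  move=> /algebraicOverV aw; apply: utr; rewrite -(subrK (iota c) (vert u)).
  by apply: algebraic_add => //; apply: algebraic_id.
have Hw : fixed H w by move=> s [sK sx]; rewrite fmorphV rmorphB sK sx.
have Hrat x : fixed H x -> rational iota w x.
  move=> /(fixed_Aut_over_Kt hL); apply: Kt_min; first exact: rational_subfield.
    by move=> c'; rewrite /= -(rat_evalC iota w); apply: rational_eval.
  have [_ RV RD _] := subfieldP (rational_subfield iota w).
  rewrite /= -(subrK (iota c) (vert u)) -[_ - _]invrK; apply: RD.
    by apply: RV; rewrite -/w /= -{2}(rat_evalX iota w); apply: rational_eval.
  by rewrite /= -(rat_evalC iota w); apply: rational_eval.
(* An inertia class on the fixed field of B is corrected by an element of B to an automorphism that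
   is inertia up to level M. *)
have lift P a : a \in G -> (forall y, fixed B y -> P (class_rep H cls a y) = P y) ->
    exists s, [/\ inertia_at M P s, H s & cls s = a].
  move=> Ga aP; pose s0 := class_rep H cls a; have Hs0 : H s0 := rep_in fq a.
  have [|b Bb bP] := conjugate_places fq1 hK BK (P := P) (Q := place_comp P (HK _ Hs0)).
    by move=> x Bx; rewrite -[RHS]/(P (s0 x)) aP.
  have [_ _ BV _] := gB; have [b' [Bb' bK b'K]] := BV _ Bb.
  have Hs : H (rcomp s0 b') by apply: HM => //; apply: BH.
  exists (rcomp s0 b'); split=> //; last first.
    rewrite (fq_mul fq) ?(cls_rep fq) //; last exact: BH.
    by rewrite (_ : cls b' = 1%g) ?mul1g //; apply/(fq_ker fq) => //; apply: BH.
  split; first exact: HA.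
  move=> y Fy; have Fb'y : fixed (level_fix M) (b' y).
    by apply: (fixed_level_stable hL hd) => //; apply: BA.
  by have := bP _ Fb'y; rewrite b'K => <-.
have ram P s : inertia_at M P s -> H s -> cls s <> 1%g -> P (vert u) = Some (j c).
  move=> Is Hs s1; apply: ramc; exists s; split=> // Cs; apply: s1.
  by apply/(fq_ker fq).
have infP P : P w = None <-> P (vert u) = Some (j c).
  split=> [Pw|Pu].
    have := plD (plV0 Pw) (pl_iota P c); by rewrite invrK subrK add0r.
  by apply: plVN => //; rewrite (plB Pu (pl_iota P c)) subrr.
have trivial : forall a, a \in G -> a = 1%g.
  apply: (tame_line_cover_trivial (j := j) fq hK HK hw Hw Hrat) => P Pw.
    apply/setP => a; rewrite [RHS]inE inE; apply/andP/eqP => [[Ga /asboolP aP]|->]; last first.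
      by split=> //; apply/asboolP => y By; rewrite (rep1 fq).
    apply: contrapT => a1; have [s [Is Hs sa]] := lift P a Ga aP.
    by apply: Pw; apply/infP; apply: (ram P s) => //; rewrite sa.
  have Pu : P (vert u) = Some (j c) by apply/infP.
  have Pt : P t <> None by rewrite -(pl_vert_None lam hd hf P u) Pu.
  set I := inertia _ _ _ _ _.
  have IP a : reflect (a \in G /\ forall y, fixed B y -> P (class_rep H cls a y) = P y) (a \in I).
    rewrite inE; apply: (iffP andP) => [[Ga /asboolP]|[Ga aP]] //.
    by split=> //; apply/asboolP.
  have gI : group_set I.
    apply/group_setP; split; first by apply/IP; split=> // y By; rewrite (rep1 fq).
    move=> a b /IP[Ga aP] /IP[Gb bP]; apply/IP; split=> [|y By]; first exact: groupM.
    rewrite -(repM fq) // bP ?aP //; exact: (rep_fixed fq).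
  apply/negP => I0; have [|p pch] := natf0_pchar _ I0; first exact: (cardG_gt0 (Group gI)).
  have p_pr : prime p by case/andP: pch.
  have pI : (p %| #|Group gI|)%N by rewrite (dvdn_pcharf pch).
  have [a Ia oa] := Cauchy p_pr pI.
  have /IP[Ga aP] : a \in I by [].
  have [s [[ts sP] Hs sa]] := lift P a Ga aP.
  (* If p = char F divided |I|, there would be a in I of order p, lifted to s of order o modulo
     [level_fix M]. For e the part of o prime to p, s^e has p-power order, so it is trivial on level
     M by [wild_inertia_trivial]; then a^e = 1, although p does not divide e. *)
  pose o := #[cls0 s]%g; pose e := (o`_p^')%N; pose q := (o`_p)%N.
  have oE : o = (q * e)%N by rewrite partnC // order_gt0.
  have qE : q = (p ^ logn p o)%N by rewrite /q p_part.
  have Fst := fixed_level_stable hL hd (n := M).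
  have Hr : H (riter e s) by apply: riter_auto_group.
  have Ir : inertia_at M P (riter e s).
    split; first exact: HA.
    elim: (e) => //= e' IH y Fy; rewrite sP ?IH //.
    by apply: Fst => //; apply: HA; apply: riter_auto_group.
  have Mr : level_fix M (riter e s).
    apply: (wild_inertia_trivial hK ht hL hd hf htame pch Pt Ir (k := logn p o)) => y Fy.
    have Mo : level_fix M (riter o s).
      apply/(fq_ker fq0); first exact: riter_auto_group.
      by rewrite (cls_riter _ fq0) // expg_order.
    rewrite -qE -{2}(Fy _ Mo) riterE oE iterM; apply: eq_iter => x.
    by rewrite riterE.
  have pe : (p %| e)%N.
    rewrite -oa order_dvdn -sa -(cls_riter _ fq) //.
    by apply/eqP/(fq_ker fq) => //; apply: NB.
  by have := part_pnat p^' o; rewrite -/e p'natE // pe.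
move=> s us; have Gs : cls s \in G by apply: (fq_in fq).
by have /(fq_ker fq us)[] := trivial _ Gs.
Qed.

End Stages.

(** * Postcritical points and Upsilon *)

Lemma uniform_bound (T : eqType) (s : seq T) (Q : T -> nat -> Prop) :
    (forall z k k', (k <= k')%N -> Q z k -> Q z k') ->
    (forall z, z \in s -> exists k, Q z k) ->
  exists k, forall z, z \in s -> Q z k.
Proof.
move=> Qle; elim: s => [|x s IH] Qs; first by exists 0%N.
have [k1 Qk1] := Qs x (mem_head x s).
have [z sz|k2 Qk2] := IH; first by apply: Qs; rewrite in_cons sz orbT.
exists (maxn k1 k2) => z; rewrite in_cons => /orP[/eqP ->|sz].
  by apply: Qle Qk1; apply: leq_maxl.
by apply: Qle (Qk2 _ sz); apply: leq_maxr.
Qed.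

Lemma card_le1 (T : Type) (A : set T) x y : (A #<= `I_1)%card -> A x -> A y -> x = y.
Proof.
move=> /pcard_leP[g] Ax Ay.
apply: (@inj _ _ A g) => //; rewrite ?inE //.
have := @funS _ _ A `I_1 g x Ax; have := @funS _ _ A `I_1 g y Ay.
by rewrite /= !ltnS !leqn0 => /eqP -> /eqP ->.
Qed.

Section PostcriticalPoints.
Variables (K : fieldType) (F : closedFieldType) (j : {rmorphism K -> F}) (f : {poly K}).
Hypothesis hf : (2 < size f)%N.
Hypothesis htame : tame j f.
Local Notation fb := (map_poly j f).
Local Notation fP := (P1map j f).

(** Tameness at infinity makes the degree invertible in F, so the derivative is nonzero. *)
Lemma crit_finite : exists rs : seq F, forall b, crit j f (Some b) -> b \in rs.
Proof.
have [k sf] : exists k, size f = k.+3 by exists (size f - 3)%N; rewrite -addn3 subnK.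
have k0 : k.+2%:R != 0 :> F.
  rewrite -(rmorph_nat j) fmorph_eq0; have l0 : local_degree j f None = k.+2.
    by rewrite /= size_map_poly sf.
  by case: htame => [/pcharf0P ->|[p pch /(_ None)]] //; rewrite l0 (dvdn_pcharf pch).
have fb'0 : fb^`() != 0.
  apply: contra_neq k0 => fb'E; have := coef0 F k.+1.
  rewrite -fb'E coef_deriv coef_map => /eqP; rewrite -[_ *+ _]mulr_natr mulf_eq0 => /orP[|/eqP //].
  have -> : f`_k.+2 = lead_coef f by rewrite lead_coefE sf.
  by rewrite (fmorph_eq0 j) lead_coef_eq0 -size_poly_eq0 sf.
have [rs rsE] := closed_field_poly_normal fb^`().
exists rs => b /(crit_deriv j hf); rewrite rsE rootZ ?lead_coef_eq0 //.
by rewrite root_prod_XsubC.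
Qed.

(** The forward orbit of z satisfies the defining equation of Upsilon: its preimages outside itself
    are critical or postcritical, hence removed. *)
Lemma Upsilon_orbit z : postcrit j f z ->
    (forall l y, fP y = iter l fP z -> (crit j f `|` postcrit j f) y) ->
  Upsilon j f z.
Proof.
move=> [i i1 [x cx zE]] back; exists [set iter l fP z | l in [set: nat]]; last by exists 0%N.
split=> [_ [l _ <-]|].
  by rewrite -zE -iterD; exists (l + i)%N; rewrite /= ?addn_gt0 ?i1 ?orbT //; exists x.
apply/seteqP; split=> [_ [l _ <-]|y [[l _ /esym fy] ny]].
  by split=> [|[]//]; exists l.+1.
by apply: contrapT => Uy; apply: ny; split=> //; apply: back fy.
Qed.

(** Only finitely many points f^i(b) are concerned. Each one outside Upsilon has some l-th iterate
    with a preimage neither critical nor postcritical; N bounds these l. *)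
Lemma Upsilon_backward_bound m : exists N, forall i b, (1 <= i <= m)%N -> crit j f (Some b) ->
    (forall l y, (l <= N)%N -> fP y = iter l fP (iter i fP (Some b)) ->
      (crit j f `|` postcrit j f) y) ->
  Upsilon j f (iter i fP (Some b)).
Proof.
have [rs rsP] := crit_finite.
pose Q z k := postcrit j f z -> (forall l y, (l <= k)%N -> fP y = iter l fP z ->
  (crit j f `|` postcrit j f) y) -> Upsilon j f z.
pose zs := [seq iter i fP (Some b) | i <- iota 1 m, b <- rs].
have [z k k' le_k Qk zp back|z _|N NP] := @uniform_bound _ zs Q.
- by apply: Qk => // l y le_l; apply: back; apply: leq_trans le_k.
- have [zU|nzU] := pselect (Upsilon j f z); first by exists 0%N.
  have [zp|nzp] := pselect (postcrit j f z); last by exists 0%N.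
  apply: contrapT => no; apply: nzU; apply: Upsilon_orbit => // l y fy.
  apply: contrapT => ny; apply: no; exists l => _ back.
  by case: ny; apply: back fy.
exists N => i b im cb; apply: NP; last by exists i; [case/andP: im|exists (Some b)].
by apply/allpairsP; exists (i, b); rewrite /= mem_iota add1n ltnS; split=> //; apply: rsP.
Qed.

End PostcriticalPoints.

Theorem theorem6p2
  (K : fieldType) (hK : separably_closed K)
  (Kb : closedFieldType) (j : {rmorphism K -> Kb}) (hKb : is_algebraic_closure j)
  (L : fieldType) (iota : {rmorphism K -> L})
  (t : L) (ht : ~ algebraicOver iota t)
  (hL : is_separable_closure_of (Kt iota t))
  (d : nat) (hd : (2 <= d)%N)
  (f : {poly K}) (hf : size f = d.+1)
  (htame : tame j f)
  (lam : labeling iota t f d)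
  (hUpsilon : (Upsilon_K j f #<= `I_1)%card) :
  mixing (Ginfty lam).
Proof.
have f_gt2 : (2 < size f)%N by rewrite hf.
apply: (mixing_Ginfty hL).
- by move=> v w vw; apply: (Aut_transitive j lam ht hL hd hf [::] vw).
- move=> n k u w1 w2 _ _ su sw1 sw2; have sw : size w1 = size w2 by rewrite sw1.
  have [s [ts sfix] sE] := level_fix_transitive lam hK ht hL hd hf htame su sw.
  by exists s.
(* At level |v| - 1, [ramified_postcrit] bounds i by m + 1. *)
move=> m _; have [N NP] := Upsilon_backward_bound f_gt2 htame m.+1.
(* The extra level makes n + N <= |v| - 1, so that N steps towards the root from the parent of v
   stay at levels at least n. *)
exists N.+1 => n v _; rewrite addnS => lt_v s vs; have lt_nv := leq_ltn_trans (leq_addr N n) lt_v.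
have v_gt0 : (0 < size v)%N by apply: leq_trans lt_nv.
(* The parent of v, not v, is used because [ramified_backward] compares level k with level k + 1 on
   the path. *)
pose k := (size v).-1; have kE : size v = k.+1 by rewrite prednK.
have le_nv := ltnW lt_nv; have lt_kv : (k < size v)%N by rewrite kE.
have le_nNk : (n + N <= k)%N by rewrite -ltnS -kE.
have le_nk : (n <= k)%N by apply: leq_trans le_nNk; apply: leq_addr.
have ramU (P : place iota j) : ramified lam n m v k P ->
    exists2 c, Upsilon_K j f c & P (vert lam (take k v)) = Some (j c).
  move=> ram; have [i [b [im cb Pk]]] :=
    ramified_postcrit hK ht hL hd hf htame le_nv le_nk (ltnW lt_kv) ram.
  rewrite kE subSnn addn1 in im; have [b' bE] := crit_rational hK f_gt2 htame cb.
  have zE l : iter l (P1map j f) (Some (j b')) = Some (j (iter l (horner f) b')).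
    by elim: l => //= l ->; rewrite /= horner_map.
  exists (iter i (horner f) b'); last by rewrite -zE -bE.
  (* P is also ramified at level k - l, and its value there is the l-th iterate of its value at
     level k. *)
  rewrite /Upsilon_K /= -zE -bE; apply: (NP i b im cb) => l y le_l; rewrite -Pk.
  have le_lk : (l <= k - n)%N by rewrite leq_subRL // (leq_trans _ le_nNk) // leq_add2l.
  have takeE : iter l (feval iota f) (vert lam (take k v)) = vert lam (take (k - l) v).
    rewrite -[take k v](cat_take_drop (k - l)) take_takel ?leq_subr //.
    have {1}-> : l = size (drop (k - l) (take k v)).
      rewrite size_drop size_take_min (minn_idPl (ltnW lt_kv)) subKn //.
      by apply: leq_trans le_lk _; apply: leq_subr.
    exact: iter_feval_vert.
  have le_nkl : (n <= k - l)%N by rewrite leq_subRL ?(leq_trans le_lk) ?leq_subr // addnC -leq_subRL.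
  rewrite -(pl_iter hd hf) takeE.
  have lt_klv : (k - l < size v)%N by apply: leq_ltn_trans lt_kv; apply: leq_subr.
  apply: (ramified_backward hK ht hL hd hf htame le_nv le_nkl lt_klv).
  by apply: ramified_le ram => //; apply: leq_subr.
(* The points c from [ramU] all lie in [Upsilon_K], so they coincide; if nothing ramifies, c = 0
   serves. *)
have [c cP] : exists c, forall P : place iota j, ramified lam n m v k P -> P (vert lam (take k v)) = Some (j c).
  have [[P ram]|no] := pselect (exists P : place iota j, ramified lam n m v k P); last first.
    by exists 0 => P ram; case: no; exists P.
  have [c cU Pc] := ramU P ram; exists c => Q /ramU[c' c'U ->].
  by rewrite (card_le1 hUpsilon c'U cU).
have us : Aut_over iota (vert lam (take k v)) s.
  by apply: (@Aut_over_prefix _ _ _ _ _ _ lam _ (drop k v)); rewrite cat_take_drop.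
have [ts [nu nn nuE]] := stage_trivial hK ht hL hd hf htame le_nv le_nk (ltnW lt_kv) cP us.
exists nu; split=> [||w le_w]; last by rewrite nuE.
  have [[nuK _] _] := nn; split=> //; have := nuE [::] (leq0n m).
  by rewrite cats0; have [_ ->] := vs.
by case: nn.
Qed.
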